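(* Let $q\geqslant 2$ be a prime power. For every $\delta\in(0,1)$ and uniformly for complex $z$ with $|z|\leqslant q^2-\delta$, we have $$\widetilde{M_z}(n):=\sum_{f\in\widetilde{\mathcal{M}}_n}z^{\Omega(f)}=q^n n^{z-1}\left\{zh(z)+O_{\delta}\left(\frac1n\right)\right\},$$ where $$h(z)=\frac{1}{\Gamma(z+1)}\left(1-\frac1q\right)^{qz}\prod_{p\in\mathcal{P}_{\geqslant 2}}\left(1-\frac{z}{q^{\deg(p)}}\right)^{-1}\left(1-\frac{1}{q^{\deg(p)}}\right)^{z}$$ is an analytic function for $|z|<q^2$.
   Context: $\mathbb{F}_q$ is the finite field with $q$ elements; $q$ is fixed and implied constants may depend on $q$ (and here on $\delta$), but not on $n\geqslant 1$ or $z$. $\widetilde{\mathcal{M}}_n$ is the set of monic polynomials of degree $n$ in $\mathbb{F}_q[t]$ having no root in $\mathbb{F}_q$. $\mathcal{P}_{\geqslant 2}$ is the set of monic irreducible polynomials in $\mathbb{F}_q[t]$ of degree at least $2$. $\Omega(f)$ is the number of monic irreducible polynomials dividing $f$, counted with multiplicity. Complex powers of positive reals are principal: $a^z=e^{z\log a}$. The function $1/\Gamma$ is regarded as an entire function. *)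

(* Defs.v *)
From HB Require Import structures.
From mathcomp Require Import all_boot all_order all_algebra.
From mathcomp Require Import finmap.
From mathcomp Require Import all_classical all_reals all_analysis.
From mathcomp.analysis.showcase Require Import summability.
From mathcomp Require Import complex.

Set Implicit Arguments.
Unset Strict Implicit.
Unset Printing Implicit Defensive.

Import Order.TTheory GRing.Theory Num.Theory.
Import numFieldNormedType.Exports.

Local Open Scope classical_set_scope.
Local Open Scope ring_scope.
Local Open Scope complex_scope.

(* The complex plane is [R[i]] for [R : realType].  Its topology is that of the
   modulus, which the library attaches to the alias [R[i]^o].  The norm [`|z|]
   and the order of [R[i]] take values in [R[i]]; [x <= y] there means that
   [y - x] is real and nonnegative. *)

Section ComplexFunctions.
Variable R : realType.

Definition cexp (z : R[i]) : R[i] :=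
  (expR (complex.Re z))%:C *
  (cos (complex.Im z) +i* sin (complex.Im z)).

(* Principal power [a ^ z], meaningful for [0 < a] only ([ln a = 0] otherwise). *)
Definition cpow (a : R) (z : R[i]) : R[i] := cexp (z * (ln a)%:C).

(* Reciprocal of Gauss's product
   [Gamma z = lim_n  n! n^z / (z (z + 1) ... (z + n))]; unlike [Gamma] itself,
   the reciprocal has a limit at every complex [z]. *)
Definition rGamma (z : R[i]) : R[i] :=
  lim ((fun n : nat =>
    (\prod_(0 <= k < n.+1) (z + k%:R)) / (n`!%:R * cpow n%:R z) : R[i]^o)
    @ \oo).

Definition analytic_at (f : R[i] -> R[i]) (z0 : R[i]) : Prop :=
  exists a : nat -> R[i],
    \forall z \near (z0 : R[i]^o),
      series (fun k : nat => a k * (z - z0) ^+ k : R[i]^o) @ \oo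
        --> (f z : R[i]^o).

End ComplexFunctions.

Section PolynomialsOverFiniteField.
Variable F : finFieldType.

Definition deg (p : {poly F}) : nat := (size p).-1.

Definition monic_irr (p : {poly F}) : bool :=
  (p \is monic) && irreducibleb p.

Definition primes_ge2 (p : {poly F}) : bool := monic_irr p && (2 <= deg p)%N.

(* The largest [k] with [p ^ k] dividing [f], for [f != 0] and [p] nonconstant:
   then [k <= deg f < size f]. *)
Definition multiplicity (p f : {poly F}) : nat :=
  \max_(k < size f | p ^+ k %| f) k.

(* Every divisor of [f != 0] lies in the finite type [{poly_(size f) F}]. *)
Definition Omega (f : {poly F}) : nat :=
  \sum_(p : {poly_(size f) F} | monic_irr p && (val p %| f))
    multiplicity (val p) f.

Definition Mtilde (n : nat) : {set {poly_n.+1 F}} :=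
  [set f : {poly_n.+1 F} |
    [&& val f \is monic, deg (val f) == n & [forall a : F, ~~ root (val f) a]]].

End PolynomialsOverFiniteField.

Section Main.
Variables (R : realType) (F : finFieldType).
Let q : nat := #|F|.

Definition Mtilde_sum (n : nat) (z : R[i]) : R[i] :=
  \sum_(f in Mtilde F n) z ^+ Omega (val f).

Definition euler_factor (z : R[i]) (p : {poly F}) : R[i] :=
  (1 - z / (q ^ deg p)%:R)^-1 * cpow (1 - ((q ^ deg p)%:R)^-1) z.

Definition euler_partial (z : R[i]) (A : {fset {poly F}}) : R[i]^o :=
  \prod_(p <- A | primes_ge2 p) euler_factor z p.

(* Unordered infinite product: the limit along the finite sets of polynomials
   directed by inclusion. *)
Definition euler_product (z : R[i]) : R[i] := lim (euler_partial z @ totally).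

Definition h (z : R[i]) : R[i] :=
  rGamma (z + 1) * cpow (1 - (q%:R)^-1) (q%:R * z) * euler_product z.

End Main.

Arguments euler_partial {R} F z A.
Arguments euler_product {R} F z.
Arguments h {R} F z.

(* Main.v *)
(* Let F(u) be the generating series of z^Omega over monic polynomials without
   roots.  Its logarithmic derivative is z times that of 1 / (1 - q u) plus a
   remainder analytic beyond |u| = 1/q, since the sums over prime powers of
   degree m with exponent 1 cancel and |z| < q^2 controls the others.  Hence
   F = (1 - q u)^(-z) G, where the coefficients g_k of G satisfy
   sum_k |g_k| (s/q)^k = O(1) for some s > 1, uniformly in z, and G(1/q) is the
   Euler product times (1 - 1/q)^(q z).  The coefficient of u^n is a
   convolution; the rising factorials coming from (1 - q u)^(-z) are compared
   with n^(z - 1) / Gamma(z) through Gauss's product, whose error term is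
   O(1/n).

   Exponentials of power series are handled through the recurrence
   n a_n = sum_i lam_i a_(n - i) satisfied by the coefficients, which avoids any
   appeal to complex analysis.  Analyticity of h follows by writing both the
   Euler product and 1 / Gamma as a polynomial times the exponential of an
   absolutely convergent power series, since the factors
   (1 - z x)^(-1) (1 - x)^z with x = 1 / q^(deg p), and their inverses at -z
   with x = 1 / k, both have a logarithm of order x^2. *)

Require Import Defs.
From HB Require Import structures.
From mathcomp Require Import all_boot all_order all_algebra.
From mathcomp Require Import finmap.
From mathcomp Require Import all_classical all_reals all_analysis.
From mathcomp.analysis.showcase Require Import summability.
From mathcomp Require Import complex.
From mathcomp Require Import zify ring lra.

Set Implicit Arguments.
Unset Strict Implicit.
Unset Printing Implicit Defensive.

Import Order.TTheory GRing.Theory Num.Theory.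
Import numFieldNormedType.Exports.

Local Open Scope classical_set_scope.
Local Open Scope ring_scope.
Local Open Scope complex_scope.

(** * Moduli and unordered sums in the complex field *)

(** A single double family drives the proof: [log_term], indexed by a prime and an exponent. Summed
    over the exponent for each prime it gives the logarithms of the Euler factors; summed over the
    primes for each exponent, a power series in [z], hence analyticity; summed at fixed degree of
    the prime power, the coefficients of log G. Unordered sums are used because they permit these
    regroupings without enumerating the primes.

    The range |z| < q^2 is available because the linear primes, whose factor would have a pole at z
    = q, are exactly the ones excluded by the absence of roots; all remaining weights are at most
    1/q^2. No count of irreducible polynomials is made: the cancellation rests on the von Mangoldt
    sum of the constant weight 1 in degree m being q^m, which is read off from the q^n monic
    polynomials of degree n. Uniformity in [z] comes from nonnegative majorants whose constants
    depend only on a bound for |z|. Moduli are taken in the real field ([nm]), where the order is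
    total and real arithmetic tactics apply. *)

Local Notation nm := Normc.normc.

Section Modulus.
Variable R : realType.
Implicit Types (z w : R[i]) (x : R).

Lemma nmE z : `|z| = (nm z)%:C. Proof. by []. Qed.

Lemma nm_ge0 z : 0 <= nm z.
Proof. by case: z => a b; exact: sqrtr_ge0. Qed.

Lemma nm0 : nm (0 : R[i]) = 0. Proof. exact: Normc.normc0. Qed.

Lemma nm1 : nm (1 : R[i]) = 1. Proof. exact: Normc.normc1. Qed.

Lemma nmD z w : nm (z + w) <= nm z + nm w.
Proof. exact: le_normcD. Qed.

Lemma nmN z : nm (- z) = nm z. Proof. exact: normcN. Qed.

Lemma nmB z w : nm (z - w) <= nm z + nm w.
Proof. by rewrite -(nmN w); exact: nmD. Qed.

Lemma nm_distC z w : nm (z - w) = nm (w - z).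
Proof. by rewrite -nmN opprB. Qed.

Lemma nmM z w : nm (z * w) = nm z * nm w. Proof. exact: Normc.normcM. Qed.

Lemma nmV z : nm z^-1 = (nm z)^-1. Proof. exact: Normc.normcV. Qed.

Lemma nmX z n : nm (z ^+ n) = nm z ^+ n.
Proof. by elim: n => [|n IH]; rewrite ?expr0 ?nm1// !exprS nmM IH. Qed.

Lemma nmC x : nm x%:C = `|x|.
Proof. by rewrite /= expr0n/= addr0 sqrtr_sqr. Qed.

Lemma nm_nat n : nm (n%:R : R[i]) = n%:R.
Proof. by rewrite -(rmorph_nat (real_complex R)) nmC normr_nat. Qed.

Lemma nm_eq0 z : nm z = 0 -> z = 0. Proof. exact: Normc.eq0_normc. Qed.

Lemma nm_gt0 z : z != 0 -> 0 < nm z.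
Proof.
by move=> z0; rewrite lt_neqAle nm_ge0 andbT eq_sym; apply: contraNneq z0 => /nm_eq0 ->.
Qed.

Lemma nm_le_dist z w v : nm (z - w) <= nm (z - v) + nm (v - w).
Proof. by rewrite -(subrKA v z (- w)); exact: nmD. Qed.

Lemma le_nmB z w : nm z - nm w <= nm (z - w).
Proof. by rewrite lerBlDr; apply: le_trans (nmD _ _); rewrite subrK. Qed.

Lemma nm_sum (I : Type) (r : seq I) (P : pred I) (f : I -> R[i]) :
  nm (\sum_(i <- r | P i) f i) <= \sum_(i <- r | P i) nm (f i).
Proof.
elim/big_rec2: _ => [|i y x _ xy]; first by rewrite nm0.
by apply: (le_trans (nmD _ _)); rewrite lerD2l.
Qed.

Lemma Re_le_nm z : `|complex.Re z| <= nm z.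
Proof. by case: z => a b /=; rewrite -sqrtr_sqr ler_sqrt ?lerDl ?addr_ge0 ?sqr_ge0. Qed.

Lemma Im_le_nm z : `|complex.Im z| <= nm z.
Proof. by case: z => a b /=; rewrite -sqrtr_sqr ler_sqrt ?lerDr ?addr_ge0 ?sqr_ge0. Qed.

Lemma nm_le_ReIm z : nm z <= `|complex.Re z| + `|complex.Im z|.
Proof.
case: z => a b /=; rewrite -[leRHS]ger0_norm ?addr_ge0// -sqrtr_sqr.
rewrite ler_sqrt ?sqr_ge0// sqrrD !real_normK ?num_real//.
by rewrite lerD2r lerDl mulrn_wge0 ?mulr_ge0.
Qed.

End Modulus.

Lemma big_fset_iota (V : nmodType) (T : choiceType) (h : nat -> T) (F : T -> V) n :
  injective h ->
  \sum_(x <- [fset h i | i in iota 0 n]%fset) F x = \sum_(i < n) F (h i).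
Proof.
move=> hI; rewrite -(big_mkord xpredT (F \o h)) /index_iota subn0.
rewrite -(big_map h xpredT F); apply: perm_big; apply: uniq_perm.
- exact: fset_uniq.
- by rewrite map_inj_uniq ?iota_uniq.
move=> x; apply/imfsetP/mapP => -[k]/= kI ->; exists k => //.
Qed.

(** * Unordered summation: reindexing, regrouping, absolute convergence *)

Section UnorderedSums.
Variable R : realType.
Local Notation C := R[i].

(** Convergence along finite sets directed by inclusion, the same notion as [totally] in the Euler
    product, written with real errors. *)
Definition has_sum (T : choiceType) (f : T -> C) (s : C) : Prop :=
  forall e : R, 0 < e -> exists A0 : {fset T}, forall A : {fset T},
    (A0 `<=` A)%fset -> nm (\sum_(x <- A) f x - s) <= e.

(** Absolute convergence is carried by an explicit bound [B] on all finite sums, so that the same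
    [B] can serve for every [z] in a disc. *)
Definition sum_le (T : choiceType) (f : T -> R) (B : R) : Prop :=
  forall A : {fset T}, \sum_(x <- A) f x <= B.

Lemma has_sum_unique (T : choiceType) (f : T -> C) s t :
  has_sum f s -> has_sum f t -> s = t.
Proof.
move=> hs ht; apply/eqP; rewrite -subr_eq0; apply/negPn/negP => /nm_gt0 st.
have e0 : 0 < nm (s - t) / 3%:R by rewrite divr_gt0.
have [A1 h1] := hs _ e0; have [A2 h2] := ht _ e0.
have := nm_le_dist s t (\sum_(x <- (A1 `|` A2)%fset) f x).
have := h1 (A1 `|` A2)%fset (fsubsetUl _ _).
have := h2 (A1 `|` A2)%fset (fsubsetUr _ _).
rewrite (nm_distC s (\sum_(_ <- _) _)); move: st; clear.
by set a := nm _; set b := nm _; set c := nm _; lra.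
Qed.

Lemma has_sumD (T : choiceType) (f g : T -> C) s t :
  has_sum f s -> has_sum g t -> has_sum (fun x => f x + g x) (s + t).
Proof.
move=> hs ht e e0; have e20 : 0 < e / 2 by rewrite divr_gt0.
have [A1 h1] := hs _ e20; have [A2 h2] := ht _ e20.
exists (A1 `|` A2)%fset => A; rewrite fsubUset => /andP[/h1 a1 /h2 a2].
rewrite big_split/= opprD addrACA; apply: (le_trans (nmD _ _)); lra.
Qed.

Lemma has_sumZ (T : choiceType) (f : T -> C) s c :
  has_sum f s -> has_sum (fun x => c * f x) (c * s).
Proof.
move=> hs e e0; have c0 : 0 < nm c + 1 by rewrite ltr_wpDl ?nm_ge0.
have [A1 h1] := hs _ (divr_gt0 e0 c0).
exists A1 => A /h1; rewrite -mulr_sumr -mulrBr nmM ler_pdivlMr// => h.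
by apply: le_trans h; rewrite mulrC ler_wpM2l ?nm_ge0// lerDl.
Qed.

Lemma has_sumN (T : choiceType) (f : T -> C) s :
  has_sum f s -> has_sum (fun x => - f x) (- s).
Proof.
move=> /(has_sumZ (-1)); rewrite mulN1r; congr has_sum.
by apply/funext => x; rewrite mulN1r.
Qed.

Lemma has_sumB (T : choiceType) (f g : T -> C) s t :
  has_sum f s -> has_sum g t -> has_sum (fun x => f x - g x) (s - t).
Proof. by move=> hf /has_sumN; exact: has_sumD. Qed.

Lemma has_sum_finite (T : choiceType) (f : T -> C) (A : {fset T}) :
  (forall x, x \notin A -> f x = 0) -> has_sum f (\sum_(x <- A) f x).
Proof.
move=> fA e e0; exists A => B AB.
rewrite -(big_fset_incl _ AB) ?subrr ?nm0 ?ltW// => x _; exact: fA.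
Qed.

Lemma has_sum0 (T : choiceType) : has_sum (fun _ : T => 0) 0.
Proof.
move=> e e0; exists fset0 => A _; rewrite big1 ?subrr ?nm0 ?ltW//.
Qed.

(** The retraction [g] turns membership in the image of [h] into the boolean test [h (g x) == x];
    off the image [f] vanishes. *)
Lemma has_sum_reindex (S T : choiceType) (h : S -> T) (g : T -> S)
    (f : T -> C) s :
  cancel h g -> (forall x, h (g x) != x -> f x = 0) ->
  has_sum (f \o h) s -> has_sum f s.
Proof.
move=> hK f0 hs e e0; have [A0 hA0] := hs _ e0.
exists [fset h x | x in A0]%fset => A hA.
have [D DE] : exists D : {fset T}, forall x,
    (x \in D) = (x \in A) && (h (g x) == x).
  by exists [fset x in A | h (g x) == x]%fset => x; rewrite !inE.
have DA : (D `<=` A)%fset by apply/fsubsetP => x; rewrite DE => /andP[].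
rewrite -(big_fset_incl _ DA); last first.
  by move=> x xA; rewrite DE xA/= => /f0.
suff -> : \sum_(x <- D) f x = \sum_(x <- [fset g x | x in D]%fset) (f \o h) x.
  apply: hA0; apply/fsubsetP => x xA0; apply/imfsetP; exists (h x) => //=.
  by rewrite /= DE hK eqxx andbT; apply: (fsubsetP hA); apply: in_imfset.
rewrite big_imfset/=; last first.
  move=> x y xD yD gxy.
  have := xD : x \in D; have := yD : y \in D.
  by rewrite !DE => /andP[_ /eqP hy] /andP[_ /eqP hx]; rewrite -hx -hy gxy.
by rewrite big_seq [RHS]big_seq; apply: eq_bigr => x; rewrite DE => /andP[_ /eqP ->].
Qed.

Lemma sumr_const_divS (T : choiceType) (A : {fset T}) (e : R) : 0 <= e ->
  \sum_(x <- A) (e / (#|` A|.+1)%:R) <= e.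
Proof.
move=> e0; rewrite big_const_seq count_predT iter_addr_0 -(mulr_natr (e / _)).
by rewrite mulrAC ler_pdivrMr ?ltr0n// ler_wpM2l// ler_nat.
Qed.

(** For a finite set [Y] of fibres, one finite set [U] contains both [A0] and good approximating
    sets of all these fibres. Its part above [Y] has a sum close to [s] and, fibre by fibre, close
    to the sum of [r] over [Y]. *)
Lemma has_sum_fiber (T S : choiceType) (pi : T -> S) (f : T -> C) (r : S -> C) s :
  has_sum f s ->
  (forall y, has_sum (fun x => if pi x == y then f x else 0) (r y)) ->
  has_sum r s.
Proof.
move=> hs hr e e0; have e20 : 0 < e / 2 by rewrite divr_gt0.
have [A0 hA0] := hs _ e20.
exists [fset pi x | x in A0]%fset => Y A0Y.
(* Half of the error is shared among the fibres; the successor keeps the share positive when [Y] is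
   empty. *)
have d0 : 0 < e / 2 / (#|` Y|.+1)%:R by rewrite divr_gt0.
have [Ay hAy] := choice (fun y => hr y _ d0).
pose U := (A0 `|` \bigcup_(y <- Y) Ay y)%fset.
pose A := [fset x in U | pi x \in Y]%fset.
have /hA0 : (A0 `<=` A)%fset.
  apply/fsubsetP => x xA0; rewrite !inE/= xA0/=.
  by apply: (fsubsetP A0Y); apply: in_imfset.
have -> : \sum_(x <- A) f x
    = \sum_(y <- Y) \sum_(x <- U) (if pi x == y then f x else 0).
  rewrite exchange_big/= big_fset/= big_mkcond/=; apply: eq_bigr => x _.
  case: ifPn => [xY|xY].
    rewrite (big_fsetD1 (pi x))//= eqxx big_seq big1 ?addr0// => y.
    by rewrite !inE eq_sym => /andP[/negPf ->].
  rewrite big_seq big1// => y yY; case: eqP => // xy.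
  by rewrite xy yY in xY.
move=> hA.
have hY : nm (\sum_(y <- Y) r y
    - \sum_(y <- Y) \sum_(x <- U) (if pi x == y then f x else 0)) <= e / 2.
  rewrite -sumrB; apply: (le_trans (nm_sum _ _ _)).
  apply: (@le_trans _ _ (\sum_(y <- Y) (e / 2 / (#|` Y|.+1)%:R))).
    rewrite big_seq [leRHS]big_seq; apply: ler_sum => y yY.
    rewrite nm_distC; apply: hAy; rewrite /U.
    by apply/(fsubset_trans _ (fsubsetUr _ _))/bigfcup_sup.
  exact/sumr_const_divS/ltW.
by apply: (le_trans (nm_le_dist _ _ _)); apply: (le_trans (lerD hY hA)); lra.
Qed.

Lemma sum_le_mono (T : choiceType) (f g : T -> R) B :
  (forall x, f x <= g x) -> sum_le g B -> sum_le f B.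
Proof. by move=> fg hg A; apply: le_trans (hg A); apply: ler_sum. Qed.

Lemma has_sum_nm_le (T : choiceType) (f : T -> C) s B :
  has_sum f s -> sum_le (fun x => nm (f x)) B -> nm s <= B.
Proof.
move=> hs hB; apply/ler_addgt0Pr => e e0; have [A hA] := hs _ e0.
have := hA A (fsubset_refl _); rewrite nm_distC => h.
rewrite -(subrK (\sum_(x <- A) f x) s) (le_trans (nmD _ _))// addrC.
by rewrite lerD// (le_trans (nm_sum _ _ _)).
Qed.

Lemma sum_le_fiber (T S : choiceType) (pi : T -> S) (f : T -> C) (r : S -> C) B :
  sum_le (fun x => nm (f x)) B ->
  (forall y, has_sum (fun x => if pi x == y then f x else 0) (r y)) ->
  sum_le (fun y => nm (r y)) B.
Proof.
move=> hB hr Y; apply/ler_addgt0Pr => e e0.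
have d0 : 0 < e / (#|` Y|.+1)%:R by rewrite divr_gt0.
have [Ay hAy] := choice (fun y => hr y _ d0).
pose U := (\bigcup_(y <- Y) Ay y)%fset.
apply: (@le_trans _ _ (\sum_(y <- Y) (\sum_(x <- U) (if pi x == y then nm (f x) else 0)
    + e / (#|` Y|.+1)%:R))).
  rewrite big_seq [leRHS]big_seq; apply: ler_sum => y yY.
  have : (Ay y `<=` U)%fset by exact: bigfcup_sup.
  move=> /hAy; rewrite nm_distC => h.
  rewrite -(subrK (\sum_(x <- U) (if pi x == y then f x else 0)) (r y)).
  rewrite (le_trans (nmD _ _))// addrC lerD// (le_trans (nm_sum _ _ _))//.
  by apply: ler_sum => x _; case: ifP; rewrite ?nm0.
rewrite big_split/= lerD//; last exact/sumr_const_divS/ltW.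
apply: le_trans (hB U); rewrite exchange_big/=; apply: ler_sum => x _.
have [xY|xY] := boolP (pi x \in Y).
  rewrite (big_fsetD1 (pi x))//= eqxx big_seq big1 ?addr0// => y.
  by rewrite !inE eq_sym => /andP[/negPf ->].
rewrite big_seq big1 ?nm_ge0// => y yY; case: eqP => // xy.
by rewrite xy yY in xY.
Qed.

Lemma fsubset_sum_le (T : choiceType) (f : T -> R) (A B : {fset T}) :
  (forall x, 0 <= f x) -> (A `<=` B)%fset ->
  \sum_(x <- A) f x <= \sum_(x <- B) f x.
Proof.
move=> f0 AB; rewrite [leRHS](big_fsetID _ (mem A))/=.
rewrite [X in X + _](_ : _ = \sum_(x <- A) f x); first by rewrite lerDl sumr_ge0.
by apply: eq_fbigl => i; rewrite !inE/= -in_fsetI (fsetIidPr AB).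
Qed.

Lemma ge0_has_sum (T : choiceType) (f : T -> R) B :
  (forall x, 0 <= f x) -> sum_le f B ->
  exists s : R, has_sum (fun x => (f x)%:C) s%:C.
Proof.
move=> f0 hB; pose E := [set \sum_(x <- A) f x | A in [set: {fset T}]].
have Eub : has_ubound E by exists B => _ [A _ <-]; exact: hB.
have E0 : E !=set0 by exists (\sum_(x <- fset0) f x); exists fset0.
exists (sup E) => e e0.
have [_ [A0 _ <-] hA0] := sup_adherent e0 (conj E0 Eub).
exists A0 => A A0A; rewrite -rmorph_sum -rmorphB nmC ler_distl.
have le1 : \sum_(x <- A) f x <= sup E by apply: ub_le_sup => //; exists A.
have le2 : \sum_(x <- A0) f x <= \sum_(x <- A) f x.
  exact: fsubset_sum_le.
by apply/andP; split; lra.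
Qed.

(** Completeness enters through the supremum in [ge0_has_sum]. A real family is the difference of
    the nonnegative families [g + |g|] and [|g|]; a complex one is split into real and imaginary
    parts. *)
Lemma abs_has_sum (T : choiceType) (f : T -> C) B :
  sum_le (fun x => nm (f x)) B -> exists s, has_sum f s.
Proof.
move=> hB.
have real_sum (g : T -> R) : (forall x, `|g x| <= nm (f x)) ->
    exists s, has_sum (fun x => (g x)%:C) s.
  move=> gf.
  have [s1 hs1] := ge0_has_sum (fun x => normr_ge0 (g x)) (sum_le_mono gf hB).
  have ge0 x : 0 <= g x + `|g x| by have := ler_norm (- g x); rewrite normrN; lra.
  have hB2 : sum_le (fun x => g x + `|g x|) (B + B).
    move=> A; rewrite big_split/= lerD// (le_trans _ (hB A))//; last by apply: ler_sum.
    by apply: ler_sum => x _; apply: (le_trans (ler_norm _)).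
  have [s2 hs2] := ge0_has_sum ge0 hB2.
  exists (s2%:C - s1%:C).
  have -> : (fun x => (g x)%:C) = (fun x => (g x + `|g x|)%:C - (`|g x|)%:C).
    by apply/funext => x; rewrite -rmorphB addrK.
  exact: has_sumB.
have [a ha] := real_sum _ (fun x => Re_le_nm (f x)).
have [b hb] := real_sum _ (fun x => Im_le_nm (f x)).
exists (a + 'i * b).
have -> : f = (fun x => (complex.Re (f x))%:C + 'i * (complex.Im (f x))%:C).
  by apply/funext => x; rewrite -complexE.
exact/has_sumD/has_sumZ.
Qed.

Lemma has_sum_series (f : nat -> C) s : has_sum f s ->
  forall e : R, 0 < e ->
  exists N, forall n, (N <= n)%N -> nm (\sum_(i < n) f i - s) <= e.
Proof.
move=> hs e e0; have [A0 hA0] := hs _ e0.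
(* The sum of the elements of [A0] is at least each of them. *)
exists (\sum_(i <- A0) i).+1 => n hn.
rewrite -(big_fset_iota f _ (@inj_id nat)).
apply: hA0; apply/fsubsetP => i iA0; apply/imfsetP; exists i => //=.
by rewrite mem_iota/= add0n; apply: leq_ltn_trans hn; rewrite (big_fsetD1 i)//= leq_addr.
Qed.

End UnorderedSums.

(** * The complex exponential *)

Section ComplexExponential.
Variable R : realType.
Implicit Types (x y t : R) (z w : R[i]).

Lemma norm_sin_le x : `|sin x| <= `|x|.
Proof.
wlog x0 : x / 0 <= x.
  move=> H; have [/H//|/ltW x0] := leP 0 x; have := H (- x).
  by rewrite sinN !normrN; apply; rewrite oppr_ge0.
have [c _] := @MVT_segment R sin cos 0 x x0 (fun x _ => is_derive_sin x)
  (continuous_subspaceT (@continuous_sin R)).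
rewrite sin0 !subr0 => ->; rewrite normrM.
by rewrite ler_piMl// cos_max.
Qed.

(** Half-angle formula: 1 - cos x = 2 sin^2 (x / 2). *)
Lemma cos_ge_quadratic x : 1 - cos x <= x ^+ 2 / 2.
Proof.
have -> : x = (x / 2) *+ 2 by rewrite -mulr_natr divfK ?pnatr_eq0.
set y := x / 2.
have := norm_sin_le y; rewrite -(ler_sqr (x := `|_|)) ?nnegrE//.
rewrite !real_normK ?num_real// => h.
rewrite cos_mulr2n; have := cos2Dsin2 y; set c := cos y in h *; set s := sin y in h *.
move=> cs; rewrite -mulr_natr -[y *+ 2]mulr_natr; nra.
Qed.

Lemma sin_sub_le x : `|sin x - x| <= `|x| * x ^+ 2.
Proof.
wlog x0 : x / 0 <= x.
  move=> H; have [/H//|/ltW x0] := leP 0 x; have := H (- x).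
  by rewrite sinN -opprD !normrN sqrrN; apply; rewrite oppr_ge0.
have [c] := @MVT_segment R sin cos 0 x x0 (fun x _ => is_derive_sin x)
  (continuous_subspaceT (@continuous_sin R)).
rewrite in_itv/= => /andP[c0 cx].
rewrite sin0 !subr0 => ->; rewrite -{2}[x]mul1r -mulrBl normrM mulrC.
rewrite ler_wpM2l// distrC ger0_norm ?subr_ge0 ?cos_le1//.
by apply: (le_trans (cos_ge_quadratic c)); nra.
Qed.

(** Both sides come from 1 + x <= exp x, taken at [t] and at [- t]: 1 + t <= exp t <= 1 / (1 -
    t). *)
Lemma expR_le_quadratic t : `|t| <= 2^-1 -> `|expR t - 1 - t| <= 2 * t ^+ 2.
Proof.
rewrite ler_norml => /andP[t1 t2].
have h1 := expR_ge1Dx t.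
rewrite ger0_norm; last by lra.
have h2 := expR_ge1Dx (- t); rewrite expRN in h2.
have e0 := expR_gt0 t.
have : (1 - t) * expR t <= 1.
  by rewrite -ler_pdivlMr// mul1r.
have := expR_gt0 t; set u := expR t; nra.
Qed.

Lemma cexp0 : cexp 0 = 1 :> R[i].
Proof. by rewrite /cexp /= expR0 cos0 sin0 mul1r. Qed.

Lemma cexpD z w : cexp (z + w) = cexp z * cexp w.
Proof.
case: z => a b; case: w => c d; rewrite /cexp/= expRD cosD sinD.
apply/eqP; rewrite eq_complex/=; apply/andP; split; apply/eqP; ring.
Qed.

Lemma cexpN z : cexp (- z) = (cexp z)^-1.
Proof.
have h : cexp z * cexp (- z) = 1 by rewrite -cexpD subrr cexp0.
have z0 : cexp z != 0.
  by apply/eqP => e; move: h; rewrite e mul0r => /esym/eqP; rewrite oner_eq0.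
by apply: (mulfI z0); rewrite h divff.
Qed.

Lemma cexp_neq0 z : cexp z != 0.
Proof.
apply/eqP => e; have := cexpD z (- z); rewrite subrr cexp0 e mul0r.
by move/eqP; rewrite oner_eq0.
Qed.

Lemma cexp_sum (I : Type) (r : seq I) (P : pred I) (f : I -> R[i]) :
  cexp (\sum_(i <- r | P i) f i) = \prod_(i <- r | P i) cexp (f i).
Proof. by apply: (big_morph _ cexpD cexp0). Qed.

Lemma cexpMn z n : cexp (n%:R * z) = cexp z ^+ n.
Proof.
elim: n => [|n IH]; first by rewrite mul0r cexp0 expr0.
by rewrite -natr1 mulrDl mul1r cexpD IH exprSr.
Qed.

Lemma cexp_real x : cexp x%:C = (expR x)%:C.
Proof. by rewrite /cexp/= cos0 sin0 mulr1. Qed.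

Lemma nm_cexp z : nm (cexp z) = expR (complex.Re z).
Proof.
rewrite nmM nmC ger0_norm ?expR_ge0//=.
by rewrite cos2Dsin2 sqrtr1 mulr1.
Qed.

Lemma nm_cexp_le z : nm (cexp z) <= expR (nm z).
Proof. by rewrite nm_cexp ler_expR (le_trans (ler_norm _))// Re_le_nm. Qed.

Lemma cexp_quadratic_near0 w : nm w <= 2^-1 ->
  nm (cexp w - 1 - w) <= 10%:R * nm w ^+ 2.
Proof.
case: w => t y hw.
have tn := Re_le_nm (t +i* y); have yn := Im_le_nm (t +i* y).
have nw : nm (t +i* y) ^+ 2 = t ^+ 2 + y ^+ 2.
  by rewrite /= sqr_sqrtr// addr_ge0 ?sqr_ge0.
rewrite nw; rewrite /= in tn yn.
have t2 : `|t| <= 2^-1 by exact: le_trans hw.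
have y2 : `|y| <= 2^-1 by exact: le_trans hw.
apply: (le_trans (nm_le_ReIm _)) => /=; rewrite !mul0r subr0 addr0 oppr0 addr0.
have E1 := expR_le_quadratic t2.
have C1 := cos_ge_quadratic y.
have S1 := sin_sub_le y.
have S0 := norm_sin_le y.
have e0 := expR_gt0 t.
have C2 := cos_le1 y.
have e2 : expR t <= 2.
  move: E1 t2; rewrite !ler_norml => /andP[_ a] /andP[b c].
  have : 0 <= (2^-1 - t) * (2^-1 + t) by apply: mulr_ge0; lra.
  nra.
have et : `|expR t - 1| <= 2 * `|t|.
  have -> : expR t - 1 = (expR t - 1 - t) + t by ring.
  apply: (le_trans (ler_normD _ _)); have := normr_ge0 t.
  move: E1 t2; rewrite -(real_normK (num_real t)); set u := `|_ - t|; set v := `|t|; nra.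
have B1 : `|expR t * cos y - 1 - t| <= 2 * t ^+ 2 + y ^+ 2.
  have -> : expR t * cos y - 1 - t = (expR t - 1 - t) - expR t * (1 - cos y) by ring.
  apply: (le_trans (ler_normB _ _)); rewrite lerD// normrM.
  rewrite (ger0_norm (ltW e0)) ger0_norm ?subr_ge0//.
  have := ler_pM (ltW e0) _ e2 C1; rewrite subr_ge0 => /(_ C2) h.
  by apply: (le_trans h); lra.
have B2 : `|expR t * sin y - y| <= 2 * `|t| * `|y| + `|y| * y ^+ 2.
  have -> : expR t * sin y - y = (expR t - 1) * sin y + (sin y - y) by ring.
  apply: (le_trans (ler_normD _ _)); rewrite lerD// normrM.
  by rewrite ler_pM.
apply: (le_trans (lerD B1 B2)).
rewrite -(real_normK (num_real t)) -(real_normK (num_real y)).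
have := normr_ge0 t; have := normr_ge0 y; move: t2 y2.
set u := `|t|; set v := `|y| => u2 v2 v0 u0.
have : v * v ^+ 2 <= 1 * v ^+ 2 by rewrite ler_wpM2r ?sqr_ge0//; lra.
have := sqr_ge0 (u - v); rewrite sqrrB; have := sqr_ge0 u; have := sqr_ge0 v.
rewrite -mulr_natr; nra.
Qed.

(** Past |w| = 1/2 a crude bound suffices: |exp w| and 1 + |w| are both at most exp |w|, and 4 |w|^2
    >= 1. *)
Lemma cexp_quadratic w : nm (cexp w - 1 - w) <= 10%:R * nm w ^+ 2 * expR (nm w).
Proof.
have w0 := nm_ge0 w; have e1 := expR_ge1Dx (nm w).
have [h|h] := leP (nm w) 2^-1.
  apply: (le_trans (cexp_quadratic_near0 h)).
  by rewrite ler_peMr// ?mulr_ge0 ?sqr_ge0//; lra.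
apply: (le_trans (nmB _ _)); apply: (le_trans (lerD (nmB _ _) (lexx _))).
rewrite nm1; have := nm_cexp_le w; set a := nm (cexp w) => ha.
set u := nm w in w0 e1 h ha *; set e := expR u in e1 ha *.
have : 1 <= 4%:R * u ^+ 2 by nra.
set v := u ^+ 2; nra.
Qed.

Lemma cexp_linear M w : nm w <= M ->
  nm (cexp w - 1) <= (1 + 10%:R * M * expR M) * nm w.
Proof.
move=> wM; have w0 := nm_ge0 w.
have -> : cexp w - 1 = (cexp w - 1 - w) + w by ring.
apply: (le_trans (nmD _ _)); rewrite addrC mulrDl mul1r lerD2l.
apply: (le_trans (cexp_quadratic w)).
have -> : 10%:R * M * expR M * nm w = 10%:R * (nm w * M * expR M) by ring.
rewrite -mulrA ler_wpM2l//; apply: ler_pM; rewrite ?expR_ge0 ?sqr_ge0 ?ler_expR//.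
by rewrite expr2 ler_wpM2l.
Qed.

Lemma cexp_continuous z (e : R) : 0 < e -> exists2 d : R, 0 < d &
  forall w, nm (w - z) <= d -> nm (cexp w - cexp z) <= e.
Proof.
move=> e0; pose K := nm (cexp z) * (1 + 10%:R * 1 * expR 1) + 1.
have K0 : 0 < K.
  by rewrite ltr_wpDl// mulr_ge0 ?nm_ge0// addr_ge0// mulr_ge0// expR_ge0.
exists (Num.min 1 (e / K)); first by rewrite lt_min ltr01 divr_gt0.
move=> w; rewrite le_min => /andP[w1 we].
have -> : cexp w - cexp z = cexp z * (cexp (w - z) - 1).
  by rewrite mulrBr mulr1 -cexpD [z + _]addrC subrK.
rewrite nmM; apply: (le_trans (ler_wpM2l (nm_ge0 _) (cexp_linear w1))).
rewrite mulrA; apply: (@le_trans _ _ (K * nm (w - z))).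
  by rewrite ler_wpM2r ?nm_ge0// lerDl.
by rewrite mulrC -ler_pdivlMr.
Qed.

Lemma cpow1 z : cpow 1 z = 1. Proof. by rewrite /cpow ln1 mulr0 cexp0. Qed.

Lemma cpowD (a : R) z w : cpow a (z + w) = cpow a z * cpow a w.
Proof. by rewrite /cpow mulrDl cexpD. Qed.

Lemma cpowN (a : R) z : cpow a (- z) = (cpow a z)^-1.
Proof. by rewrite /cpow mulNr cexpN. Qed.

Lemma cpow_neq0 (a : R) z : cpow a z != 0. Proof. exact: cexp_neq0. Qed.

Lemma cpowM (a b : R) z : 0 < a -> 0 < b -> cpow (a * b) z = cpow a z * cpow b z.
Proof. by move=> a0 b0; rewrite /cpow lnM// rmorphD mulrDr cexpD. Qed.

Lemma cpowV (a : R) z : 0 < a -> cpow a^-1 z = (cpow a z)^-1.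
Proof. by move=> a0; rewrite /cpow lnV// rmorphN mulrN cexpN. Qed.

Lemma cpow_1r (a : R) : 0 < a -> cpow a 1 = a%:C.
Proof. by move=> a0; rewrite /cpow mul1r cexp_real lnK. Qed.

Lemma nm_cpow (a : R) z : nm (cpow a z) = expR (complex.Re z * ln a).
Proof. by rewrite nm_cexp; case: z => x y /=; rewrite mulr0 subr0. Qed.

End ComplexExponential.

(** * Power series with a given logarithmic derivative *)

Section Convolution.
Variable K : comNzRingType.
Implicit Types a b c : nat -> K.

Definition conv a b (n : nat) : K := \sum_(i < n.+1) a i * b (n - i)%N.

(** Up to a given degree, convolution is multiplication of truncated polynomials; commutativity and
    associativity are inherited from [{poly K}]. *)
Lemma conv_coef a b N n : (n < N)%N ->
  conv a b n = (\poly_(i < N) a i * \poly_(i < N) b i)`_n.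
Proof.
move=> nN; rewrite coefM; apply: eq_bigr => i _; rewrite !coef_poly.
have -> : (i < N)%N by have := ltn_ord i; lia.
by have -> : (n - i < N)%N by lia.
Qed.

Lemma convC a b n : conv a b n = conv b a n.
Proof. by rewrite !(@conv_coef _ _ n.+1)// mulrC. Qed.

Lemma convA a b c n : conv a (conv b c) n = conv (conv a b) c n.
Proof.
pose P (u : nat -> K) : {poly K} := \poly_(i < n.+1) u i.
have trunc (u v : nat -> K) (p : {poly K}) i : (i <= n)%N ->
    (P (conv u v) * p)`_i = (P u * P v * p)`_i.
  move=> iN; rewrite !coefM; apply: eq_bigr => j _; congr (_ * _).
  have jN : (j < n.+1)%N by have := ltn_ord j; lia.
  by rewrite /P coef_poly jN (conv_coef _ _ jN).
rewrite (@conv_coef _ _ n.+1)// -/(P _) -/(P _) [RHS](@conv_coef _ _ n.+1)//.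
by rewrite -/(P _) -/(P _) [P a * _]mulrC !trunc// mulrC mulrA.
Qed.

Lemma eq_conv a a' b b' n :
  (forall i, (i <= n)%N -> a i = a' i) -> (forall i, (i <= n)%N -> b i = b' i) ->
  conv a b n = conv a' b' n.
Proof.
move=> ha hb; apply: eq_bigr => i _.
by rewrite ha ?hb ?leq_subr//; have := ltn_ord i; lia.
Qed.

Lemma convDl a a' b n : conv (fun i => a i + a' i) b n = conv a b n + conv a' b n.
Proof. by rewrite -big_split; apply: eq_bigr => i _; rewrite mulrDl. Qed.

Lemma conv_derivation a b n :
  n%:R * conv a b n = conv (fun i => i%:R * a i) b n + conv a (fun i => i%:R * b i) n.
Proof.
rewrite mulr_sumr -big_split; apply: eq_bigr => i _.
have -> : n%:R = i%:R + (n - i)%:R :> K by rewrite -natrD subnKC// -ltnS.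
by rewrite mulrDl !mulrA [a i * _]mulrC.
Qed.

(* [a] are the coefficients of the power series with constant term [1] whose
   logarithmic derivative is [\sum_n lam n x^(n - 1)]; the equation at [n = 0]
   forces [lam 0 = 0]. *)
Definition logrec (lam a : nat -> K) : Prop :=
  a 0%N = 1 /\ forall n, n%:R * a n = conv lam a n.

(** Logarithmic derivatives add under products, since a_n -> n a_n is a derivation for the
    convolution. *)
Lemma logrec_conv lam mu a b : logrec lam a -> logrec mu b ->
  logrec (fun n => lam n + mu n) (conv a b).
Proof.
move=> [a0 ha] [b0 hb]; split; first by rewrite /conv big_ord1 a0 b0 mulr1.
move=> n; rewrite conv_derivation convDl; congr (_ + _).
  by rewrite convA; apply: eq_conv.
rewrite convC (eq_conv (a' := conv mu b) (b' := a))//.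
by rewrite -convA; apply: eq_conv => // i _; rewrite convC.
Qed.

Lemma logrec0 lam a : logrec lam a -> lam 0%N = 0.
Proof. by move=> [a0 /(_ 0%N)]; rewrite mul0r /conv big_ord1 subn0 a0 mulr1. Qed.

Lemma logrec_scale lam a x : logrec lam a ->
  logrec (fun n => lam n * x ^+ n) (fun n => a n * x ^+ n).
Proof.
move=> [a0 ha]; split; first by rewrite a0 mul1r.
move=> n; rewrite mulrA ha mulr_suml; apply: eq_bigr => i _.
have -> : x ^+ n = x ^+ i * x ^+ (n - i) by rewrite -exprD subnKC// -ltnS.
ring.
Qed.

End Convolution.

(** * Existence and uniqueness of the solution of the recurrence *)

Section LogarithmicRecurrence.
Variable K : numFieldType.
Implicit Types lam a b : nat -> K.

Lemma logrec_S lam a n : logrec lam a ->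
  a n.+1 = (lam n.+1 + \sum_(i < n) lam i.+1 * a (n - i)%N) / n.+1%:R.
Proof.
move=> ha; have n0 : n.+1%:R != 0 :> K by rewrite pnatr_eq0.
apply: (mulfI n0); rewrite ha.2 mulrC divfK//.
rewrite /conv big_ord_recl (logrec0 ha) mul0r add0r big_ord_recr/=.
by rewrite /bump/= add1n subSS subnn ha.1 mulr1 addrC; congr (_ + _).
Qed.

Lemma logrec_unique lam a b : logrec lam a -> logrec lam b -> a =1 b.
Proof.
move=> ha hb n; elim/ltn_ind: n => -[|n] IH; first by rewrite ha.1 hb.1.
rewrite (logrec_S _ ha) (logrec_S _ hb); congr ((_ + _) / _).
by apply: eq_bigr => i _; rewrite IH// ltnS leq_subr.
Qed.

Lemma logrec_exists lam : lam 0%N = 0 -> exists a, logrec lam a.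
Proof.
move=> lam0.
(* A list holds the coefficients found so far; each step appends the next one, computed from the
   whole list. *)
pose step s := rcons s ((lam (size s) + \sum_(i < (size s).-1)
  lam i.+1 * nth 0 s ((size s).-1 - i)%N) / (size s)%:R).
pose s n := iter n step [:: 1].
have ssize n : size (s n) = n.+1 by elim: n => //= n IH; rewrite size_rcons IH.
have snth n i : (i <= n)%N -> nth 0 (s n) i = nth 0 (s i) i.
  elim: n => [|n IH]; first by rewrite leqn0 => /eqP ->.
  rewrite leq_eqVlt => /orP[/eqP -> //|]; rewrite ltnS => iN.
  by rewrite /= nth_rcons ssize ltnS iN IH.
exists (fun n => nth 0 (s n) n); split=> // -[|n].
  by rewrite mul0r /conv big_ord1 lam0 mul0r.
have n0 : n.+1%:R != 0 :> K by rewrite pnatr_eq0.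
have -> : nth 0 (s n.+1) n.+1 = (lam n.+1 + \sum_(i < n)
    lam i.+1 * nth 0 (s n) (n - i)%N) / n.+1%:R.
  by rewrite /= nth_rcons ssize ltnn eqxx.
rewrite mulrC divfK//.
rewrite /conv big_ord_recl lam0 mul0r add0r big_ord_recr/=.
rewrite /bump/= add1n subSS subnn/= mulr1 addrC; congr (_ + _).
by apply: eq_bigr => i _; rewrite add1n subSS snth ?leq_subr.
Qed.

End LogarithmicRecurrence.

(** * Cauchy products and nonnegative majorants of exponentials of series *)

Section ExponentialFormula.
Variable R : realType.
Local Notation C := R[i].

Lemma sum_le_pair (S T : choiceType) (F : S * T -> R) (G : S -> R) B :
  (forall i (A : {fset T}), \sum_(j <- A) F (i, j) <= G i) -> sum_le G B ->
  sum_le F B.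
Proof.
move=> hF hG A; rewrite (partition_big_imfset _ fst)/=.
apply: le_trans (hG _); apply: ler_sum => i _.
apply: le_trans (hF i [fset x.2 | x in [fset x in A | x.1 == i]]%fset).
rewrite big_imfset/=; last first.
  move=> [x1 x2] [y1 y2]; rewrite !inE/= => /andP[_ /eqP ->] /andP[_ /eqP ->].
  by move=> ->.
by rewrite big_fset/=; apply: ler_sum => -[x1 x2]/= /eqP ->.
Qed.

(** The absolutely summable family [a i * b j] is grouped by rows, which gives [s * t], and by
    antidiagonals, which gives the convolution. *)
Lemma cauchy_product (a b : nat -> C) s t (A B : R) :
  sum_le (fun n => nm (a n)) A -> sum_le (fun n => nm (b n)) B ->
  has_sum a s -> has_sum b t ->
  has_sum (conv a b) (s * t) /\ sum_le (fun n => nm (conv a b n)) (A * B).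
Proof.
move=> hA hB hs ht.
pose f (x : nat * nat) := a x.1 * b x.2.
have A0 : 0 <= A by have := hA fset0; rewrite big_seq_fset0.
have hf : sum_le (fun x => nm (f x)) (A * B).
  apply: (@sum_le_pair _ _ _ (fun i => nm (a i) * B)) => [i D|D].
    rewrite (eq_bigr (fun j => nm (a i) * nm (b j))) => [|j _]; last by rewrite nmM.
    rewrite -mulr_sumr.
    by rewrite ler_wpM2l ?nm_ge0.
  by rewrite -mulr_suml ler_wpM2r//; have := hB fset0; rewrite big_seq_fset0.
have [u hu] := abs_has_sum hf.
have hrow : has_sum (fun i => t * a i) u.
  apply: (has_sum_fiber (pi := fst) hu) => i.
  apply: (has_sum_reindex (h := pair i) (g := snd)) => //.
    by move=> [x y]/=; case: (x =P i) => // ->; rewrite eqxx.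
  rewrite mulrC; have -> : (fun x => if x.1 == i then f x else 0) \o pair i
      = (fun j => a i * b j) by apply/funext => j /=; rewrite eqxx.
  exact: has_sumZ.
rewrite mulrC -(has_sum_unique hrow (has_sumZ t hs)).
suff hdiag n : has_sum (fun x => if (x.1 + x.2 == n)%N then f x else 0) (conv a b n).
  split; first exact: (has_sum_fiber (pi := fun x => (x.1 + x.2)%N) hu).
  exact: (sum_le_fiber (pi := fun x => (x.1 + x.2)%N) hf).
pose D := [fset (i, n - i)%N | i in iota 0 n.+1]%fset.
have -> : conv a b n = \sum_(x <- D) (if (x.1 + x.2 == n)%N then f x else 0).
  rewrite big_fset_iota; last by move=> x y [].
  by apply: eq_bigr => i _ /=; rewrite subnKC ?eqxx// -ltnS.
apply: has_sum_finite => -[x y]; case: eqP => //= xyn /negP[].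
apply/imfsetP; exists x; first by change (x \in iota 0 n.+1); rewrite mem_iota; lia.
by rewrite -xyn addKn.
Qed.

Lemma has_sum1 (T : choiceType) (y : T) (c : C) :
  has_sum (fun x => if x == y then c else 0) c.
Proof.
have := @has_sum_finite R T (fun x => if x == y then c else 0) [fset y]%fset.
by rewrite big_seq_fset1 eqxx; apply=> x; rewrite inE => /negPf ->.
Qed.

Lemma sum_le_fset_nat (f : nat -> R) B : (forall n, 0 <= f n) ->
  (forall n, \sum_(i < n) f i <= B) -> sum_le f B.
Proof.
move=> f0 hB A; pose n := (\sum_(i <- A) i).+1.
apply: le_trans (hB n); rewrite -(big_fset_iota f _ (@inj_id nat)).
apply: fsubset_sum_le => //; apply/fsubsetP => i iA; apply/imfsetP; exists i => //.
by change (i \in iota 0 n); rewrite mem_iota leq0n ltnS (big_fsetD1 i)//= leq_addr.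
Qed.

Section Majorant.
Variables (lam : nat -> R) (lam_ge0 : forall n, 0 <= lam n).
Variables (B : R) (lamB : forall n, \sum_(i < n) lam i / i%:R <= B).

Lemma logrec_ge0 (t : R) b : 0 <= t -> logrec (fun n => t * lam n) b ->
  forall n, 0 <= b n.
Proof.
move=> t0 hb n; elim/ltn_ind: n => -[|n] IH; first by rewrite hb.1.
rewrite (logrec_S _ hb) divr_ge0// addr_ge0 ?mulr_ge0//.
by apply: sumr_ge0 => i _; rewrite !mulr_ge0// IH// ltnS leq_subr.
Qed.

(** A coefficient of positive index of the exponential of [t] times a series is a polynomial in [t]
    with nonnegative coefficients and no constant term, hence at most [t] times its value at 1.
    Setting its linear term aside leaves a factor [t ^+ 2], as in the next lemma. *)
Lemma logrec_le_linear (t : R) b b1 : 0 <= t <= 1 ->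
  logrec (fun n => t * lam n) b -> logrec lam b1 ->
  forall n, b n.+1 <= t * b1 n.+1.
Proof.
move=> /andP[t0 t1] hb hb1 n; elim/ltn_ind: n => n IH.
have b0 := logrec_ge0 t0 hb.
have b10 : forall n, 0 <= b1 n.
  apply: (@logrec_ge0 1) => //; congr logrec: hb1.
  by apply/funext => i; rewrite mul1r.
rewrite (logrec_S _ hb) (logrec_S _ hb1) mulrA ler_wpM2r ?invr_ge0//.
rewrite mulrDr lerD2l mulr_sumr; apply: ler_sum => i _.
rewrite -mulrA ler_wpM2l// ler_wpM2l//.
have iN := ltn_ord i.
have -> : (n - i = (n - i).-1.+1)%N by lia.
apply: (le_trans (IH _ _)); first by lia.
by rewrite ler_piMl.
Qed.

Lemma logrec_le_quadratic (t : R) b b1 : 0 <= t <= 1 ->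
  logrec (fun n => t * lam n) b -> logrec lam b1 ->
  forall n, b n.+1 <= t * (lam n.+1 / n.+1%:R) + t ^+ 2 * b1 n.+1.
Proof.
move=> t01 hb hb1 n; have /andP[t0 t1] := t01.
rewrite (logrec_S _ hb) (logrec_S _ hb1) mulrDl mulrA lerD2l mulrA.
rewrite ler_wpM2r ?invr_ge0// mulrDr.
apply: (@le_trans _ _ (t ^+ 2 * \sum_(i < n) lam i.+1 * b1 (n - i)%N)); last first.
  by rewrite lerDr mulr_ge0// sqr_ge0.
rewrite mulr_sumr; apply: ler_sum => i _.
have iN := ltn_ord i.
have -> : (n - i = (n - i).-1.+1)%N by lia.
have := logrec_le_linear t01 hb hb1 (n - i).-1.
have l0 := mulr_ge0 t0 (lam_ge0 i.+1).
move=> /(ler_wpM2l l0) h; apply: (le_trans h).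
by rewrite le_eqVlt; apply/orP; left; apply/eqP; ring.
Qed.

Lemma logrec_natmul b1 t b s d : logrec (fun n => t * lam n) b ->
  logrec (fun n => s * lam n) d -> logrec (fun n => (t + s) * lam n) b1 ->
  b1 =1 conv b d.
Proof.
move=> hb hd h1; apply: (logrec_unique h1).
have := logrec_conv hb hd; congr logrec.
by apply/funext => n; rewrite mulrDl.
Qed.

(** The partial sums [S t], truncated at a fixed index, are submultiplicative in [t], and S t <= 1 +
    t B + t^2 S 1. With t = 1/N this gives S 1 <= (S t)^N <= exp (B + S 1 / N). As [S 1] is a finite
    sum, the last term vanishes for large N, although nothing is known beforehand about the size of
    [S 1]. *)
Lemma logrec_sum_le b : logrec lam b -> sum_le b (expR B).
Proof.
move=> hb.
have lam0 := logrec0 hb.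
have ex t : exists b, logrec (fun n => t * lam n) b.
  by apply: logrec_exists; rewrite lam0 mulr0.
have [bt hbt] := choice ex.
have b1E : b =1 bt 1.
  apply: (logrec_unique hb); have := hbt 1; congr logrec.
  by apply/funext => n; rewrite mul1r.
have b0 n : 0 <= b n by rewrite b1E; apply: logrec_ge0 (hbt 1) _.
apply: sum_le_fset_nat => // -[|K]; first by rewrite big_ord0 expR_ge0.
pose S t := \sum_(k < K.+1) bt t k.
have S0 t : 0 <= t -> 0 <= S t.
  by move=> t0; apply: sumr_ge0 => i _; apply: logrec_ge0 (hbt t) _.
have SD t s : 0 <= t -> 0 <= s -> S (t + s) <= S t * S s.
  move=> t0 s0; rewrite /S mulr_suml.
  under eq_bigr do rewrite (logrec_natmul (hbt t) (hbt s) (hbt _)).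
  rewrite /conv.
  pose G (i j : nat) := bt t i * bt s j.
  have -> : \sum_(k < K.+1) \sum_(i < k.+1) bt t i * bt s (k - i)%N
      = \sum_(k < K.+1) \sum_(i < K.+1 | (i <= k)%N) G i (k - i)%N.
    apply: eq_bigr => k _.
    by rewrite (big_ord_widen_cond K.+1 xpredT (fun i => G i (k - i)%N)).
  (* The pairs with i + j <= K form part of the square i, j <= K, and all products are
     nonnegative. *)
  rewrite (exchange_big_dep xpredT)//=; apply: ler_sum => i _.
  rewrite mulr_sumr.
  apply: (@le_trans _ _ (\sum_(i <= k < K.+1) G i (k - i)%N)).
    rewrite le_eqVlt; apply/orP; left; apply/eqP.
    by rewrite big_geq_mkord.
  rewrite -{1}[nat_of_ord i]add0n big_addn.
  under eq_bigr do rewrite addnK.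
  rewrite -(big_mkord xpredT (fun j => bt t i * bt s j)).
  rewrite [leRHS](big_cat_nat (n := (K.+1 - i)%N))//= ?leq_subr// lerDl.
  by rewrite sumr_ge0// => j _; rewrite mulr_ge0//; exact: logrec_ge0 (hbt _) _.
have SX t n : 0 <= t -> S (n.+1%:R * t) <= S t ^+ n.+1.
  move=> t0; elim: n => [|n IH]; first by rewrite mul1r.
  rewrite -natr1 mulrDl mul1r exprSr.
  apply: (le_trans (SD _ _ _ t0)); first by rewrite mulr_ge0.
  by rewrite ler_wpM2r// S0.
have SE : \sum_(i < K.+1) b i = S 1 by apply: eq_bigr => i _; rewrite b1E.
rewrite SE.
have Sq t : 0 <= t <= 1 -> S t <= 1 + t * B + t ^+ 2 * S 1.
  move=> t01; have /andP[t0 t1] := t01.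
  rewrite /S big_ord_recl (hbt t).1 -addrA lerD2l.
  apply: (@le_trans _ _ (\sum_(i < K) (t * (lam i.+1 / i.+1%:R) + t ^+ 2 * b i.+1))).
    by apply: ler_sum => i _; apply: logrec_le_quadratic => //.
  rewrite big_split/= -!mulr_sumr lerD//.
    rewrite ler_wpM2l//; apply: le_trans (lamB K.+1).
    by rewrite big_ord_recl/= invr0 mulr0 add0r.
  rewrite ler_wpM2l ?sqr_ge0// [leRHS]big_ord_recl.
  rewrite -[leLHS]add0r lerD ?(hbt 1).1//.
  by apply: ler_sum => i _; rewrite b1E.
have S1ge1 : 1 <= S 1.
  rewrite /S big_ord_recl (hbt 1).1 lerDl sumr_ge0// => i _.
  by apply: logrec_ge0 (hbt 1) _.
have key n : S 1 <= expR (B + S 1 / n.+1%:R).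
  have n0 : 0 < n.+1%:R :> R by rewrite ltr0n.
  have n01 : 0 <= (n.+1%:R^-1 : R) <= 1.
    by rewrite invr_ge0 ler0n/= invf_le1// ler1n.
  have /andP[t0 t1] := n01.
  have := SX _ n t0; rewrite divff ?gt_eqF// => h; apply: (le_trans h).
  have -> : B + S 1 / n.+1%:R = n.+1%:R * (n.+1%:R^-1 * B + n.+1%:R^-1 ^+ 2 * S 1).
    by field; rewrite gt_eqF.
  rewrite expRM_natl lerXn2r// ?nnegrE ?S0 ?expR_ge0//.
  apply: (le_trans (Sq _ n01)); rewrite -addrA; exact: expR_ge1Dx.
have S1gt0 : 0 < S 1 by exact: lt_le_trans S1ge1.
suff : ln (S 1) <= B by move=> h; rewrite -(lnK S1gt0) ler_expR.
apply/ler_addgt0Pr => e e0.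
pose n := Num.truncn (S 1 / e).
have := key n; rewrite -{1}(lnK S1gt0) ler_expR => h; apply: (le_trans h).
rewrite lerD2l ler_pdivrMr ?ltr0n// mulrC -ler_pdivrMr// ltW//.
exact: truncnS_gt.
Qed.

End Majorant.
End ExponentialFormula.

Section ComplexExponentialFormula.
Variable R : realType.
Local Notation C := R[i].
Implicit Types (lam a : nat -> C).

Lemma logrec_nm_le lam a (b : nat -> R) : logrec lam a ->
  logrec (fun n => nm (lam n)) b -> forall n, nm (a n) <= b n.
Proof.
move=> ha hb n; elim/ltn_ind: n => -[|n] IH; first by rewrite ha.1 hb.1 nm1.
rewrite (logrec_S _ ha) (logrec_S _ hb) nmM nmV nm_nat.
rewrite ler_wpM2r ?invr_ge0//; apply: (le_trans (nmD _ _)); rewrite lerD2l.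
apply: (le_trans (nm_sum _ _ _)); apply: ler_sum => i _.
by rewrite nmM ler_wpM2l ?nm_ge0// IH// ltnS leq_subr.
Qed.

Lemma logrec_abs_majorant lam a : logrec lam a ->
  exists2 b : nat -> R, logrec (fun n => nm (lam n)) b & forall n, nm (a n) <= b n.
Proof.
move=> ha; have [|b hb] := @logrec_exists _ (fun n => nm (lam n)).
  by rewrite (logrec0 ha) nm0.
by exists b => //; apply: logrec_nm_le ha hb.
Qed.

Lemma logrec_sum_nm_le lam a (B : R) : logrec lam a ->
  (forall n, \sum_(i < n) nm (lam i) / i%:R <= B) ->
  sum_le (fun n => nm (a n)) (expR B).
Proof.
move=> ha hB; have [b hb ab] := logrec_abs_majorant ha.
by apply: sum_le_mono ab (logrec_sum_le (fun n => nm_ge0 (lam n)) hB hb).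
Qed.

(** Coefficientwise form of exp (t x) = 1 + t x + O(t^2), the constant being the majorant at t =
    1. *)
Lemma logrec_t_quadratic lam (t : R) a (b : nat -> R) : 0 <= t <= 1 ->
  logrec (fun n => t%:C * lam n) a -> logrec (fun n => nm (lam n)) b ->
  forall n, nm (a n - (if n == 0%N then 1 else t%:C * (lam n / n%:R))) <= t ^+ 2 * b n.
Proof.
move=> t01 ha hb [|n] /=.
  rewrite ha.1 subrr nm0 hb.1 mulr1; exact: sqr_ge0.
have /andP[t0 t1] := t01.
have [b' hb' ab'] := logrec_abs_majorant ha.
have hb'' : logrec (fun n => t * nm (lam n)) b'.
  by congr logrec: hb'; apply/funext => i; rewrite nmM nmC ger0_norm.
rewrite (logrec_S _ ha) mulrDl mulrA addrC addKr nmM nmV nm_nat.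
rewrite (logrec_S _ hb) mulrA ler_wpM2r ?invr_ge0// mulrDr.
apply: (@le_trans _ _ (t ^+ 2 * \sum_(i < n) nm (lam i.+1) * b (n - i)%N)); last first.
  by rewrite lerDr mulr_ge0 ?nm_ge0// sqr_ge0.
apply: (le_trans (nm_sum _ _ _)).
rewrite mulr_sumr; apply: ler_sum => i _.
rewrite !nmM nmC ger0_norm//.
have iN := ltn_ord i.
have E : (n - i = (n - i).-1.+1)%N by lia.
have h1 : nm (a (n - i)%N) <= t * b (n - i)%N.
  apply: (le_trans (ab' _)); rewrite E.
  exact: (logrec_le_linear (fun n => nm_ge0 (lam n)) t01 hb'' hb).
apply: (le_trans (ler_wpM2l _ h1)); first by rewrite mulr_ge0 ?nm_ge0.
by rewrite le_eqVlt; apply/orP; left; apply/eqP; ring.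
Qed.

Lemma nm_subXX (x y : C) (M : R) n : 0 <= M -> nm x <= M -> nm y <= M ->
  nm (x ^+ n.+1 - y ^+ n.+1) <= n.+1%:R * M ^+ n * nm (x - y).
Proof.
move=> M0 xM yM; rewrite subrXX nmM mulrC ler_wpM2r ?nm_ge0//.
apply: (le_trans (nm_sum _ _ _)).
apply: (@le_trans _ _ (\sum_(i < n.+1) M ^+ n)); last first.
  by rewrite sumr_const card_ord mulr_natl.
apply: ler_sum => i _; rewrite nmM !nmX.
have iN : (i <= n)%N by rewrite -ltnS.
rewrite -[in leRHS](subnK iN) exprD ler_pM ?exprn_ge0 ?nm_ge0//.
  by rewrite lerXn2r// nnegrE nm_ge0.
by rewrite lerXn2r// nnegrE nm_ge0.
Qed.

Lemma le0_of_bound_divS (x A : R) : (forall n, x <= A / n.+1%:R) -> x <= 0.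
Proof.
move=> h; apply/ler_addgt0Pr => e e0; rewrite add0r.
pose n := Num.truncn (A / e).
apply: (le_trans (h n)); rewrite ler_pdivrMr ?ltr0n// mulrC -ler_pdivrMr// ltW//.
exact: truncnS_gt.
Qed.

(* The coefficients [f t] for the logarithmic derivative [t * lam] satisfy
   [f (t + u) = f t * f u] and [f t = 1 + t s + O(t^2)], so that
   [f 1 = f (1 / N) ^ N] tends to [cexp s]. *)
Lemma logrec_has_sum_cexp lam a (B : R) s : logrec lam a ->
  (forall n, \sum_(i < n) nm (lam i) / i%:R <= B) ->
  has_sum (fun n => lam n / n%:R) s -> has_sum a (cexp s).
Proof.
move=> ha hB hs; have lam0 := logrec0 ha.
have B0 : 0 <= B by have := hB 0%N; rewrite big_ord0.
have [b hb ab] := logrec_abs_majorant ha.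
have bB := logrec_sum_le (fun n => nm_ge0 (lam n)) hB hb.
have ex (t : R) : exists a, logrec (fun n => t%:C * lam n) a.
  by apply: logrec_exists; rewrite lam0 mulr0.
have [at_ hat] := choice ex.
have a1E : a =1 at_ 1.
  apply: (logrec_unique ha); have := hat 1; congr logrec.
  by apply/funext => n; rewrite mul1r.
have atB (t : R) : 0 <= t -> sum_le (fun n => nm (at_ t n)) (expR (t * B)).
  move=> t0; apply: (logrec_sum_nm_le (hat t)) => n.
  apply: le_trans (ler_wpM2l t0 (hB n)); rewrite mulr_sumr.
  by apply: ler_sum => i _; rewrite nmM nmC ger0_norm// mulrA.
have exf (t : R) : exists f, 0 <= t -> has_sum (at_ t) f.
  have [t0|t0] := leP 0 t; last by exists 0.
  by have [f hf] := abs_has_sum (atB t t0); exists f.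
have [f hf] := choice exf.
have fD (t u : R) : 0 <= t -> 0 <= u -> f (t + u) = f t * f u.
  move=> t0 u0; apply: (has_sum_unique (hf _ (addr_ge0 t0 u0))).
  have -> : at_ (t + u) = conv (at_ t) (at_ u).
    apply/funext => n; apply: (logrec_unique (hat (t + u))).
    have := logrec_conv (hat t) (hat u); congr logrec.
    by apply/funext => k; rewrite -mulrDl -rmorphD.
  by have [] := cauchy_product (atB _ t0) (atB _ u0) (hf _ t0) (hf _ u0).
have fX (t : R) n : 0 <= t -> f (n.+1%:R * t) = f t ^+ n.+1.
  move=> t0; elim: n => [|n IH]; first by rewrite mul1r.
  by rewrite -natr1 mulrDl mul1r fD ?mulr_ge0// IH [RHS]exprSr.
have sB : nm s <= B.
  apply: (has_sum_nm_le hs); apply: sum_le_fset_nat => [n|n]; first exact: nm_ge0.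
  by apply: le_trans (hB n); apply: ler_sum => i _; rewrite nmM nmV nm_nat.
suff -> : cexp s = f 1.
  have -> : a = at_ 1 by exact/funext.
  exact: hf.
apply/esym/eqP; rewrite -subr_eq0; apply/eqP/nm_eq0/eqP; rewrite eq_le nm_ge0 andbT.
(* N factors [f t] are replaced by [cexp (t * s)], each at a cost O(1 / N^2); the N - 1 remaining
   factors multiply to at most [expR B]. The total is A / N. *)
pose A := expR B * (expR B + 10%:R * B ^+ 2 * expR B).
apply: (@le0_of_bound_divS _ A) => n.
have n0 : 0 < n.+1%:R :> R by rewrite ltr0n.
pose t : R := n.+1%:R^-1.
have t0 : 0 <= t by rewrite invr_ge0.
have t1 : t <= 1 by rewrite invf_le1// ler1n.
have f1E : f 1 = f t ^+ n.+1 by rewrite -fX// divff// gt_eqF.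
have cE : cexp s = cexp (t%:C * s) ^+ n.+1.
  rewrite -cexpMn mulrA -(rmorph_nat (real_complex R)) -rmorphM divff ?gt_eqF//.
  by rewrite mul1r.
have ft : nm (f t - (1 + t%:C * s)) <= t ^+ 2 * expR B.
  apply: (@has_sum_nm_le _ _ (fun n =>
      at_ t n - (if n == 0%N then 1 else t%:C * (lam n / n%:R)))).
    apply: has_sumB; first exact: hf.
    have -> : (fun n => if n == 0%N then 1 else t%:C * (lam n / n%:R))
        = (fun n => (if n == 0%N then 1 else 0) + t%:C * (lam n / n%:R)).
      by apply/funext => -[|m]; rewrite /= ?add0r// lam0 !(mul0r, mulr0) addr0.
    exact/has_sumD/has_sumZ/hs/has_sum1.
  move=> D; apply: (@le_trans _ _ (\sum_(k <- D) t ^+ 2 * b k)).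
    apply: ler_sum => k _; apply: logrec_t_quadratic (hat t) hb k.
    by rewrite t0 t1.
  by rewrite -mulr_sumr ler_wpM2l ?sqr_ge0.
have ct : nm (cexp (t%:C * s) - 1 - t%:C * s) <= t ^+ 2 * (10%:R * B ^+ 2 * expR B).
  apply: (le_trans (cexp_quadratic _)); rewrite nmM nmC ger0_norm//.
  have -> : t ^+ 2 * (10%:R * B ^+ 2 * expR B) = 10%:R * (t * B) ^+ 2 * expR B by ring.
  have tsB : t * nm s <= t * B by rewrite ler_wpM2l.
  have ts0 : 0 <= t * nm s by rewrite mulr_ge0 ?nm_ge0.
  apply: ler_pM; [by rewrite mulr_ge0 ?sqr_ge0|exact: expR_ge0| |].
    by rewrite ler_wpM2l// lerXn2r// nnegrE// mulr_ge0.
  rewrite ler_expR; apply: (le_trans tsB); rewrite ler_piMl//.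
have fcB : nm (f t - cexp (t%:C * s)) <= t ^+ 2 * (expR B + 10%:R * B ^+ 2 * expR B).
  have -> : f t - cexp (t%:C * s)
      = (f t - (1 + t%:C * s)) - (cexp (t%:C * s) - 1 - t%:C * s) by ring.
  by apply: (le_trans (nmB _ _)); rewrite mulrDr lerD.
rewrite f1E cE.
have eM : expR (t * B) ^+ n <= expR B.
  rewrite -expRM_natl ler_expR mulrA ler_piMl// /t ler_pdivrMr// mul1r ler_nat//.
apply: (le_trans (@nm_subXX _ _ (expR (t * B)) _ _ _ _)); rewrite ?expR_ge0//.
- exact: has_sum_nm_le (hf t t0) (atB t t0).
- apply: (le_trans (nm_cexp_le _)); rewrite ler_expR nmM nmC ger0_norm//.
  by rewrite ler_wpM2l.
have -> : A / n.+1%:R = n.+1%:R * expR B * (t ^+ 2 * (expR B + 10%:R * B ^+ 2 * expR B)).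
  by rewrite /A /t; field; rewrite gt_eqF.
rewrite ler_pM ?mulr_ge0 ?exprn_ge0 ?expR_ge0 ?nm_ge0//.
by rewrite ler_wpM2l.
Qed.

End ComplexExponentialFormula.

(** * Power series and analyticity *)

Section PowerSeries.
Variable R : realType.
Local Notation C := R[i].
Implicit Types (a b : nat -> C) (f g : C -> C) (r : R).

(** Absolute convergence is asked at the radius [r] itself, so that the closed disc is covered and
    products and exponentials are bounded at the single point [r]. *)
Definition power_series r a f : Prop :=
  (exists B, sum_le (fun n => nm (a n) * r ^+ n) B) /\
  (forall z, nm z <= r -> has_sum (fun n => a n * z ^+ n) (f z)).

Lemma sum_leD (T : choiceType) (f g : T -> R) A B :
  sum_le f A -> sum_le g B -> sum_le (fun x => f x + g x) (A + B).
Proof. by move=> hA hB D; rewrite big_split/= lerD. Qed.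

Lemma eq_power_series r a f g : (forall z, nm z <= r -> f z = g z) ->
  power_series r a f -> power_series r a g.
Proof. by move=> fg [hB hf]; split=> // z zr; rewrite -fg//; exact: hf. Qed.

Lemma power_seriesD r a b f g : 0 <= r -> power_series r a f ->
  power_series r b g -> power_series r (fun n => a n + b n) (fun z => f z + g z).
Proof.
move=> r0 [[A hA] hf] [[B hB] hg]; split.
  exists (A + B); apply: sum_le_mono (sum_leD hA hB) => n.
  by rewrite -mulrDl ler_wpM2r ?exprn_ge0// nmD.
move=> z zr; have := has_sumD (hf z zr) (hg z zr); congr has_sum.
by apply/funext => n; rewrite mulrDl.
Qed.

Lemma power_seriesN r a f : power_series r a f ->
  power_series r (fun n => - a n) (fun z => - f z).
Proof.
move=> [[A hA] hf]; split.
  by exists A; apply: sum_le_mono hA => n; rewrite nmN.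
move=> z zr; have := has_sumN (hf z zr); congr has_sum.
by apply/funext => n; rewrite mulNr.
Qed.

Lemma power_series_oppz r a f : power_series r a f ->
  power_series r (fun n => a n * (-1) ^+ n) (fun z => f (- z)).
Proof.
move=> [[A hA] hf]; split.
  by exists A; apply: sum_le_mono hA => n; rewrite nmM nmX nmN nm1 expr1n mulr1.
move=> z zr; have := hf (- z); rewrite nmN => /(_ zr); congr has_sum.
by apply/funext => n; rewrite -mulrA -exprMn mulN1r.
Qed.

Lemma power_seriesM r a b f g : 0 <= r -> power_series r a f ->
  power_series r b g -> power_series r (conv a b) (fun z => f z * g z).
Proof.
move=> r0 [[A hA] hf] [[B hB] hg].
have convX z n : conv (fun n => a n * z ^+ n) (fun n => b n * z ^+ n) n
    = conv a b n * z ^+ n.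
  rewrite mulr_suml; apply: eq_bigr => i _.
  have -> : z ^+ n = z ^+ i * z ^+ (n - i) by rewrite -exprD subnKC// -ltnS.
  ring.
have bd z c D : nm z <= r -> sum_le (fun n => nm (c n) * r ^+ n) D ->
    sum_le (fun n => nm (c n * z ^+ n)) D.
  move=> zr; apply: sum_le_mono => n; rewrite nmM ler_wpM2l ?nm_ge0// nmX.
  by rewrite lerXn2r// ?nnegrE ?nm_ge0.
have cp z (zr : nm z <= r) :=
  cauchy_product (bd z _ _ zr hA) (bd z _ _ zr hB) (hf z zr) (hg z zr).
split; last first.
  move=> z /cp[h _]; congr has_sum: h; exact/funext/convX.
exists (A * B); have rr : nm r%:C <= r by rewrite nmC ger0_norm.
have [_] := cp _ rr; apply: sum_le_mono => n.
by rewrite convX nmM nmX nmC ger0_norm.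
Qed.

Lemma power_series_monomial r c m : 0 <= r ->
  power_series r (fun n => if n == m then c else 0) (fun z => c * z ^+ m).
Proof.
move=> r0.
have E z : (fun n => (if n == m then c else 0) * z ^+ n)
    = (fun n => if n == m then c * z ^+ m else 0).
  by apply/funext => n; case: eqP => [->|]; rewrite ?mul0r.
split; last by move=> z _; rewrite E; exact: has_sum1.
exists (nm c * r ^+ m) => A.
have [mA|mA] := boolP (m \in A).
  rewrite (big_fsetD1 m)//= eqxx big_seq big1 ?addr0// => i.
  by rewrite !inE => /andP[/negPf -> _]; rewrite nm0 mul0r.
rewrite big_seq big1 ?mulr_ge0 ?nm_ge0 ?exprn_ge0// => i iA.
by case: eqP => [im|]; rewrite ?nm0 ?mul0r//; rewrite -im iA in mA.
Qed.

(** The logarithmic derivative has coefficients [n * a n]. The condition [a 0 = 0] matches the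
    constant term 1 that [logrec] imposes on the exponential. *)
Lemma power_series_cexp r a f : 0 <= r -> a 0%N = 0 -> power_series r a f ->
  exists e, power_series r e (fun z => cexp (f z)).
Proof.
move=> r0 a0 [[B hB] hf]; have B0 : 0 <= B by have := hB fset0; rewrite big_seq_fset0.
have [|e he] := @logrec_exists _ (fun n => n%:R * a n); first by rewrite mul0r.
have hz z : nm z <= r ->
    forall n, \sum_(i < n) nm (i%:R * a i * z ^+ i) / i%:R <= B.
  move=> zr n; rewrite -(big_fset_iota (fun i => nm (i%:R * a i * z ^+ i) / i%:R) _ (@inj_id nat)).
  apply: le_trans (hB _); apply: ler_sum => i _; rewrite !nmM nm_nat.
  case: i => [|i]; first by rewrite invr0 mulr0 mulr_ge0 ?nm_ge0 ?exprn_ge0.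
  rewrite mulrAC [_ * nm (a _)]mulrC mulfK ?pnatr_eq0//.
  by rewrite ler_wpM2l ?nm_ge0// nmX lerXn2r// ?nnegrE ?nm_ge0.
exists e; split.
  exists (expR B).
  have := logrec_sum_nm_le (logrec_scale r%:C he) (hz r%:C _).
  rewrite nmC ger0_norm// => /(_ (lexx _)); apply: sum_le_mono => n.
  by rewrite nmM nmX nmC ger0_norm.
move=> z zr; apply: (logrec_has_sum_cexp (logrec_scale z he) (hz z zr)).
have := hf z zr; congr has_sum; apply/funext => -[|n].
  by rewrite a0 !(mul0r, mulr0).
by rewrite [RHS]mulrAC [_ * a _]mulrC mulfK// pnatr_eq0.
Qed.

(* Recentering: expand [(z0 + w) ^ n] by the binomial theorem and sum the
   resulting double series, absolutely convergent for [|w| <= r - |z0|],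
   first over [n]. *)
Lemma power_series_recenter r a f z0 : power_series r a f -> nm z0 < r ->
  exists b, forall w, nm w <= r - nm z0 ->
    has_sum (fun k => b k * w ^+ k) (f (z0 + w)).
Proof.
move=> [[B hB] hf] z0r; pose d := r - nm z0; have d0 : 0 < d by rewrite subr_gt0.
pose c (x : nat * nat) : C := a x.1 * ('C(x.1, x.2)%:R * z0 ^+ (x.1 - x.2)).
have binom_sum n w : \sum_(k < n.+1) c (n, nat_of_ord k) * w ^+ k = a n * (z0 + w) ^+ n.
  rewrite exprDn mulr_sumr; apply: eq_bigr => k _.
  by rewrite /c/= -mulr_natl; ring.
have c0 n k : (n < k)%N -> c (n, k) = 0.
  by move=> nk; rewrite /c/= bin_small// mul0r mulr0.
have cB w : nm w <= d -> sum_le (fun x => nm (c x * w ^+ x.2)) B.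
  move=> wd; apply: sum_le_pair hB => n D.
  apply: (@sum_le_fset_nat _ (fun k => nm (c (n, k) * w ^+ k))) => [k|m].
    exact: nm_ge0.
  apply: (@le_trans _ _ (\sum_(k < m + n.+1) nm (c (n, nat_of_ord k) * w ^+ k))).
    rewrite big_split_ord/= lerDl; apply: sumr_ge0 => k _; exact: nm_ge0.
  rewrite addnC big_split_ord/= [X in _ + X]big1 ?addr0; last first.
    by move=> k _; rewrite c0 ?mul0r ?nm0// leq_addr.
  apply: (@le_trans _ _ (nm (a n) * (nm z0 + nm w) ^+ n)); last first.
    rewrite ler_wpM2l ?nm_ge0// lerXn2r ?nnegrE ?addr_ge0 ?nm_ge0//.
      by rewrite (le_trans (nm_ge0 z0))// ltW.
    by rewrite -lerBrDl.
  rewrite exprDn mulr_sumr; apply: ler_sum => k _.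
  rewrite /c/= !nmM !nmX nm_nat -mulr_natl.
  by rewrite le_eqVlt; apply/orP; left; apply/eqP; ring.
have exb k : exists s, has_sum (fun n => c (n, k)) s.
  have hd := cB d%:C; rewrite nmC (ger0_norm (ltW d0)) in hd.
  apply: (@abs_has_sum _ _ _ (B / d ^+ k)) => D.
  rewrite ler_pdivlMr ?exprn_gt0// mulr_suml.
  apply: le_trans (hd (lexx _) [fset (n, k) | n in D]%fset).
  rewrite big_imfset/=; last by move=> x y _ _ [].
  by apply: ler_sum => n _; rewrite nmM nmX nmC (ger0_norm (ltW d0)).
have [b hb] := choice exb.
exists b => w wd; have [u hu] := abs_has_sum (cB w wd).
have -> : f (z0 + w) = u.
  have zwr : nm (z0 + w) <= r by rewrite (le_trans (nmD _ _))// -lerBrDl.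
  apply: (has_sum_unique (hf _ zwr)).
  apply: (has_sum_fiber (pi := fst) hu) => n.
  apply: (has_sum_reindex (h := pair n) (g := snd)) => //.
    by move=> [x y]/=; case: (x =P n) => // ->; rewrite eqxx.
  rewrite -binom_sum -(big_fset_iota (fun k => c (n, k) * w ^+ k) _ (@inj_id nat)).
  have -> : (fun x : nat * nat => if x.1 == n then c x * w ^+ x.2 else 0) \o pair n
      = (fun k => c (n, k) * w ^+ k) by apply/funext => j /=; rewrite eqxx.
  apply: has_sum_finite => k kn; rewrite c0 ?mul0r// ltnNge.
  apply: contra kn => kn; apply/imfsetP; exists k => //.
  by change (k \in iota 0 n.+1); rewrite mem_iota leq0n ltnS.
apply: (has_sum_fiber (pi := snd) hu) => k.
apply: (has_sum_reindex (h := fun n => (n, k)) (g := fst)) => //.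
  by move=> [x y]/=; case: (y =P k) => // ->; rewrite eqxx.
have := has_sumZ (w ^+ k) (hb k); rewrite mulrC; congr has_sum.
by apply/funext => n /=; rewrite eqxx mulrC.
Qed.

Lemma power_series_analytic r a f z0 : power_series r a f -> nm z0 < r ->
  analytic_at f z0.
Proof.
move=> ha z0r; have [b hb] := power_series_recenter ha z0r.
exists b; have d0 : 0 < ((r - nm z0)%:C : C) by rewrite ltcR subr_gt0.
have nb : \forall z \near (z0 : R[i]^o), nm (z - z0) <= r - nm z0.
  apply: (@nbhs_norm_le_nbhs _ (R[i]^o : pseudoMetricNormedZmodType R[i])).
  by exists (r - nm z0)%:C => // z; rewrite /ball_/= nmE ltcR nm_distC => /ltW.
apply: filterS nb => z zd.
have := hb _ zd; rewrite [z0 + _]addrC subrK => hs.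
apply/cvgrPdist_le => e e0.
(* In the order of [R[i]], positivity forces [e] to be real. *)
have [e1 eE] : exists e1 : R, e = e1%:C.
  by apply/complex_realP; rewrite realE ltW.
move: e0; rewrite eE ltcR => e10.
have [N hN] := has_sum_series hs e10.
exists N => // n /= Nn.
rewrite distrC nmE lecR seriesEnat/= big_mkord; exact: hN.
Qed.

End PowerSeries.

(** * Logarithms of products with factors (1 - z x)^-1 (1 - x)^z *)

Section LogarithmicFamily.
Variable R : realType.
Local Notation C := R[i].

Lemma geometric_sum_le (t : R) n : 0 <= t < 1 -> \sum_(i < n) t ^+ i <= (1 - t)^-1.
Proof.
move=> /andP[t0 t1]; rewrite -[leRHS]mul1r ler_pdivlMr ?subr_gt0//.
rewrite mulrC; have -> : (1 - t) * \sum_(i < n) t ^+ i = 1 - t ^+ n.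
  by rewrite -[RHS]opprB subrX1; ring.
by rewrite gerBl exprn_ge0.
Qed.

(** No complex logarithm is needed: the sequence 1, -w, 0, 0, ... satisfies the recurrence for
    [lam k = - w ^+ k], so the exponential of the sum of - w^k / k is the finite sum 1 - w. *)
Lemma neg_log_has_sum (w : C) : nm w < 1 ->
  exists2 s, has_sum (fun k => w ^+ k / k%:R) s & cexp s = (1 - w)^-1.
Proof.
move=> w1; pose lam k : C := if k == 0%N then 0 else - w ^+ k.
pose a k : C := if k == 0%N then 1 else if k == 1%N then - w else 0.
have ha : logrec lam a.
  split=> // n; rewrite /conv /lam /a.
  case: n => [|[|n]]; first by rewrite big_ord1/= !mul0r.
    by rewrite big_ord_recl big_ord1/= mul0r add0r mul1r mulr1.
  rewrite /= mulr0 big_ord_recl/= mul0r add0r !big_ord_recr/= big1 ?add0r.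
    rewrite !/bump/= !add1n subnn subSnn/= mulr1 !exprS; ring.
  move=> i _; have iN := ltn_ord i; rewrite /bump/= add1n.
  have -> : (n.+2 - i.+1 = (n - i.+1).+2)%N by lia.
  by rewrite mulr0.
have hB n : \sum_(i < n) nm (lam i) / i%:R <= (1 - nm w)^-1.
  apply: le_trans (geometric_sum_le n _); last by rewrite nm_ge0.
  apply: ler_sum => -[[|i] hi] _ /=.
    by rewrite /lam/= invr0 mulr0.
  rewrite /lam/= nmN nmX ler_pdivrMr ?ltr0n// ler_peMr ?exprn_ge0 ?nm_ge0//.
  by rewrite ler1n.
have [s hs] : exists s, has_sum (fun n => lam n / n%:R) s.
  apply: (@abs_has_sum _ _ _ (1 - nm w)^-1); apply: sum_le_fset_nat => n.
    exact: nm_ge0.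
  by apply: le_trans (hB n); apply: ler_sum => i _; rewrite nmM nmV nm_nat.
exists (- s).
  have := has_sumN hs; congr has_sum; apply/funext => -[|k].
    by rewrite /lam/= mul0r oppr0 invr0 mulr0.
  by rewrite /lam/= mulNr opprK.
rewrite cexpN; congr (_^-1).
apply: (has_sum_unique (logrec_has_sum_cexp ha hB hs)).
have -> : 1 - w = \sum_(i < 2) a i by rewrite big_ord_recl big_ord1.
rewrite -(big_fset_iota a _ (@inj_id nat)).
apply: has_sum_finite => -[|[|k]]//.
- by move=> /negP[]; apply/imfsetP; exists 0%N.
- by move=> /negP[]; apply/imfsetP; exists 1%N.
Qed.

(** The complex exponential determines the sum only up to a period; here the terms are real and
    nonnegative, so the sum is real and the real [ln] identifies it. *)
Lemma neg_ln_has_sum (x : R) : 0 <= x < 1 ->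
  has_sum (fun k => (x ^+ k / k%:R)%:C) (- ln (1 - x))%:C.
Proof.
move=> /andP[x0 x1].
have [|s hs es] := @neg_log_has_sum x%:C; first by rewrite nmC ger0_norm.
have E k : x%:C ^+ k / k%:R = (x ^+ k / k%:R)%:C :> C.
  by rewrite -(rmorph_nat (real_complex R)) -fmorphV -rmorphXn -rmorphM.
have ge0 k : 0 <= x ^+ k / k%:R by rewrite divr_ge0 ?exprn_ge0.
have [|s' hs'] := @ge0_has_sum R nat (fun k => x ^+ k / k%:R) (1 - x)^-1 ge0.
  apply: sum_le_fset_nat => n; first by rewrite divr_ge0 ?exprn_ge0.
  apply: le_trans (geometric_sum_le n _); last by rewrite x0.
  apply: ler_sum => -[[|i] hi] _ /=; first by rewrite invr0 mulr0.
  by rewrite ler_pdivrMr ?ltr0n// ler_peMr ?exprn_ge0// ler1n.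
suff -> : - ln (1 - x) = s' by [].
have ss' : s = s'%:C by apply: (has_sum_unique hs); congr has_sum: hs'; exact/funext.
have : expR s' = (1 - x)^-1.
  apply: complexI; rewrite -cexp_real -ss' es fmorphV rmorphB rmorph1//.
by move=> /(congr1 (@ln R)); rewrite expRK lnV ?posrE ?subr_gt0.
Qed.

Variables (T : choiceType) (x : T -> R) (r theta B : R).
Hypotheses (x_ge0 : forall i, 0 <= x i) (r_ge1 : 1 <= r) (theta_lt1 : theta < 1).
Hypotheses (x_le : forall i, x i * r <= theta) (xB : sum_le (fun i => x i ^+ 2) B).

(** The family [x] will be q^(- deg p) over primes, or 1/k over large integers. The bound by [theta]
    keeps every |z x_i| uniformly below 1, and [xB] makes the weights of exponent at least 2
    summable. *)
Definition log_weight (y : T * nat) : R :=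
  if (2 <= y.2)%N then x y.1 ^+ y.2 / y.2%:R else 0.

(* The terms of the double series expanding
   [\sum_i (- log (1 - z x_i) + z log (1 - x_i))]; those of order [1] cancel. *)
Definition log_term (z : C) (y : T * nat) : C := (log_weight y)%:C * (z ^+ y.2 - z).

Let r_ge0 : 0 <= r. Proof. exact: le_trans r_ge1. Qed.

Let xr_ge0 i : 0 <= x i * r. Proof. by rewrite mulr_ge0. Qed.

Lemma log_weight_ge0 y : 0 <= log_weight y.
Proof. by rewrite /log_weight; case: ifP => // _; rewrite divr_ge0 ?exprn_ge0. Qed.

Lemma log_weight_sum_le :
  sum_le (fun y => log_weight y * r ^+ y.2) (B * (r ^+ 2 / (1 - theta))).
Proof.
have th1 : 0 < 1 - theta by rewrite subr_gt0.
apply: (@sum_le_pair _ _ _ _ (fun i => x i ^+ 2 * (r ^+ 2 / (1 - theta)))) => [i|]; last first.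
  by move=> A; rewrite -mulr_suml ler_wpM2r// divr_ge0 ?sqr_ge0// ltW.
have th0 : 0 <= theta by exact: le_trans (x_le i).
apply: sum_le_fset_nat => [k|n].
  by rewrite mulr_ge0 ?log_weight_ge0 ?exprn_ge0.
apply: (@le_trans _ _ (\sum_(k < n.+2) log_weight (i, k : nat) * r ^+ k)).
  rewrite !big_ord_recr/= -addrA lerDl.
  by rewrite addr_ge0// mulr_ge0 ?log_weight_ge0 ?exprn_ge0.
rewrite !big_ord_recl/= /log_weight/= !mul0r !add0r.
apply: (@le_trans _ _ (\sum_(k < n) (x i ^+ 2 * r ^+ 2) * theta ^+ k)).
  apply: ler_sum => k _; rewrite /bump/= !add1n.
  have -> : x i ^+ k.+2 / k.+2%:R * r ^+ k.+2 = (x i * r) ^+ k.+2 / k.+2%:R.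
    by rewrite exprMn mulrAC.
  apply: (@le_trans _ _ ((x i * r) ^+ k.+2)).
    by rewrite ler_pdivrMr ?ltr0n// ler_peMr ?exprn_ge0// ler1n.
  rewrite -exprMn -[in leLHS]addn2 addnC exprD ler_wpM2l ?sqr_ge0//.
  by rewrite lerXn2r// nnegrE.
rewrite -mulr_sumr mulrA ler_wpM2l ?mulr_ge0 ?sqr_ge0//.
by apply: geometric_sum_le; rewrite th0.
Qed.

Lemma nm_log_term_le z y : nm z <= r ->
  nm (log_term z y) <= 2 * (log_weight y * r ^+ y.2).
Proof.
move=> zr; rewrite nmM nmC (ger0_norm (log_weight_ge0 y)).
have [y2|y2] := leqP 2 y.2; last by rewrite /log_weight leqNgt y2 !mul0r mulr0.
rewrite mulrCA ler_wpM2l ?log_weight_ge0//; apply: (le_trans (nmB _ _)).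
rewrite mulr_natl mulr2n lerD//; first by rewrite nmX lerXn2r// nnegrE ?nm_ge0.
by rewrite (le_trans zr)// ler_eXnr// (leq_trans _ y2).
Qed.

Lemma log_term_sum_le z : nm z <= r ->
  sum_le (fun y => nm (log_term z y)) (2 * (B * (r ^+ 2 / (1 - theta)))).
Proof.
move=> zr A; apply: (@le_trans _ _ (\sum_(y <- A) 2 * (log_weight y * r ^+ y.2))).
  by apply: ler_sum => y _; apply: nm_log_term_le.
by rewrite -mulr_sumr ler_wpM2l// log_weight_sum_le.
Qed.

(** Grouping by exponent: [p k] collects the weights of exponent [k], and the total weight [u]
    corrects the coefficient of [z]. The vanishing constant term is recorded for
    [power_series_cexp]. *)
Lemma log_term_power_series : exists a L, a 0%N = 0 /\ power_series r a L /\
  forall z, nm z <= r -> has_sum (log_term z) (L z).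
Proof.
have hW := log_weight_sum_le; set M := B * _ in hW.
have abs1 z : nm z <= r ->
    sum_le (fun y => nm ((log_weight y)%:C * z ^+ y.2)) M.
  move=> zr; apply: sum_le_mono hW => y.
  rewrite nmM nmC (ger0_norm (log_weight_ge0 y)) ler_wpM2l ?log_weight_ge0//.
  by rewrite nmX lerXn2r// nnegrE ?nm_ge0.
have [u hu] : exists u, has_sum (fun y => (log_weight y)%:C) u.
  have [|u hu] := @abs_has_sum R (T * nat)%type (fun y => (log_weight y)%:C * 1 ^+ y.2) M.
    by apply: abs1; rewrite nm1.
  by exists u; congr has_sum: hu; apply/funext => y; rewrite expr1n mulr1.
have exS z : exists s, nm z <= r -> has_sum (fun y => (log_weight y)%:C * z ^+ y.2) s.
  have [zr|zr] := leP (nm z) r; last by exists 0.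
  by have [s hs] := abs_has_sum (abs1 _ zr); exists s.
have [S hS] := choice exS.
have exp k : exists s, has_sum (fun i => (log_weight (i, k))%:C) s.
  apply: (@abs_has_sum _ _ _ M) => A.
  rewrite (eq_bigr (fun i => log_weight (i, k))) => [|i _]; last first.
    by rewrite nmC ger0_norm ?log_weight_ge0.
  apply: le_trans (hW [fset (i, k) | i in A]%fset).
  rewrite big_imfset/=; last by move=> ? ? _ _ [].
  apply: ler_sum => i _.
  by rewrite ler_peMr ?log_weight_ge0// exprn_ege1.
have [p hp] := choice exp.
have fib z k : has_sum (fun y => if y.2 == k then (log_weight y)%:C * z ^+ y.2 else 0)
    (p k * z ^+ k).
  apply: (has_sum_reindex (h := fun i => (i, k)) (g := fst)) => //.
    by move=> [i l]/=; case: (l =P k) => // ->; rewrite eqxx.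
  have := has_sumZ (z ^+ k) (hp k); rewrite mulrC; congr has_sum.
  by apply/funext => i /=; rewrite eqxx mulrC.
have psS : power_series r p S.
  split; last by move=> z zr; apply: (has_sum_fiber (hS z zr)); exact: fib.
  exists M; have rr : nm r%:C <= r by rewrite nmC ger0_norm.
  have := sum_le_fiber (abs1 _ rr) (fib r%:C); apply: sum_le_mono => k.
  by rewrite nmM nmX nmC ger0_norm.
exists (fun n => p n + (if n == 1%N then - u else 0)), (fun z => S z + - u * z ^+ 1).
split; first last.
  split; first exact/power_seriesD/power_series_monomial.
  move=> z zr; rewrite expr1 mulNr mulrC.
  have := has_sumB (hS z zr) (has_sumZ z hu); congr has_sum.
  by apply/funext => y; rewrite /log_term mulrBr [z * _]mulrC.
rewrite addr0; apply: (has_sum_unique (hp 0%N)).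
have -> : (fun i => (log_weight (i, 0%N))%:C) = (fun _ => 0).
  by apply/funext => i; rewrite /log_weight.
exact: has_sum0.
Qed.

Lemma log_factor z i : nm z <= r ->
  exists l, has_sum (fun k => log_term z (i, k)) l /\
    cexp l = (1 - z * (x i)%:C)^-1 * cpow (1 - x i) z.
Proof.
move=> zr.
have x1 : x i < 1.
  apply: le_lt_trans theta_lt1; apply: le_trans (x_le i).
  by rewrite ler_peMr.
have zx1 : nm (z * (x i)%:C) < 1.
  rewrite nmM nmC ger0_norm// mulrC (le_lt_trans _ theta_lt1)//.
  by rewrite (le_trans _ (x_le i))// ler_wpM2l.
have [s hs es] := neg_log_has_sum zx1.
have hl : has_sum (fun k => (x i ^+ k / k%:R)%:C) (- ln (1 - x i))%:C.
  by apply: neg_ln_has_sum; rewrite x_ge0.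
exists (s - z * (- ln (1 - x i))%:C); split; last first.
  by rewrite cexpD es rmorphN mulrN opprK.
have := has_sumB hs (has_sumZ z hl); congr has_sum; apply/funext => k.
rewrite /log_term /log_weight/=.
have E : (x i ^+ k / k%:R)%:C = (x i)%:C ^+ k / k%:R :> C.
  by rewrite -(rmorph_nat (real_complex R)) -fmorphV -rmorphXn -rmorphM.
case: k E => [|[|k]] E /=.
- by rewrite !invr0 !(mulr0, mul0r) subrr.
- by rewrite !invr1 !mulr1 !expr1 subrr mul0r.
by rewrite E exprMn; ring.
Qed.

(** Grouping the same family by index recovers a logarithm of each factor. *)
Lemma log_factors z L : nm z <= r -> has_sum (log_term z) L ->
  exists2 l, has_sum l L &
    forall i, cexp (l i) = (1 - z * (x i)%:C)^-1 * cpow (1 - x i) z.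
Proof.
move=> zr hL; have [l hl] := choice (fun i => log_factor i zr).
exists l => [|i]; last exact: (hl i).2.
apply: (has_sum_fiber (pi := fst) hL) => i.
apply: (has_sum_reindex (h := pair i) (g := snd)) => //.
  by move=> [y k]/=; case: (y =P i) => // ->; rewrite eqxx.
by have := (hl i).1; congr has_sum; apply/funext => k /=; rewrite eqxx.
Qed.

Lemma log_term_product z L : nm z <= r -> has_sum (log_term z) L ->
  forall e : R, 0 < e -> exists A0 : {fset T}, forall A : {fset T}, (A0 `<=` A)%fset ->
    nm (\prod_(i <- A) ((1 - z * (x i)%:C)^-1 * cpow (1 - x i) z) - cexp L) <= e.
Proof.
move=> zr hL e e0; have [l hl el] := log_factors zr hL.
have [d d0 hd] := cexp_continuous L e0.
have [A0 hA0] := hl _ d0; exists A0 => A /hA0 /hd.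
by rewrite cexp_sum; congr (nm (_ - _) <= _); apply: eq_bigr => i _.
Qed.

End LogarithmicFamily.

(** * Monic polynomials over a finite field *)

Section MonicPolynomials.
Variable F : finFieldType.
Implicit Types (p f g : {poly F}) (n k N : nat).

Lemma deg_lt_size f : f != 0 -> (deg f).+1 = size f.
Proof. by move=> f0; rewrite /deg prednK// lt0n size_poly_eq0. Qed.

Lemma deg_monicM f g : f \is monic -> g \is monic -> deg (f * g) = (deg f + deg g)%N.
Proof.
move=> fm gm; rewrite /deg size_Mmonic ?monic_neq0//.
by have := deg_lt_size (monic_neq0 fm); have := deg_lt_size (monic_neq0 gm); rewrite /deg; lia.
Qed.

Lemma deg_monicX p k : p \is monic -> deg (p ^+ k) = (k * deg p)%N.
Proof. by move=> pm; rewrite /deg size_exp mulnC. Qed.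

Lemma monic_deg0 f : f \is monic -> deg f = 0%N -> f = 1.
Proof.
move=> fm /(congr1 S); rewrite deg_lt_size ?monic_neq0// => /eqP/size_poly1P[c c0 fE].
by move: fm; rewrite fE monicE lead_coefC => /eqP ->.
Qed.

Lemma monic_irr_monic p : monic_irr p -> p \is monic.
Proof. by case/andP. Qed.

Lemma monic_irr_irreducible p : monic_irr p -> irreducible_poly p.
Proof. by case/andP => _ /irreducibleP. Qed.

Lemma monic_irr_deg_gt0 p : monic_irr p -> (0 < deg p)%N.
Proof. by move=> /monic_irr_irreducible[]; rewrite /deg; case: (size p) => [|[]]. Qed.

Lemma monic_irr_coprime p p' : monic_irr p -> monic_irr p' -> p != p' -> coprimep p p'.
Proof.
move=> ip ip' pp'; rewrite irreducible_poly_coprime; last exact: monic_irr_irreducible.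
apply: contra pp' => pdvd; rewrite -eqp_monic ?monic_irr_monic//.
apply: (monic_irr_irreducible ip').2 => //.
by have [+ _] := monic_irr_irreducible ip; case: ltngtP.
Qed.

(** With this equivalence, identities between multiplicities are proved by testing divisibility by
    every power, through [eq_from_leq]. *)
Lemma dvdp_exp_multiplicity p f k : (0 < deg p)%N -> f != 0 ->
  (p ^+ k %| f) = (k <= multiplicity p f)%N.
Proof.
move=> p0 f0; have pN0 : p != 0 by apply: contraTneq p0 => ->; rewrite /deg size_poly0.
have bound j : p ^+ j %| f -> (j < size f)%N.
  move=> /(dvdp_leq f0) h; apply: leq_trans h.
  have := deg_lt_size (expf_neq0 j pN0); rewrite /deg size_exp => <-.
  by rewrite ltnS -{1}[j]mul1n leq_mul.
apply/idP/idP => [h|kM].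
  by apply: (@leq_bigmax_cond _ (fun j : 'I_(size f) => p ^+ j %| f)
    (fun j => nat_of_ord j) (Ordinal (bound _ h))).
apply: (dvdp_trans (dvdp_exp2l p kM)).
have [|j jD jE] := @eq_bigmax_cond _ (fun j : 'I_(size f) => p ^+ j %| f) (fun j => nat_of_ord j).
  apply/card_gt0P; have s0 : (0 < size f)%N by rewrite lt0n size_poly_eq0.
  by exists (Ordinal s0); rewrite unfold_in/= expr0 dvd1p.
by rewrite /multiplicity jE.
Qed.

Lemma multiplicity_mul_deg_le p f : (0 < deg p)%N -> f != 0 ->
  (multiplicity p f * deg p <= deg f)%N.
Proof.
move=> p0 f0; have := dvdp_exp_multiplicity (multiplicity p f) p0 f0.
rewrite leqnn => /(dvdp_leq f0) h.
by rewrite /deg mulnC -size_exp -!subn1 leq_sub2r.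
Qed.

Lemma eq_from_leq m n : (forall k, (k <= m)%N = (k <= n)%N) -> m = n.
Proof. by move=> h; apply/eqP; rewrite eqn_leq -h leqnn h leqnn. Qed.

Lemma multiplicity_mul_self p g : monic_irr p -> g != 0 ->
  multiplicity p (p * g) = (multiplicity p g).+1.
Proof.
move=> ip g0; have p0 := monic_irr_deg_gt0 ip.
have pN0 := monic_neq0 (monic_irr_monic ip).
apply: eq_from_leq => -[|k]//.
by rewrite -dvdp_exp_multiplicity ?mulf_neq0// exprS dvdp_mul2l// dvdp_exp_multiplicity.
Qed.

Lemma multiplicity_mul_other p p' g : monic_irr p -> monic_irr p' -> p' != p ->
  g != 0 -> multiplicity p' (p * g) = multiplicity p' g.
Proof.
move=> ip ip' pp' g0; have p0 := monic_irr_deg_gt0 ip'.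
have pN0 := monic_neq0 (monic_irr_monic ip).
apply: eq_from_leq => k.
rewrite -!dvdp_exp_multiplicity ?mulf_neq0// Gauss_dvdpr//.
exact/coprimep_expl/monic_irr_coprime.
Qed.

(** A finite set in [{poly F}], not in a type of bounded degree, so that products and polynomials of
    various degrees share one type. *)
Definition monics n : {fset {poly F}} :=
  [fset val f | f in [pred f : {poly_n.+1 F} | (val f \is monic) && (deg (val f) == n)]]%fset.

Definition irrs N : {fset {poly F}} :=
  [fset val p | p in [pred p : {poly_N.+1 F} | monic_irr (val p)]]%fset.

Lemma mem_monics n f : (f \in monics n) = (f \is monic) && (deg f == n).
Proof.
apply/imfsetP/idP => [[g /= gn ->]//|/andP[fm fn]].
have fs : (size f <= n.+1)%N by rewrite -(eqP fn) deg_lt_size ?monic_neq0.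
exists (npolyp n.+1 f); last by rewrite /= npolypK.
by change ((polyn (npolyp n.+1 f) \is monic) && (deg (polyn (npolyp n.+1 f)) == n));
  rewrite npolypK// fm.
Qed.

Lemma mem_irrs N p : (p \in irrs N) = monic_irr p && (deg p <= N)%N.
Proof.
apply/imfsetP/idP => [[g /= gi ->]|/andP[ip pN]].
  by rewrite [monic_irr _]gi; have := size_npoly g; rewrite /deg; case: (size _).
have ps : (size p <= N.+1)%N.
  by rewrite -deg_lt_size ?ltnS// monic_neq0// monic_irr_monic.
exists (npolyp N.+1 p); last by rewrite /= npolypK.
by change (monic_irr (polyn (npolyp N.+1 p))); rewrite npolypK.
Qed.

Lemma big_fset_fintype (V : nmodType) (T : choiceType) (I : finType) (P : pred I)
    (h : I -> T) (A : {fset T}) (G : T -> V) : injective h ->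
  (forall x, reflect (exists2 i, P i & x = h i) (x \in A)) ->
  \sum_(i | P i) G (h i) = \sum_(x <- A) G x.
Proof.
move=> hI hA; rewrite -big_filter -(big_map h xpredT G).
apply: perm_big; apply: uniq_perm => [||x].
- by rewrite map_inj_uniq// filter_uniq// index_enum_uniq.
- exact: fset_uniq.
apply/mapP/hA => -[j]; rewrite ?mem_filter.
  by move=> /andP[Pj _] ->; exists j.
by move=> Pj ->; exists j => //; rewrite mem_filter Pj mem_index_enum.
Qed.

Lemma multiplicity_gt0 p f : (0 < deg p)%N -> f != 0 ->
  (0 < multiplicity p f)%N = (p %| f).
Proof. by move=> p0 f0; rewrite -dvdp_exp_multiplicity. Qed.

Lemma multiplicity_eq0_deg p f : f \is monic -> (deg f < deg p)%N ->
  multiplicity p f = 0%N.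
Proof.
move=> fm fp; have p0 : (0 < deg p)%N by exact: leq_ltn_trans fp.
apply/eqP; rewrite -leqn0 leqNgt (multiplicity_gt0 p0 (monic_neq0 fm)).
apply: contraTN fp => /(dvdp_leq (monic_neq0 fm)) pf.
by rewrite -leqNgt /deg -!subn1 leq_sub2r.
Qed.

Lemma sum_irrs_widen (v : {poly F} -> nat) f N : f \is monic -> (deg f <= N)%N ->
  (\sum_(p <- irrs (deg f)) v p * multiplicity p f
   = \sum_(p <- irrs N) v p * multiplicity p f)%N.
Proof.
move=> fm fN; apply: big_fset_incl.
  by apply/fsubsetP => p; rewrite !mem_irrs => /andP[-> /leq_trans ->].
move=> p; rewrite !mem_irrs => /andP[ip pN]; rewrite ip/= -ltnNge => h.
by rewrite multiplicity_eq0_deg// muln0.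
Qed.

Lemma OmegaE f : f \is monic ->
  Omega f = (\sum_(p <- irrs (deg f)) 1 * multiplicity p f)%N.
Proof.
move=> fm; rewrite /Omega; pose v := fun p => multiplicity p f.
rewrite (@big_fset_fintype nat _ _ _ val
  [fset p in irrs (deg f) | p %| f]%fset v val_inj); last first.
  move=> p; apply: (iffP idP) => [|[p' /andP[ip' p'f] ->]]; last first.
    have := size_npoly p'.
    by move=> p's; rewrite !inE mem_irrs ip' p'f andbT /= /deg -!subn1 leq_sub2r.
  rewrite !inE mem_irrs => /andP[/andP[ip pN] pf].
  have ps : (size p <= size f)%N by exact: dvdp_leq (monic_neq0 fm) pf.
  by exists (npolyp (size f) p); rewrite /= npolypK// ip pf.
apply: etrans (eq_bigr _ (fun p _ => esym (mul1n (v p)))).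
apply: big_fset_incl => [|p].
  by apply/fsubsetP => p; rewrite !inE => /andP[].
rewrite !inE mem_irrs => /andP[ip pN]; rewrite ip pN/= => pf.
by apply/eqP; rewrite -leqn0 leqNgt (multiplicity_gt0 (monic_irr_deg_gt0 ip) (monic_neq0 fm)).
Qed.

(** The weight [v] is arbitrary because [v = 1] yields [Omega] and [v = deg] the degree. *)
Lemma sum_irrs_mul (v : {poly F} -> nat) p g : monic_irr p -> g \is monic ->
  (\sum_(p' <- irrs (deg (p * g))) v p' * multiplicity p' (p * g)
   = v p + \sum_(p' <- irrs (deg g)) v p' * multiplicity p' g)%N.
Proof.
move=> ip gm; have pm := monic_irr_monic ip.
rewrite (sum_irrs_widen v gm (leq_addl (deg p) (deg g))) -deg_monicM//.
have pI : p \in irrs (deg (p * g)) by rewrite mem_irrs ip deg_monicM// leq_addr.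
rewrite (big_fsetD1 p)//= [in RHS](big_fsetD1 p)//=.
rewrite multiplicity_mul_self ?monic_neq0// mulnS -addnA; congr (_ + (_ + _))%N.
rewrite big_seq [RHS]big_seq; apply: eq_bigr => p'; rewrite in_fsetD1 mem_irrs.
by move=> /and3P[pp' ip' _]; rewrite multiplicity_mul_other ?monic_neq0.
Qed.

Lemma Omega_mul p g : monic_irr p -> g \is monic -> Omega (p * g) = (Omega g).+1.
Proof.
move=> ip gm; rewrite (OmegaE gm) OmegaE; last by rewrite (monicMl g (monic_irr_monic ip)).
by rewrite (sum_irrs_mul (fun=> 1%N)).
Qed.

Lemma irr_factor f : f \is monic -> (0 < deg f)%N ->
  exists p g, [/\ monic_irr p, g \is monic & f = p * g].
Proof.
elim/ltn_ind: {f}(deg f) {-2}f (erefl (deg f)) => n IH f fn fm f0.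
have [irr|nirr] := boolP (irreducibleb f).
  by exists f, 1; rewrite /monic_irr fm irr rpred1 mulr1.
have [d [d1 df ndf]] : exists d : {poly F}, [/\ size d != 1%N, d %| f & ~~ (d %= f)].
  apply/not_existsP => h; move/negP: nirr; apply; apply/irreducibleP; split.
    by move: f0; rewrite /deg; case: (size f) => [|[]].
  by move=> d d1 df; apply/negPn/negP => ndf; apply: (h d).
have fN0 := monic_neq0 fm.
have dN0 : d != 0 by apply: contraNneq fN0 => d0; rewrite d0 dvd0p in df.
pose e := (lead_coef d)^-1 *: d.
have lN0 : (lead_coef d)^-1 != 0 by rewrite invr_eq0 lead_coef_eq0.
have em : e \is monic by rewrite monicE lead_coefZ mulVf// lead_coef_eq0.
have ed : e %= d by exact: eqp_scale.
have [g fE] : exists g, f = e * g.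
  have /dvdpP[g ->] : e %| f by rewrite (eqp_dvdl _ ed).
  by exists g; rewrite mulrC.
have gm : g \is monic by move: fm; rewrite fE monicMl.
have degf : deg f = (deg e + deg g)%N by rewrite fE deg_monicM.
have e0 : (0 < deg e)%N.
  rewrite lt0n; apply: contra d1 => /eqP/(monic_deg0 em) e1.
  by rewrite -(eqp_size ed) e1 size_poly1.
have g0 : (0 < deg g)%N.
  rewrite lt0n; apply: contra ndf => /eqP/(monic_deg0 gm) g1.
  by rewrite eqp_sym fE g1 mulr1.
have en : (deg e < n)%N by lia.
have [p [g' [ip g'm eE]]] := IH _ en e (erefl _) em e0.
exists p, (g' * g); split=> //; first by rewrite (monicMr g' gm).
by rewrite fE eE mulrA.
Qed.
(** This count stands in for unique factorisation: it converts the factor n of the recurrence into a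
    sum over the prime powers dividing [f]. *)
Lemma sum_deg_multiplicity f : f \is monic ->
  (\sum_(p <- irrs (deg f)) deg p * multiplicity p f)%N = deg f.
Proof.
have [n] := ubnP (deg f); elim: n f => // n IH f fn fm.
have [f0|f0] := posnP (deg f).
  rewrite [LHS]big_seq big1 ?f0// => p; rewrite mem_irrs leqn0 => /andP[ip].
  by rewrite -leqn0 leqNgt monic_irr_deg_gt0.
have [p [g [ip gm fE]]] := irr_factor fm f0; rewrite fE sum_irrs_mul//.
have p0 := monic_irr_deg_gt0 ip; have := deg_monicM (monic_irr_monic ip) gm.
move=> E; rewrite E IH//; move: fn; rewrite fE E; lia.
Qed.

End MonicPolynomials.

(** * The von Mangoldt identity for completely multiplicative weights *)

Section MultiplicativeWeights.
Variables (F : finFieldType) (K : comNzRingType) (w : {poly F} -> K).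
Hypotheses (w1 : w 1 = 1)
  (wM : forall p g, monic_irr p -> g \is monic -> w (p * g) = w p * w g).

Definition weight_sum (n : nat) : K := \sum_(f <- monics F n) w f.

Definition prime_power_term (m : nat) (p : {poly F}) (k : nat) : K :=
  if (k.+1 * deg p == m)%N then (deg p)%:R * w p ^+ k.+1 else 0.

(* The von Mangoldt function attached to [w], summed over the prime powers of
   degree [m]. *)
Definition mangoldt (m : nat) : K :=
  \sum_(p <- irrs F m) \sum_(k < m) prime_power_term m p k.

Lemma mangoldt_widen m n : (m <= n)%N ->
  mangoldt m = \sum_(p <- irrs F n) \sum_(k < n) prime_power_term m p k.
Proof.
move=> mn; rewrite /mangoldt.
have -> : \sum_(p <- irrs F n) \sum_(k < n) prime_power_term m p k
    = \sum_(p <- irrs F n) \sum_(k < m) prime_power_term m p k.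
  rewrite big_seq [RHS]big_seq; apply: eq_bigr => p; rewrite mem_irrs => /andP[ip _].
  rewrite [RHS](big_ord_widen_cond n xpredT (prime_power_term m p))//=.
  rewrite [LHS](bigID (fun k : 'I_n => (k < m)%N))/= [X in _ + X]big1 ?addr0//.
  move=> k; rewrite -leqNgt /prime_power_term => mk; case: eqP => // E.
  have := monic_irr_deg_gt0 ip; nia.
apply: big_fset_incl.
  by apply/fsubsetP => p; rewrite !mem_irrs => /andP[-> /leq_trans ->].
move=> p; rewrite !mem_irrs => /andP[ip pn]; rewrite ip/= -ltnNge => h.
by apply: big1 => k _; rewrite /prime_power_term; case: eqP => // E; nia.
Qed.

Lemma weightX p g j : monic_irr p -> g \is monic -> w (p ^+ j * g) = w p ^+ j * w g.
Proof.
move=> ip gm; elim: j => [|j IH]; first by rewrite !mul1r.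
rewrite !exprS -!mulrA wM ?IH//.
by rewrite (monicMr _ gm) monic_exp// monic_irr_monic.
Qed.

Lemma sum_monics_dvd n p j : monic_irr p ->
  \sum_(f <- monics F n | p ^+ j %| f) w f =
  if (j * deg p <= n)%N then w p ^+ j * weight_sum (n - j * deg p) else 0.
Proof.
move=> ip; have pm := monic_irr_monic ip; have pjm := monic_exp j pm.
case: leqP => jn; last first.
  rewrite big_seq_cond big1// => f; rewrite mem_monics => /andP[/andP[fm /eqP fn]].
  move=> /dvdpP[g fE]; have gm : g \is monic by move: fm; rewrite fE (monicMr g pjm).
  by move: fn jn; rewrite fE deg_monicM// deg_monicX// => <-; rewrite ltnNge leq_addl.
rewrite big_fset_condE.
have -> : [fset f in monics F n | p ^+ j %| f]%fset
    = [fset p ^+ j * g | g in monics F (n - j * deg p)]%fset.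
  apply/fsetP => f; rewrite !inE mem_monics; apply/andP/imfsetP => /=.
    move=> [/andP[fm /eqP fn] /dvdpP[g fE]].
    have gm : g \is monic by move: fm; rewrite fE (monicMr g pjm).
    exists g; last by rewrite mulrC.
    by rewrite mem_monics gm -fn fE deg_monicM// deg_monicX// addnK eqxx.
  move=> [g]; rewrite mem_monics => /andP[gm /eqP gn] ->.
  by rewrite (monicMl g pjm) gm deg_monicM// deg_monicX// gn subnKC// eqxx dvdp_mulr.
rewrite big_imfset/=; last first.
  by move=> g g' _ _; apply: mulfI; apply: monic_neq0.
rewrite mulr_sumr big_seq [RHS]big_seq; apply: eq_bigr => g.
by rewrite mem_monics => /andP[gm _]; rewrite weightX.
Qed.

Lemma sum_ord_ltn m n : (m <= n)%N -> (\sum_(k < n) (k < m))%N = m.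
Proof.
move=> mn; rewrite -big_mkcond/= -(big_ord_widen n (fun=> 1%N) mn).
by rewrite sum_nat_const card_ord muln1.
Qed.

(** Polynomial analogue of log = Lambda convolved with 1: the degree n of [f] is the sum of deg p
    over the prime powers p^j dividing [f]. Exchanging the sums and writing f = p^j g factors the
    weight as w(p)^j w(g). *)
Lemma weight_sum_logrec : logrec mangoldt weight_sum.
Proof.
split.
  rewrite /weight_sum (_ : monics F 0 = [fset 1%R]%fset) ?big_seq_fset1//.
  apply/fsetP => f; rewrite mem_monics inE; apply/andP/eqP => [[fm /eqP]|->].
    exact: monic_deg0.
  by rewrite rpred1 /deg size_poly1.
move=> n.
have -> : n%:R * weight_sum n = \sum_(p <- irrs F n) \sum_(k < n)
    (deg p)%:R * \sum_(f <- monics F n | p ^+ k.+1 %| f) w f.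
  transitivity (\sum_(f <- monics F n) \sum_(p <- irrs F n) \sum_(k < n)
      (deg p)%:R * (if p ^+ k.+1 %| f then w f else 0)).
    rewrite /weight_sum mulr_sumr big_seq [RHS]big_seq; apply: eq_bigr => f.
    rewrite mem_monics => /andP[fm /eqP fn].
    rewrite -[in LHS]fn -{1}(sum_deg_multiplicity fm) natr_sum mulr_suml fn.
    rewrite big_seq [RHS]big_seq; apply: eq_bigr => p; rewrite mem_irrs => /andP[ip _].
    rewrite natrM -mulrA -mulr_sumr; congr (_ * _).
    have p0 := monic_irr_deg_gt0 ip; have f0 := monic_neq0 fm.
    have mn : (multiplicity p f <= n)%N.
      by have := multiplicity_mul_deg_le p0 f0; rewrite fn; nia.
    (* The multiplicity becomes the number of [k < n] such that [p ^+ k.+1] divides [f]. *)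
    rewrite -[in LHS](sum_ord_ltn mn) natr_sum mulr_suml; apply: eq_bigr => k _.
    rewrite dvdp_exp_multiplicity//.
    by case: ltnP => _; rewrite ?mul1r ?mul0r.
  rewrite exchange_big/=; apply: eq_bigr => p _.
  rewrite exchange_big/=; apply: eq_bigr => k _.
  by rewrite -mulr_sumr -big_mkcond.
have -> : conv mangoldt weight_sum n = \sum_(p <- irrs F n) \sum_(k < n)
    \sum_(i < n.+1) prime_power_term i p k * weight_sum (n - i).
  rewrite /conv; transitivity (\sum_(i < n.+1) \sum_(p <- irrs F n) \sum_(k < n)
      prime_power_term i p k * weight_sum (n - i)).
    apply: eq_bigr => i _; have iN : (i <= n)%N by rewrite -ltnS.
    rewrite (mangoldt_widen iN) mulr_suml.
    by apply: eq_bigr => p _; rewrite mulr_suml.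
  by rewrite exchange_big/=; apply: eq_bigr => p _; rewrite exchange_big.
rewrite big_seq [RHS]big_seq; apply: eq_bigr => p; rewrite mem_irrs => /andP[ip _].
apply: eq_bigr => k _; rewrite sum_monics_dvd//.
case: leqP => kn; last first.
  rewrite mulr0 big1// => i _; rewrite /prime_power_term; case: eqP => [E|].
    by have := ltn_ord i; rewrite ltnS -E leqNgt kn.
  by rewrite mul0r.
rewrite (bigD1 (Ordinal (kn : (k.+1 * deg p < n.+1)%N)))//= big1 ?addr0.
  by rewrite /prime_power_term eqxx mulrA.
move=> i; rewrite -val_eqE/= eq_sym /prime_power_term => /negPf ->.
by rewrite mul0r.
Qed.

End MultiplicativeWeights.

Section CountingMonics.
Variable F : finFieldType.

Lemma card_monics n : \sum_(f <- monics F n) (1 : nat) = (#|F| ^ n)%N.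
Proof.
rewrite -card_npoly -sum1_card.
rewrite (@big_fset_fintype nat {poly F} {poly_n F} predT
  (fun g => 'X^n + val g) (monics F n) (fun=> 1%N))//.
  by move=> g g' /addrI /val_inj.
move=> f; apply: (iffP idP) => [|[g _ ->]].
  rewrite mem_monics => /andP[fm /eqP fn].
  have fs : size f = n.+1 by rewrite -fn deg_lt_size ?monic_neq0.
  have gs : (size (f - 'X^n)%R <= n)%N.
    apply/leq_sizeP => j; rewrite leq_eqVlt => /orP[/eqP <-|nj].
      rewrite coefB coefXn eqxx; move: fm; rewrite monicE /lead_coef fs /= => /eqP ->.
      by rewrite subrr.
    rewrite coefB coefXn gtn_eqF// subr0; apply/(leq_sizeP _ n.+1) => //.
    by rewrite fs.
  exists (npolyp n (f - 'X^n)) => //=.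
  by rewrite npolypK// addrC subrK.
have gs := size_npoly g.
have s : size ('X^n + val g) = n.+1 by rewrite size_polyDl size_polyXn// ltnS.
rewrite mem_monics /deg s eqxx andbT monicE lead_coefDl ?lead_coefXn//.
by rewrite size_polyXn ltnS.
Qed.

End CountingMonics.

(** * Primes of degree at least 2 and polynomials without roots *)

Section PrimeFamily.
Variables (R : realType) (F : finFieldType).
Local Notation C := R[i].
Implicit Types p f g : {poly F}.
Let q : nat := #|F|.

(** Extension by 0 makes all of [{poly F}] the index type, a zero weight giving the factor 1. The
    value y = 1/q serves the Euler product, a slightly larger [y] the radius of convergence of G. *)
Definition prime_weight (y : R) (p : {poly F}) : R :=
  if primes_ge2 p then y ^+ deg p else 0.

Lemma prime_weight_ge0 (y : R) p : 0 <= y -> 0 <= prime_weight y p.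
Proof. by move=> y0; rewrite /prime_weight; case: ifP => // _; rewrite exprn_ge0. Qed.

(** Primes of degree d are among the q^d monic polynomials of that degree, so a geometric series of
    ratio q y^2 dominates. *)
Lemma sum_prime_weight_sqr_le (y : R) : 0 <= y -> q%:R * y ^+ 2 < 1 ->
  sum_le (fun p => prime_weight y p ^+ 2) (1 - q%:R * y ^+ 2)^-1.
Proof.
move=> y0 qy A; pose D := (\sum_(p <- A) deg p).+1.
pose G (p : {poly F}) (d : nat) : R :=
  if (p \is monic) && (deg p == d) then (y ^+ 2) ^+ d else 0.
have y20 d : 0 <= (y ^+ 2) ^+ d by rewrite exprn_ge0 ?sqr_ge0.
apply: (@le_trans _ _ (\sum_(d < D) \sum_(p <- A) G p d)).
  rewrite exchange_big/= big_seq [leRHS]big_seq; apply: ler_sum => p pA.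
  have pD : (deg p < D)%N by rewrite ltnS (big_fsetD1 p)//= leq_addr.
  rewrite (bigD1 (Ordinal pD))//=; apply: ler_wpDr.
    by apply: sumr_ge0 => d _; rewrite /G; case: ifP.
  rewrite /G eqxx andbT /prime_weight /primes_ge2 /monic_irr.
  by case: ifP => [/andP[/andP[-> _] _]|_]; [rewrite exprAC|rewrite expr0n/=; case: ifP].
apply: le_trans (geometric_sum_le D _); last by rewrite qy mulr_ge0 ?sqr_ge0.
apply: ler_sum => d _; rewrite exprMn -natrX -card_monics natr_sum mulr_suml.
rewrite /G -big_mkcond/= big_fset_condE.
under [leRHS]eq_bigr do rewrite mul1r.
apply: fsubset_sum_le => //; apply/fsubsetP => p.
by rewrite !inE mem_monics => /andP[].
Qed.

(** The coefficient of u^m in the logarithm of the product, over primes of degree d >= 2, of (1 - z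
    u^d)^(-1) (1 - u^d)^z. *)
Definition prime_fiber (m : nat) (z : C) : C :=
  \sum_(p <- irrs F m) \sum_(k < m)
    if (2 <= deg p)%N && (k.+1 * deg p == m)%N then (z ^+ k.+1 - z) / k.+1%:R else 0.

(** Grouping by the degree of the prime power: a nonzero term has both degree and exponent at most
    [m], so the sum is finite. *)
Lemma has_sum_prime_fiber (y : R) z m :
  has_sum (fun x : {poly F} * nat =>
      if (x.2 * deg x.1 == m)%N then log_term (prime_weight y) z x else 0)
    ((y ^+ m)%:C * prime_fiber m z).
Proof.
pose f (x : {poly F} * nat) :=
  if (x.2 * deg x.1 == m)%N then log_term (prime_weight y) z x else 0.
have [K KE KS] : exists2 K : {fset nat}, (forall k, (k \in K) = (k <= m)%N) &
    forall G : nat -> C, \sum_(k <- K) G k = \sum_(k < m.+1) G k.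
  exists [fset id k | k in iota 0 m.+1]%fset => [k|G]; last exact: big_fset_iota.
  by apply/imfsetP/idP => [[l]|km];
    [change (l \in iota 0 m.+1 -> k = l -> (k <= m)%N); rewrite mem_iota => + ->|
     exists k => //; change (k \in iota 0 m.+1); rewrite mem_iota].
pose A := [fset ((p, k) : {poly F} * nat) | p in irrs F m, k in K]%fset.
have -> : (y ^+ m)%:C * prime_fiber m z = \sum_(x <- A) f x.
  rewrite big_imfset2/=; last by move=> [p k] [p' k'] _ _ /= [-> ->].
  rewrite mulr_sumr big_seq [RHS]big_seq; apply: eq_bigr => p.
  rewrite mem_irrs => /andP[ip pm].
  rewrite KS.
  rewrite big_ord_recl/=.
  rewrite {1}/f /log_term/log_weight/= mul0r if_same add0r mulr_sumr.
  apply: eq_bigr => k _; rewrite /f /= /bump/= add1n.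
  have [kE|kE] := eqVneq (k.+1 * deg p)%N m; last by rewrite andbF mulr0.
  rewrite andbT /log_term /log_weight/= /prime_weight /primes_ge2 ip/=.
  case: ifP => p2; last first.
    rewrite mulr0 expr0n/= mul0r; case: ifP => _; by rewrite mul0r.
  case: k kE => -[|k] kn /= kE; first by rewrite expr1 subrr mul0r !mulr0.
  rewrite -exprM mulnC kE rmorphM fmorphV rmorph_nat; ring.
apply: has_sum_finite => -[p k]; rewrite /f /log_term /log_weight/=.
case: eqP => // kE; case: leqP => k2; rewrite ?mul0r// => /negP h.
rewrite /prime_weight; case: ifP => [/andP[ip p2]|_]; last first.
  by rewrite expr0n; case: k k2 kE h => //= *; rewrite !mul0r.
exfalso; apply: h; apply/imfset2P; exists p.
  by rewrite /= mem_irrs ip/=; nia.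
exists k => //; rewrite /= KE.
by have := monic_irr_deg_gt0 ip; nia.
Qed.

Lemma logrec_lam_unique (K : numFieldType) (lam mu a : nat -> K) :
  logrec lam a -> logrec mu a -> lam =1 mu.
Proof.
move=> h1 h2 n; elim/ltn_ind: n => -[|n] IH; first by rewrite (logrec0 h1) (logrec0 h2).
have := logrec_S n h1; rewrite (logrec_S n h2).
have n0 : n.+1%:R != 0 :> K by rewrite pnatr_eq0.
move=> /(mulIf (invr_neq0 n0)).
rewrite (eq_bigr (fun i : 'I_n => lam i.+1 * a (n - i)%N)) => [|i _]; last by rewrite IH// ltnS.
by move=> /addIr.
Qed.

Lemma logrec_geometric (K : numFieldType) (t : K) :
  logrec (fun m => if m == 0%N then 0 else t ^+ m) (fun n => t ^+ n).
Proof.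
split=> // n; rewrite /conv big_ord_recl/= mul0r add0r.
rewrite (eq_bigr (fun=> t ^+ n)) ?sumr_const ?card_ord ?mulr_natl// => i _.
by rewrite /bump/= add1n -exprD subnKC.
Qed.

(** Gauss's identity for the sum of deg p over the primes of degree dividing m. There are q^n monic
    polynomials of degree n, and the generating series 1 / (1 - q u) determines its logarithmic
    derivative. *)
Lemma mangoldt1 m : (0 < m)%N -> mangoldt (fun _ : {poly F} => 1 : C) m = q%:R ^+ m.
Proof.
move=> m0; have h : logrec (mangoldt (fun _ : {poly F} => 1 : C)) (fun n => q%:R ^+ n).
  have := @weight_sum_logrec F C (fun=> 1) erefl.
  have -> : weight_sum (fun _ : {poly F} => 1 : C) = (fun n => q%:R ^+ n).
    by apply/funext => n; rewrite /weight_sum -natrX -card_monics natr_sum.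
  by apply=> *; rewrite mulr1.
by rewrite (logrec_lam_unique h (logrec_geometric _)) gtn_eqF.
Qed.

Definition rootless (f : {poly F}) : bool := [forall a : F, ~~ root f a].

Lemma rootlessM f g : rootless (f * g) = rootless f && rootless g.
Proof.
apply/forallP/andP => [h|[/forallP hf /forallP hg] a].
  by split; apply/forallP => a; have := h a; rewrite rootM negb_or => /andP[].
by rewrite rootM negb_or hf hg.
Qed.

Lemma monic_deg1_irr p : p \is monic -> deg p = 1%N -> monic_irr p.
Proof.
move=> pm p1; have ps : size p = 2 by rewrite -deg_lt_size ?p1 ?monic_neq0.
rewrite /monic_irr pm; apply/irreducibleP; split; first by rewrite ps.
move=> d d1 dp; rewrite -(dvdp_size_eqp dp) ps.
have := dvdp_leq (monic_neq0 pm) dp; rewrite ps.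
have : d != 0 by apply: contraTneq dp => ->; rewrite dvd0p monic_neq0.
by rewrite -size_poly_gt0; case: (size d) d1 => [|[|[]]].
Qed.

Lemma rootless_irr p : monic_irr p -> rootless p = (2 <= deg p)%N.
Proof.
move=> ip; have pm := monic_irr_monic ip; have p0 := monic_irr_deg_gt0 ip.
apply/idP/idP => [/forallP h|p2].
  rewrite ltn_neqAle p0 andbT eq_sym; apply/negP => /eqP p1.
  have ps : size p = 2 by rewrite -deg_lt_size ?p1 ?monic_neq0.
  have := h (- p`_0); rewrite rootE.
  have : lead_coef p = 1 by apply/eqP; rewrite -monicE.
  rewrite lead_coefE ps /= => p11.
  by rewrite horner_coef ps big_ord_recl big_ord1/= p11 expr0 mulr1 mul1r expr1 subrr eqxx.
apply/forallP => a; apply/negP; rewrite -dvdp_XsubCl => h.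
have := (monic_irr_irreducible ip).2 _ _ h.
rewrite size_XsubC => /(_ isT) /eqp_size; rewrite size_XsubC.
by move=> sp; move: p2; rewrite /deg -sp.
Qed.

Definition rootless_weight (z : C) (f : {poly F}) : C :=
  if rootless f then z ^+ Omega f else 0.

Lemma rootless1 : rootless 1.
Proof. by apply/forallP => a; rewrite root1. Qed.

Lemma Omega1 : Omega (1 : {poly F}) = 0%N.
Proof.
rewrite OmegaE ?rpred1// big_seq big1// => p; rewrite mem_irrs => /andP[/monic_irr_deg_gt0].
by rewrite /deg size_poly1/=; lia.
Qed.

Lemma rootless_weight1 z : rootless_weight z 1 = 1.
Proof. by rewrite /rootless_weight rootless1 Omega1. Qed.

Lemma rootless_weight_irr z p : monic_irr p ->
  rootless_weight z p = if (2 <= deg p)%N then z else 0.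
Proof.
move=> ip; rewrite /rootless_weight rootless_irr//; case: ifP => // _.
by rewrite -[p]mulr1 Omega_mul ?rpred1// Omega1 expr1.
Qed.

Lemma rootless_weightM z p g : monic_irr p -> g \is monic ->
  rootless_weight z (p * g) = rootless_weight z p * rootless_weight z g.
Proof.
move=> ip gm; rewrite (rootless_weight_irr z ip) -(rootless_irr ip) /rootless_weight rootlessM.
case: (rootless p); case: (rootless g); rewrite ?mulr0 ?mul0r//=.
by rewrite Omega_mul// exprS.
Qed.

Lemma Mtilde_sumE n z : Mtilde_sum F n z = weight_sum (rootless_weight z) n.
Proof.
rewrite /Mtilde_sum /weight_sum.
rewrite (@big_fset_fintype C {poly F} _ _ val
  [fset f in monics F n | rootless f]%fset (fun f => z ^+ Omega f) val_inj).
  by rewrite -big_fset_condE big_mkcond; apply: eq_bigr.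
move=> f; apply: (iffP idP) => [|[g]].
  rewrite !inE mem_monics => /andP[/andP[fm /eqP fn] fr].
  have fs : (size f <= n.+1)%N by rewrite -fn deg_lt_size ?monic_neq0.
  by exists (npolyp n.+1 f); rewrite /= ?inE/= npolypK// fm fn eqxx.
by rewrite !inE mem_monics => /and3P[gm gn gr] ->; rewrite gm gn.
Qed.

Lemma sum_deg1 m : (0 < m)%N ->
  \sum_(p <- irrs F m | deg p == 1%N) (1 : C) = q%:R.
Proof.
move=> m0; rewrite -[q]expn1 -card_monics natr_sum big_fset_condE.
apply: eq_fbigl => p; rewrite !inE mem_irrs mem_monics; apply/andP/andP.
  by move=> [/andP[ip _] p1]; rewrite monic_irr_monic.
by move=> [pm /eqP p1]; rewrite p1 monic_deg1_irr.
Qed.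

(** Subtract z times [mangoldt1]. A prime of degree at least 2 with m = j deg p leaves deg p (z^j -
    z) = m (z^j - z) / j; each of the q linear primes has weight 0 and leaves -z. *)
Lemma mangoldt_rootless z m : (0 < m)%N ->
  mangoldt (rootless_weight z) m
  = z * q%:R ^+ m + (m%:R * prime_fiber m z - z * q%:R).
Proof.
move=> m0; apply/eqP; rewrite addrC -subr_eq; apply/eqP.
rewrite -(mangoldt1 m0) /mangoldt -(sum_deg1 m0) /prime_fiber !mulr_sumr -sumrB.
rewrite [X in _ - X]big_mkcond -sumrB.
rewrite big_seq [RHS]big_seq; apply: eq_bigr => p; rewrite mem_irrs => /andP[ip _].
rewrite !mulr_sumr -sumrB /prime_power_term.
have p0 := monic_irr_deg_gt0 ip.
have [p1|p1] := eqVneq (deg p) 1%N.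
  rewrite p1 /= [X in _ = X - _]big1 ?sub0r; last by move=> k _; rewrite mulr0.
  case: m m0 => // m _; rewrite (bigD1 ord_max)//= muln1 eqxx big1 ?addr0.
    by rewrite rootless_weight_irr// p1/= expr0n/= mulr0 sub0r !mul1r expr1n !mulr1.
  by move=> k /negPf; rewrite -val_eqE/= muln1 eqSS => ->; rewrite mulr0 subrr.
have p2 : (2 <= deg p)%N by rewrite ltn_neqAle eq_sym p1.
rewrite p2/= subr0; apply: eq_bigr => k _; case: eqP => [kE|]; last by rewrite !mulr0 subrr.
rewrite rootless_weight_irr// p2 expr1n.
have -> : m%:R = k.+1%:R * (deg p)%:R :> C by rewrite -natrM kE.
have : k.+1%:R != 0 :> C by rewrite pnatr_eq0.
by set u := k.+1%:R => u0; field.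
Qed.

(** After rescaling u to u / q, the constant part [z] of the logarithmic derivative belongs to (1 -
    u)^(-z), with coefficients [c]; the rest belongs to G(u / q), with coefficients [b]. *)
Lemma Mtilde_sum_conv n z (b c : nat -> C) :
  logrec (fun m => if m == 0%N then 0 else z) c ->
  logrec (fun m => if m == 0%N then 0 else
    (m%:R * prime_fiber m z - z * q%:R) * q%:R^-1 ^+ m) b ->
  Mtilde_sum F n z = q%:R ^+ n * conv b c n.
Proof.
move=> hc hb; have q0 : q%:R != 0 :> C.
  by rewrite pnatr_eq0 -lt0n; apply/card_gt0P; exists 0.
have hw := weight_sum_logrec (rootless_weight1 z) (rootless_weightM z).
have := logrec_scale q%:R^-1 hw.
have -> : (fun m => mangoldt (rootless_weight z) m * q%:R^-1 ^+ m)
    = (fun m => (if m == 0%N then 0 else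
      (m%:R * prime_fiber m z - z * q%:R) * q%:R^-1 ^+ m) + (if m == 0%N then 0 else z)).
  apply/funext => -[|m] /=; first by rewrite (logrec0 hw) mul0r addr0.
  rewrite mangoldt_rootless// mulrDl addrC; congr (_ + _).
  by rewrite exprVn mulfK// expf_neq0.
move=> /logrec_unique /(_ (logrec_conv hb hc)) /(_ n) <-.
by rewrite Mtilde_sumE exprVn mulrC divfK// expf_neq0.
Qed.

End PrimeFamily.

(** * The reciprocal of the Gamma function *)

Section Gamma.
Variable R : realType.
Local Notation C := R[i].
Implicit Types (z : C) (n m : nat).

Lemma cvg_nmP (u : nat -> C) (l : C) :
  (forall e : R, 0 < e -> exists N, forall n, (N <= n)%N -> nm (u n - l) <= e) <->
  ((u : nat -> R[i]^o) @ \oo --> (l : R[i]^o)).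
Proof.
split=> [h|/cvgrPdist_le h e e0].
  apply/cvgrPdist_le => e e0.
  have [e1 eE] : exists e1 : R, e = e1%:C.
    by apply/complex_realP; rewrite realE ltW.
  move: e0; rewrite eE ltcR => /h[N hN].
  by exists N => // n /= Nn; rewrite distrC nmE lecR; exact: hN.
have e0C : 0 < (e%:C : C) by rewrite ltcR.
have [N _ hN] := h _ e0C; exists N => n Nn.
by have := hN n Nn; rewrite distrC nmE lecR.
Qed.

Lemma bound_divS_cvg (u : nat -> C) (l : C) (A : R) :
  (forall n, nm (u n - l) <= A / n.+1%:R) -> (u : nat -> R[i]^o) @ \oo --> (l : R[i]^o).
Proof.
move=> h; apply/cvg_nmP => e e0; exists (Num.truncn (A / e)) => n hn.
apply: (le_trans (h n)); rewrite ler_pdivrMr ?ltr0n// mulrC -ler_pdivrMr//.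
by rewrite ltW// (lt_le_trans (truncnS_gt _))// ler_nat ltnS.
Qed.

Lemma ln_le_sub1 (x : R) : 0 < x -> ln x <= x - 1.
Proof. by move=> x0; have := expR_ge1Dx (ln x); rewrite lnK ?posrE//; lra. Qed.

Lemma ln1D_bounds (x : R) : 0 <= x -> 0 <= ln (1 + x) <= x /\ `|ln (1 + x) - x| <= x ^+ 2.
Proof.
move=> x0; have x10 : 0 < 1 + x by rewrite ltr_wpDr.
have l1 : ln (1 + x) <= x by have := ln_le_sub1 x10; move: (ln _) => l; lra.
have l2 : x / (1 + x) <= ln (1 + x).
  have := @ln_le_sub1 (1 + x)^-1; rewrite invr_gt0 x10 lnV ?posrE// => /(_ isT).
  have -> : x / (1 + x) = 1 - (1 + x)^-1 by field; rewrite gt_eqF.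
  by move=> ?; lra.
have l3 : x - x ^+ 2 <= x / (1 + x).
  rewrite ler_pdivlMr//; have : 0 <= x ^+ 3 by rewrite exprn_ge0.
  have -> : (x - x ^+ 2) * (1 + x) = x - x ^+ 3 by ring.
  by move=> ?; lra.
have l4 : 0 <= x / (1 + x) by rewrite divr_ge0// ltW.
split; first by rewrite l1 (le_trans l4).
have x2 : 0 <= x ^+ 2 by exact: sqr_ge0.
by rewrite ler_norml; apply/andP; split; lra.
Qed.

Definition gauss_const (r : R) : R := r ^+ 2 + (1 + r) * (r + 10%:R * r ^+ 2 * expR r).

Lemma gauss_const_ge0 (r : R) : 0 <= r -> 0 <= gauss_const r.
Proof.
by move=> r0; rewrite /gauss_const addr_ge0 ?sqr_ge0// mulr_ge0 ?addr_ge0// !mulr_ge0 ?expR_ge0 ?sqr_ge0.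
Qed.

Lemma gauss_ratio_le (r x : R) z : 0 <= x <= 1 -> nm z <= r ->
  nm ((1 + z * x%:C) * cpow (1 + x) (- z) - 1) <= gauss_const r * x ^+ 2.
Proof.
move=> /andP[x0 x1] zr; have r0 : 0 <= r by apply: le_trans zr; exact: nm_ge0.
have [/andP[l0 l1] l2] := ln1D_bounds x0; rewrite /cpow.
set l := ln (1 + x) in l0 l1 l2 *; set w := - z * l%:C.
have wr : nm w <= r * x.
  by rewrite nmM nmN nmC ger0_norm// ler_pM// nm_ge0.
have wr' : nm w <= r by apply: (le_trans wr); rewrite ler_piMr.
have e1 := cexp_quadratic w.
have e1' : nm (cexp w - 1 - w) <= 10%:R * r ^+ 2 * expR r * x ^+ 2.
  apply: (le_trans e1).
  have -> : 10%:R * r ^+ 2 * expR r * x ^+ 2 = 10%:R * (r * x) ^+ 2 * expR r by ring.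
  apply: ler_pM; rewrite ?ler_expR ?expR_ge0//; first by rewrite mulr_ge0 ?sqr_ge0.
  by rewrite ler_wpM2l// lerXn2r// nnegrE ?nm_ge0// mulr_ge0.
pose e2 := w + z * x%:C.
have e2' : nm e2 <= r * x ^+ 2.
  have -> : e2 = - z * (l - x)%:C by rewrite /e2 /w rmorphB; ring.
  by rewrite nmM nmN nmC ler_pM// nm_ge0.
pose e3 := (cexp w - 1 - w) + e2.
have e3' : nm e3 <= (r + 10%:R * r ^+ 2 * expR r) * x ^+ 2.
  apply: (le_trans (nmD _ _)); rewrite mulrDl [leLHS]addrC; exact: (lerD e2' e1').
(* Since exp w = 1 - z x + e3, the terms linear in [x] cancel; [gauss_const] collects what
   remains. *)
have -> : (1 + z * x%:C) * cexp w - 1 = - (z * x%:C) ^+ 2 + (1 + z * x%:C) * e3.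
  by rewrite /e3 /e2; ring.
apply: (le_trans (nmD _ _)); rewrite /gauss_const [leRHS]mulrDl; apply: lerD.
  by rewrite nmN nmX nmM nmC ger0_norm// -exprMn lerXn2r// ?nnegrE ?mulr_ge0 ?nm_ge0// ler_wpM2r.
rewrite nmM -mulrA ler_pM ?nm_ge0//; apply: (le_trans (nmD _ _)).
rewrite nm1 lerD2l nmM nmC ger0_norm//.
by rewrite -[leRHS]mulr1 ler_pM ?nm_ge0.
Qed.

Definition rising_prod z n : C := \prod_(i < n) (1 + z / i.+1%:R).

(** Gauss's product for 1 / Gamma (z + 1), with [n.+1] in the power: the value at [n = 0] is 1, and
    the index fits the coefficient [n.+1] of (1 - u)^(-z) in [rising_coef_gauss]. *)
Definition gauss z n : C := rising_prod z n * cpow n.+1%:R (- z).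

Lemma cpow_succ n z :
  cpow n.+2%:R z = cpow (n.+1%:R : R) z * cpow (1 + n.+1%:R^-1) z.
Proof.
have p1 : 0 < n.+1%:R :> R by rewrite ltr0n.
have p2 : 0 < 1 + n.+1%:R^-1 :> R by rewrite ltr_wpDr// invr_ge0.
rewrite -(cpowM _ p1 p2) mulrDr mulr1 divff ?pnatr_eq0//.
by rewrite -[n.+2%:R]natr1.
Qed.

Lemma gaussS z n : gauss z n.+1
  = gauss z n * ((1 + z * (n.+1%:R^-1 : R)%:C) * cpow (1 + n.+1%:R^-1) (- z)).
Proof.
rewrite /gauss /rising_prod big_ord_recr/=.
rewrite cpow_succ.
rewrite fmorphV rmorph_nat; ring.
Qed.

(** The telescoping form gives explicit tails of order 1/n, the source of the error term in
    [gauss_rate]. *)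
Lemma inv_sqr_telescope n :
  (n.+1%:R^-1 : R) ^+ 2 <= 2 * (n.+1%:R^-1 - n.+2%:R^-1).
Proof.
have -> : n.+1%:R^-1 - n.+2%:R^-1 = (n.+1%:R^-1 : R) * n.+2%:R^-1.
  by rewrite -[n.+2%:R]natr1; field; rewrite -?natr1 !gt_eqF// ?ltr_wpDl// addr_ge0.
rewrite expr2 mulrCA ler_wpM2l// ler_pdivlMr ?ltr0n// mulrC ler_pdivrMr ?ltr0n//.
by rewrite -natrM ler_nat; lia.
Qed.

Lemma gauss_bound (r : R) z n : nm z <= r ->
  nm (gauss z n) <= expR (2 * gauss_const r * (1 - n.+1%:R^-1)).
Proof.
move=> zr; have r0 : 0 <= r by apply: le_trans zr; exact: nm_ge0.
have c0 := gauss_const_ge0 r0.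
elim: n => [|n IH].
  by rewrite /gauss /rising_prod big_ord0 cpow1 mul1r nm1 invr1 subrr mulr0 expR0.
have x01 : 0 <= (n.+1%:R^-1 : R) <= 1 by rewrite invr_ge0 ler0n invf_le1// ler1n.
have := gauss_ratio_le x01 zr; rewrite gaussS nmM; set v := _ * cpow _ _ => hv.
have hv' : nm v <= expR (gauss_const r * n.+1%:R^-1 ^+ 2).
  apply: le_trans (expR_ge1Dx _); rewrite -lerBlDl; apply: le_trans hv.
  by rewrite -[1]nm1; exact: le_nmB.
apply: (le_trans (ler_pM (nm_ge0 _) (nm_ge0 _) IH hv')); rewrite -expRD ler_expR.
have := inv_sqr_telescope n; move: c0; set c := gauss_const r.
move=> c0 /(ler_wpM2l c0); set a := n.+1%:R^-1; set b := n.+2%:R^-1; lra.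
Qed.

Lemma gauss_dist (r : R) z n k : nm z <= r ->
  nm (gauss z (n + k) - gauss z n)
  <= expR (2 * gauss_const r) * (2 * gauss_const r) * (n.+1%:R^-1 - (n + k).+1%:R^-1).
Proof.
move=> zr; have r0 : 0 <= r by apply: le_trans zr; exact: nm_ge0.
have c0 := gauss_const_ge0 r0.
elim: k => [|k IH]; first by rewrite addn0 !subrr nm0 mulr0.
rewrite addnS; set m := (n + k)%N in IH *.
apply: (le_trans (nm_le_dist _ _ (gauss z m))).
have x01 : 0 <= (m.+1%:R^-1 : R) <= 1 by rewrite invr_ge0 ler0n invf_le1// ler1n.
have hm : nm (gauss z m.+1 - gauss z m)
    <= expR (2 * gauss_const r) * (2 * gauss_const r) * (m.+1%:R^-1 - m.+2%:R^-1).
  rewrite gaussS -[X in _ - X]mulr1 -mulrBr nmM -!mulrA; apply: ler_pM; rewrite ?nm_ge0//.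
    apply: (le_trans (gauss_bound m zr)); rewrite ler_expR.
    by rewrite ler_piMr ?mulr_ge0// gerBl invr_ge0.
  apply: (le_trans (gauss_ratio_le x01 zr)); rewrite [leRHS]mulrCA ler_wpM2l//.
  exact: inv_sqr_telescope.
apply: (le_trans (lerD hm IH)); rewrite -mulrDr; apply: ler_wpM2l.
  by rewrite !mulr_ge0 ?expR_ge0.
by rewrite [leLHS]addrC subrKA.
Qed.

End Gamma.

(** * Convergence and analyticity of Gauss's product *)

Section GammaLimit.
Variable R : realType.
Local Notation C := R[i].
Implicit Types (z : C) (n m k : nat).

Lemma cpow1D_cvg z (c : R) : 0 <= c ->
  (fun n => cpow (1 + c / n.+1%:R) z : R[i]^o) @ \oo --> (1 : R[i]^o).
Proof.
move=> c0; pose M := nm z * c.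
have M0 : 0 <= M by rewrite mulr_ge0 ?nm_ge0.
apply: (@bound_divS_cvg _ _ _ ((1 + 10%:R * M * expR M) * M)) => n.
have x0 : 0 <= c / n.+1%:R by rewrite divr_ge0.
have [/andP[l0 l1] _] := ln1D_bounds x0.
have wM : nm (z * (ln (1 + c / n.+1%:R))%:C) <= M / n.+1%:R.
  by rewrite nmM nmC ger0_norm// /M -mulrA ler_wpM2l ?nm_ge0.
have wM' : nm (z * (ln (1 + c / n.+1%:R))%:C) <= M.
  by apply: (le_trans wM); rewrite ler_pdivrMr ?ltr0n// ler_peMr// ler1n.
apply: (le_trans (cexp_linear wM')); rewrite -[leRHS]mulrA ler_wpM2l//.
by rewrite addr_ge0// mulr_ge0 ?expR_ge0// mulr_ge0.
Qed.

Lemma cvg_succP (u : nat -> C) (l : C) :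
  ((fun n => u n.+1 : R[i]^o) @ \oo --> (l : R[i]^o)) <->
  ((u : nat -> R[i]^o) @ \oo --> (l : R[i]^o)).
Proof. by rewrite -(cvg_shiftS (u : nat -> R[i]^o)). Qed.

(** Only the factors 1 + z / k with k > m are written as exponentials: they do not vanish for |z| <
    m + 1. The zeros of 1 / Gamma in that disc stay in the polynomial [rising_prod z m]. *)
Definition gamma_weight m k : R := if (m < k)%N then k%:R^-1 else 0.

Lemma gamma_weight_ge0 m k : 0 <= gamma_weight m k.
Proof. by rewrite /gamma_weight; case: ifP => // _; rewrite invr_ge0. Qed.

Lemma gamma_weight_le m (r : R) k : 0 <= r -> gamma_weight m k * r <= r / m.+1%:R.
Proof.
move=> r0; rewrite mulrC ler_wpM2l// /gamma_weight; case: ifP => [mk|_].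
  by rewrite lef_pV2 ?posrE ?ltr0n ?ler_nat//; exact: leq_ltn_trans mk.
by rewrite invr_ge0.
Qed.

Lemma sum_gamma_weight_sqr m : sum_le (fun k => gamma_weight m k ^+ 2) 2.
Proof.
apply: sum_le_fset_nat => [k|n]; first exact: sqr_ge0.
apply: (@le_trans _ _ (\sum_(k < n.+1) gamma_weight m k ^+ 2)).
  by rewrite big_ord_recr/= lerDl sqr_ge0.
rewrite big_ord_recl/= {1}/gamma_weight ltn0 expr0n/= add0r.
apply: (@le_trans _ _ (2 * (1 - n.+1%:R^-1))); last first.
  by rewrite ler_piMr// gerBl invr_ge0.
elim: n => [|n IH]; first by rewrite big_ord0 invr1 subrr mulr0.
rewrite big_ord_recr/=; apply: (le_trans (lerD IH _)).
  apply: le_trans (inv_sqr_telescope R n); rewrite /bump/= add1n /gamma_weight.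
  by case: ifP => // _; rewrite expr0n/= sqr_ge0.
by rewrite -mulrDr addrA subrK.
Qed.

(** At [- z] the family produces the inverses of 1 + z / k, and the powers (1 - 1/k)^(-z) telescope
    to (m / n)^(-z), which requires m > 0. *)
Lemma gamma_product m z n : (0 < m)%N -> nm z < m.+1%:R -> (m <= n)%N ->
  (\prod_(k < n.+1) ((1 - (- z) * (gamma_weight m k)%:C)^-1
      * cpow (1 - gamma_weight m k) (- z)))
    * (rising_prod z n * cpow n%:R (- z)) = rising_prod z m * cpow m%:R (- z).
Proof.
move=> m0 zm; elim: n => [|n IH]; first by rewrite leqn0 => /eqP mE; rewrite mE in m0.
rewrite leq_eqVlt => /orP[/eqP <-|mn].
  rewrite big1 ?mul1r// => k _.
  rewrite /gamma_weight ltnNge -ltnS ltn_ord/=.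
  by rewrite mulr0 !subr0 invr1 mul1r cpow1.
rewrite -[RHS](IH mn) big_ord_recr/= -[LHS]mulrA; congr (_ * _).
have gE : gamma_weight m n.+1 = n.+1%:R^-1 by rewrite /gamma_weight mn.
rewrite gE /rising_prod big_ord_recr/=.
have n0 : (0 < n)%N by lia.
have nS0 : n.+1%:R != 0 :> C by rewrite pnatr_eq0.
have zn : 1 + z / n.+1%:R != 0 :> C.
  apply/eqP => /eqP; rewrite addrC addr_eq0 => /eqP h.
  have := congr1 (@nm R) h; rewrite nmN nm1 nmM nmV nm_nat => h1.
  have : nm z = n.+1%:R.
    by rewrite -[LHS](divfK (x := n.+1%:R)) ?pnatr_eq0// h1 mul1r.
  move=> zE; rewrite zE ltr_nat in zm; lia.
have -> : cpow (1 - n.+1%:R^-1) (- z) = cpow (n%:R : R) (- z) / cpow n.+1%:R (- z).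
  have p1 : 0 < n%:R :> R by rewrite ltr0n.
  have p2 : 0 < n.+1%:R :> R by rewrite ltr0n.
  have p3 : 0 < n.+1%:R^-1 :> R by rewrite invr_gt0.
  have -> : 1 - n.+1%:R^-1 = n%:R * n.+1%:R^-1 :> R.
    apply: (mulIf (lt0r_neq0 p2)); rewrite mulrBl mul1r mulVf ?lt0r_neq0//.
    by rewrite divfK ?lt0r_neq0// -[n.+1%:R]natr1 addrK.
  by rewrite (cpowM _ p1 p3) (cpowV _ p2).
rewrite fmorphV rmorph_nat mulNr opprK.
have c1 := cpow_neq0 (n.+1%:R : R) (- z).
set a := cpow _ _; set b := cpow n.+1%:R _ in c1 *; set p := \prod_(_ < _) _.
move: (n.+1%:R : C) nS0 zn => N nS0 zn.
have Nz : N + z != 0.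
  apply: contra zn => /eqP h; apply/eqP/(mulfI nS0).
  by rewrite mulr0 mulrDr mulr1 [N * _]mulrC divfK.
by field; rewrite Nz nS0 c1.
Qed.

Lemma gauss_cvg_exp m (r : R) z L : (0 < m)%N -> 1 <= r -> r < m.+1%:R -> nm z <= r ->
  has_sum (log_term (gamma_weight m) (- z)) L ->
  (gauss z : nat -> R[i]^o) @ \oo -->
    (rising_prod z m * cpow m%:R (- z) / cexp L : R[i]^o).
Proof.
move=> m0 r1 rm zr hL; have r0 : 0 <= r by exact: le_trans r1.
have th1 : r / m.+1%:R < 1 by rewrite ltr_pdivrMr ?ltr0n// mul1r.
have zr' : nm (- z) <= r by rewrite nmN.
have [l hl el] := log_factors (gamma_weight_ge0 m) r1 th1
  (fun k => gamma_weight_le m k r0) zr' hL.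
pose u n : C := \prod_(k < n.+1) ((1 - (- z) * (gamma_weight m k)%:C)^-1
      * cpow (1 - gamma_weight m k) (- z)).
have hu : (u : nat -> R[i]^o) @ \oo --> (cexp L : R[i]^o).
  apply/cvg_nmP => e e0; have [d d0 hd] := cexp_continuous L e0.
  have [N hN] := has_sum_series hl d0; exists N => n Nn.
  have := hd _ (hN n.+1 (leqW Nn)); rewrite cexp_sum; congr (nm (_ - _) <= _).
  by apply: eq_bigr => k _.
have hP : (fun n => rising_prod z n * cpow n%:R (- z) : R[i]^o) @ \oo -->
    (rising_prod z m * cpow m%:R (- z) / cexp L : R[i]^o).
  have hM : (fun n => rising_prod z m * cpow m%:R (- z) / u n : R[i]^o) @ \oo -->
    (rising_prod z m * cpow m%:R (- z) / cexp L : R[i]^o).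
    apply: cvgM; first exact: cvg_cst.
    by apply: cvgV => //; exact: cexp_neq0.
  apply: cvg_trans hM; apply: near_eq_cvg; exists m => // n /= mn.
  have u0 : u n != 0.
    apply/prodf_neq0 => k _; rewrite -el; exact: cexp_neq0.
  rewrite -(gamma_product m0 (le_lt_trans zr rm) mn) -/(u n).
  by rewrite mulrAC divff// mul1r.
apply/cvg_succP.
have -> : (fun n => gauss z n.+1) = (fun n =>
    (rising_prod z n.+1 * cpow n.+1%:R (- z)) * cpow (1 + 1 / n.+1%:R) (- z)).
  by apply/funext => n; rewrite /gauss cpow_succ mulrA div1r.
rewrite -[X in _ --> X]mulr1; apply: cvgM; last exact: cpow1D_cvg.
exact/(cvg_succP (fun n => rising_prod z n * cpow n%:R (- z))).
Qed.

Lemma rising_prodE z n :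
  \prod_(0 <= k < n) (z + 1 + k%:R) = n`!%:R * rising_prod z n.
Proof.
rewrite big_mkord; elim: n => [|n IH].
  by rewrite /rising_prod !big_ord0 mulr1.
rewrite /rising_prod !big_ord_recr/= IH -/(rising_prod z n) factS natrM.
have n0 : n.+1%:R != 0 :> C by rewrite pnatr_eq0.
have -> : z + 1 + n%:R = z + n.+1%:R by rewrite -[n.+1%:R]natr1; ring.
by move: n0; set a := n.+1%:R => n0; field.
Qed.

Lemma gauss_cvg_rGamma z l : (gauss z : nat -> R[i]^o) @ \oo --> (l : R[i]^o) ->
  rGamma (z + 1) = l.
Proof.
move=> hg; apply: (@cvg_lim R[i]^o (@norm_hausdorff _ R[i]^o)).
(* The shift avoids [cpow 0]. The sequence defining [rGamma] then differs from [gauss] by the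
   factors (n+2)/(n+1) and ((n+3)/(n+1))^z, both tending to 1. *)
apply/cvg_succP.
have -> : (fun n => (\prod_(0 <= k < n.+2) (z + 1 + k%:R)) /
    (n.+1`!%:R * cpow n.+1%:R (z + 1)))
  = (fun n => gauss z n.+2 * (cpow (1 + 1 / n.+1%:R) 1 * cpow (1 + 2 / n.+1%:R) z)).
  apply/funext => n /=; rewrite rising_prodE /gauss factS natrM.
  have n0 : 0 < n.+1%:R :> R by rewrite ltr0n.
  have e1 : 0 < 1 + 1 / n.+1%:R :> R by rewrite ltr_wpDr// divr_ge0.
  have e2 : 0 < 1 + 2 / n.+1%:R :> R by rewrite ltr_wpDr// divr_ge0.
  have E2 : (1 + 2 / n.+1%:R) = n.+3%:R / n.+1%:R :> R.
    rewrite -[n.+3%:R]natr1 -[n.+2%:R]natr1; field.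
    by rewrite ?natr1 ?pnatr_eq0.
  have E1 : (1 + 1 / n.+1%:R) = n.+2%:R / n.+1%:R :> R.
    by rewrite -[n.+2%:R]natr1; field; rewrite ?natr1 ?pnatr_eq0.
  have n3 : 0 < n.+3%:R :> R by rewrite ltr0n.
  have ni : 0 < n.+1%:R^-1 :> R by rewrite invr_gt0.
  rewrite (cpow_1r e1) E1 E2 (cpowM _ n3 ni) (cpowV _ n0) cpowN cpowD (cpow_1r n0).
  rewrite rmorphM fmorphV !rmorph_nat.
  have f0 : (n.+1)`!%:R != 0 :> C by rewrite pnatr_eq0 -lt0n fact_gt0.
  have n1 : n.+1%:R != 0 :> C by rewrite pnatr_eq0.
  have c1 := cpow_neq0 (n.+1%:R : R) z; have c3 := cpow_neq0 (n.+3%:R : R) z.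
  move: (cpow n.+1%:R z) (cpow n.+3%:R z) c1 c3 => c d c1 d1.
  move: (_`!%:R : C) (n.+1%:R : C) (n.+2%:R : C) f0 n1 => f a b f0 a0.
  by field; rewrite f0 a0 c1 d1.
have -> : l = l * (1 * 1) by rewrite !mulr1.
apply: cvgM; last by apply: cvgM; apply: cpow1D_cvg.
apply/(cvg_succP (fun n => gauss z n.+1)).
exact/cvg_succP.
Qed.

Lemma rGamma_product m (r : R) z L : (0 < m)%N -> 1 <= r -> r < m.+1%:R -> nm z <= r ->
  has_sum (log_term (gamma_weight m) (- z)) L ->
  rGamma (z + 1) = rising_prod z m * cpow m%:R (- z) / cexp L.
Proof. by move=> m0 r1 rm zr /(gauss_cvg_exp m0 r1 rm zr) /gauss_cvg_rGamma. Qed.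

Lemma gamma_family (r : R) : 1 <= r -> exists m a L,
  [/\ (0 < m)%N, r < m.+1%:R, a 0%N = 0, power_series r a L &
      forall z, nm z <= r -> has_sum (log_term (gamma_weight m) z) (L z)].
Proof.
move=> r1; have r0 : 0 <= r by exact: le_trans r1.
pose m := (Num.truncn r).+1; have rm : r < m.+1%:R.
  by rewrite (lt_le_trans (truncnS_gt _))// ler_nat.
have th1 : r / m.+1%:R < 1 by rewrite ltr_pdivrMr ?ltr0n// mul1r.
have [a [L [a0 [ha hL]]]] := log_term_power_series (gamma_weight_ge0 m) r1 th1
  (fun k => gamma_weight_le m k r0) (sum_gamma_weight_sqr m).
by exists m, a, L.
Qed.

Lemma gauss_cvg z : (gauss z : nat -> R[i]^o) @ \oo --> (rGamma (z + 1) : R[i]^o).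
Proof.
pose r := Num.max 1 (nm z); have r1 : 1 <= r by rewrite le_max lexx.
have zr : nm z <= r by rewrite le_max lexx orbT.
have [m [a [L [m0 rm a0 ha hL]]]] := gamma_family r1.
have hLz := hL (- z); rewrite nmN in hLz.
rewrite (rGamma_product m0 r1 rm zr (hLz zr)).
exact: gauss_cvg_exp m0 r1 rm zr (hLz zr).
Qed.

Lemma gauss_rate (r : R) z n : nm z <= r ->
  nm (gauss z n - rGamma (z + 1))
  <= expR (2 * gauss_const r) * (2 * gauss_const r) / n.+1%:R.
Proof.
move=> zr; apply/ler_addgt0Pr => e e0.
have [N hN] := (cvg_nmP _ _).2 (@gauss_cvg z) e e0.
apply: (le_trans (nm_le_dist _ _ (gauss z (n + N)))); apply: lerD; last first.
  by apply: hN; exact: leq_addl.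
rewrite nm_distC; apply: (le_trans (gauss_dist n N zr)); apply: ler_wpM2l.
  have r0 : 0 <= r by apply: le_trans zr; exact: nm_ge0.
  by rewrite !mulr_ge0 ?expR_ge0// gauss_const_ge0.
by rewrite gerBl invr_ge0.
Qed.

Lemma rising_prod_power_series (r : R) m : 0 <= r ->
  exists a, power_series r a (fun z => rising_prod z m).
Proof.
move=> r0; elim: m => [|m [a ha]].
  exists (fun n => if n == 0%N then 1 else 0).
  apply: eq_power_series (power_series_monomial 1 0 r0) => z _.
  by rewrite /rising_prod big_ord0 mulr1.
eexists; have h := power_seriesD r0 (power_series_monomial 1 0 r0)
  (power_series_monomial (m.+1%:R^-1) 1 r0).
apply: eq_power_series (power_seriesM r0 ha h) => z _.
by rewrite /rising_prod big_ord_recr/= mulr1 [_ * z]mulrC.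
Qed.

Lemma cexp_linear_power_series (r : R) (c : C) : 0 <= r ->
  exists a, power_series r a (fun z => cexp (c * z)).
Proof.
move=> r0; have h := power_series_monomial c 1 r0.
by apply: (power_series_cexp r0 _ h).
Qed.

Lemma rGamma_power_series (r : R) : 1 <= r ->
  exists a, power_series r a (fun z => rGamma (z + 1)).
Proof.
move=> r1; have r0 : 0 <= r by exact: le_trans r1.
have [m [a [L [m0 rm a0 ha hL]]]] := gamma_family r1.
have [b hb] := rising_prod_power_series m r0.
have [c hc] := cexp_linear_power_series (- (ln m%:R)%:C) r0.
have hN := power_seriesN (power_series_oppz ha).
have [|d hd] := power_series_cexp r0 _ hN; first by rewrite a0 mul0r oppr0.
eexists; apply: eq_power_series (power_seriesM r0 (power_seriesM r0 hb hc) hd) => z zr.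
have hLz := hL (- z); rewrite nmN in hLz.
rewrite (rGamma_product m0 r1 rm zr (hLz zr)) /cpow [cexp (- L _)]cexpN.
by congr (_ * cexp _ / _); ring.
Qed.

End GammaLimit.

(** * Asymptotics of the rising factorials *)

Ltac ge0_tac := repeat first [done | exact: nm_ge0 | exact: expR_ge0 | apply: exprn_ge0
  | apply: mulr_ge0 | apply: addr_ge0].

Section CoefficientComparison.
Variable R : realType.
Local Notation C := R[i].
Implicit Types (z : C) (n k : nat) (c : nat -> C).

Lemma power_le_geometric (s : R) A : 1 < s ->
  exists2 K : R, 0 <= K & forall k, k.+1%:R ^+ A <= K * s ^+ k.
Proof.
move=> s1; have s0 : 0 < s by exact: lt_trans s1.
case: A => [|A].
  by exists 1 => // k; rewrite expr0 mul1r exprn_ege1// ltW.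
(* Chosen so that u (k + 1) <= 1 + k ln s / (A + 1) <= exp (k ln s / (A + 1)), whose power of
   exponent A + 1 is s^k. *)
pose u := Num.min 1 (ln s / A.+1%:R).
have u0 : 0 < u by rewrite lt_min ltr01 divr_gt0// ln_gt0.
exists (u^-1 ^+ A.+1) => [|k]; first by rewrite exprn_ge0// invr_ge0 ltW.
have -> : s ^+ k = expR (k%:R * (ln s / A.+1%:R)) ^+ A.+1.
  rewrite -expRM_natl mulrCA [A.+1%:R * _]mulrC divfK ?pnatr_eq0//.
  by rewrite expRM_natl lnK.
rewrite -exprMn lerXn2r// ?nnegrE ?mulr_ge0 ?expR_ge0 ?invr_ge0 ?(ltW u0)//.
rewrite ler_pdivlMl//; apply: le_trans (expR_ge1Dx _).
rewrite -natr1 mulrDr mulr1 addrC; apply: lerD; first by rewrite ge_min lexx.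
by rewrite mulrC ler_wpM2l// ge_min lexx orbT.
Qed.

(** These are the coefficients of (1 - u)^(-z). Their partial sums are those of (1 - u)^(- z - 1),
    namely [rising_prod z n], and the recurrence involves exactly these partial sums. *)
Lemma rising_coef z c : logrec (fun m => if m == 0%N then 0 else z) c ->
  forall n, c n.+1 = z * (rising_prod z n / n.+1%:R).
Proof.
move=> hc; pose a n : C := if n is m.+1 then z * (rising_prod z m / m.+1%:R) else 1.
have suma n : \sum_(i < n.+1) a i = rising_prod z n.
  elim: n => [|n IH]; first by rewrite big_ord1 /rising_prod big_ord0.
  rewrite big_ord_recr IH /= [RHS]/rising_prod big_ord_recr/= -/(rising_prod z n).
  by rewrite mulrDr mulr1; congr (_ + _); ring.
suff ha : logrec (fun m => if m == 0%N then 0 else z) a.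
  by move=> n; rewrite (logrec_unique hc ha).
split=> // -[|n]; first by rewrite /conv big_ord1 !mul0r.
rewrite /conv big_ord_recl/= mul0r add0r /a mulrC -mulrA divfK ?pnatr_eq0//.
rewrite -suma mulr_sumr (reindex_inj rev_ord_inj)/=; apply: eq_bigr => i _.
by rewrite /bump/= add1n !subSS.
Qed.

Lemma rising_coef_gauss z c : logrec (fun m => if m == 0%N then 0 else z) c ->
  forall n, c n.+1 = z * (gauss z n * cpow n.+1%:R (z - 1)).
Proof.
move=> hc n; rewrite (rising_coef hc) /gauss cpowD !cpowN.
rewrite (@cpow_1r _ n.+1%:R) ?ltr0n// rmorph_nat -mulrA; congr (_ * (_ * _)).
by rewrite mulrA mulVf ?cpow_neq0// mul1r.
Qed.

Lemma norm_ln1B_le (x : R) : 0 <= x <= 2^-1 -> `|ln (1 - x)| <= 2 * x.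
Proof.
move=> /andP[x0 x2]; have x1 : 0 < 1 - x by lra.
have h1 := ln_le_sub1 x1.
have := @ln_le_sub1 _ (1 - x)^-1; rewrite invr_gt0 x1 lnV ?posrE// => /(_ isT) h2.
have h3 : (1 - x)^-1 - 1 <= 2 * x.
  rewrite -subr_ge0; have -> : 2 * x - ((1 - x)^-1 - 1) = x * (1 - 2 * x) / (1 - x).
    by field; rewrite gt_eqF.
  by rewrite divr_ge0 ?(ltW x1)// mulr_ge0//; lra.
by move: h1 h2 h3; set l := ln _ => h1 h2 h3; rewrite ler_norml; apply/andP; split; lra.
Qed.

Lemma nm_cpow_ratio_le (r : R) A (j n : nat) z : nm z <= r -> (0 < j <= n)%N -> r + 1 <= A%:R ->
  nm (cpow (j%:R / n%:R) (z - 1)) <= n%:R ^+ A.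
Proof.
move=> zr /andP[j0 jn] rA; have n0 : (0 < n)%N by exact: leq_trans jn.
have n0R : 0 < n%:R :> R by rewrite ltr0n.
have ln0 : 0 <= ln (n%:R : R) by rewrite ln_ge0// ler1n.
rewrite nm_cpow -[X in X ^+ A]lnK// -expRM_natl ler_expR.
apply: (le_trans (ler_norm _)); rewrite normrM; apply: ler_pM => //.
  apply: (le_trans (Re_le_nm _)); apply: (le_trans (nmB _ _)); rewrite nm1.
  by apply: le_trans rA; rewrite lerD2r.
rewrite ln_div ?posrE ?ltr0n// distrC ger0_norm ?subr_ge0; last first.
  by rewrite ler_ln ?posrE ?ltr0n// ler_nat.
by rewrite gerBl ln_ge0// ler1n.
Qed.

Lemma nm_cpow_ratio_sub1_le (r : R) z n k : nm z <= r -> (0 < n)%N -> (2 * k <= n)%N ->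
  nm (cpow ((n - k)%:R / n%:R) (z - 1) - 1)
    <= (1 + 10%:R * (r + 1) * expR (r + 1)) * ((r + 1) * 2) * (k%:R / n%:R).
Proof.
move=> zr n0 kn; have r0 : 0 <= r by apply: le_trans zr; exact: nm_ge0.
have n0R : 0 < n%:R :> R by rewrite ltr0n.
have -> : (n - k)%:R / n%:R = 1 - k%:R / n%:R :> R.
  by rewrite natrB ?mulrBl ?divff ?gt_eqF//; lia.
have x01 : 0 <= (k%:R / n%:R : R) <= 2^-1.
  rewrite divr_ge0//= ler_pdivrMr// mulrC ler_pdivlMr//.
  by rewrite -natrM ler_nat; lia.
have hl := norm_ln1B_le x01.
have hw : nm ((z - 1) * (ln (1 - k%:R / n%:R))%:C) <= (r + 1) * 2 * (k%:R / n%:R).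
  rewrite nmM nmC -mulrA ler_pM ?nm_ge0//; apply: (le_trans (nmB _ _)).
  by rewrite nm1 lerD2r.
have hw1 : nm ((z - 1) * (ln (1 - k%:R / n%:R))%:C) <= r + 1.
  apply: (le_trans hw); rewrite -mulrA ler_piMr ?addr_ge0//.
  by case/andP: x01; lra.
apply: (le_trans (cexp_linear hw1)); rewrite -[leRHS]mulrA ler_wpM2l//.
by rewrite addr_ge0// !mulr_ge0 ?expR_ge0 ?addr_ge0.
Qed.

(** The estimate covers every [k], with 0 replacing the coefficient when k > n, so that it can be
    summed directly against the coefficients of G. Growth polynomial in [k] is harmless because
    these decay geometrically. *)
Lemma rising_coef_asymptotic (r : R) : 1 <= r -> exists K A, 0 <= K /\
  forall z c, nm z <= r -> logrec (fun m => if m == 0%N then 0 else z) c ->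
  forall n k, (0 < n)%N ->
  nm ((if (k <= n)%N then c (n - k)%N * cpow n%:R (1 - z) else 0) - z * rGamma (z + 1))
    <= K * k.+1%:R ^+ A / n%:R.
Proof.
move=> r1; have r0 : 0 <= r by exact: le_trans r1.
(* Constants are kept opaque, with an equation, to keep the arithmetic small. [K2] is the rate of
   [gauss], [Kg] bounds [gauss], [K1] bounds [rGamma] by comparison with [gauss z 0 = 1], [D]
   controls ((n - k) / n)^(z - 1) - 1; [Kn] and [Kf] serve 2k <= n and 2k > n. *)
have [K2 K2E] : exists x : R, x = expR (2 * gauss_const r) * (2 * gauss_const r) by eexists.
have [Kg KgE] : exists x : R, x = expR (2 * gauss_const r) by eexists.
have c0 := gauss_const_ge0 r0.
have K20 : 0 <= K2 by rewrite K2E !mulr_ge0 ?expR_ge0.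
have Kg0 : 0 <= Kg by rewrite KgE expR_ge0.
have [K1 K1E] : exists x : R, x = 1 + K2 by eexists.
have K10 : 0 <= K1 by rewrite K1E addr_ge0.
have [D DE] : exists x : R, x = (1 + 10%:R * (r + 1) * expR (r + 1)) * ((r + 1) * 2) by eexists.
have D0 : 0 <= D.
  by rewrite DE mulr_ge0 ?mulr_ge0 ?addr_ge0// ?mulr_ge0 ?expR_ge0 ?addr_ge0.
(* [A] bounds |z - 1|, so that (j / n)^(z - 1) is at most n^A. The extra power in [A.+1] pays for
   the factor 1/n when n < 2 (k + 1). *)
pose A := (Num.truncn (r + 1)).+1.
have rA : r + 1 <= A%:R by rewrite ltW// truncnS_gt.
have [Kn KnE] : exists x : R, x = r * (2 * K2 + (2 * K2 + K1) * D) by eexists.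
have [Kf KfE] : exists x : R, x = (1 + r * Kg) * 2 ^+ A.+1 + r * K1 * 2 by eexists.
have Kn0 : 0 <= Kn by rewrite KnE; ge0_tac.
have Kf0 : 0 <= Kf by rewrite KfE; ge0_tac.
exists (Kn + Kf), A.+1; split; first by rewrite addr_ge0.
move=> z c zr hc n k n0; have n0R : 0 < n%:R :> R by rewrite ltr0n.
have G1 : nm (rGamma (z + 1)) <= K1.
  have := gauss_rate 0 zr; rewrite invr1 mulr1 nm_distC => h.
  have := le_nmB (rGamma (z + 1)) (gauss z 0).
  rewrite {1}/gauss /rising_prod big_ord0 cpow1 mul1r nm1 => h2.
  by rewrite K1E K2E -lerBlDl (le_trans h2).
have zG : nm (z * rGamma (z + 1)) <= r * K1 by rewrite nmM ler_pM ?nm_ge0.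
have k1A : k.+1%:R <= (k.+1%:R : R) ^+ A.+1 by rewrite ler_eXnr// ler1n.
have far : (n < 2 * k.+1)%N -> nm (z * rGamma (z + 1)) <= r * K1 * 2 * k.+1%:R ^+ A.+1 / n%:R.
  move=> nk; apply: (le_trans zG); rewrite ler_pdivlMr// -[leRHS]mulrA ler_wpM2l ?mulr_ge0//.
  apply: (@le_trans _ _ (2 * k.+1%:R)).
    by rewrite -natrM ler_nat ltnW.
  by rewrite ler_wpM2l.
have Kmono (a b : R) : a <= b -> a * k.+1%:R ^+ A.+1 / n%:R <= b * k.+1%:R ^+ A.+1 / n%:R.
  by move=> ab; rewrite ler_wpM2r ?invr_ge0 ?ler0n// ler_wpM2r ?exprn_ge0.
have [kn2|kn2] := leqP (2 * k) n.
  have kn : (k < n)%N by move: kn2 n0; clear; lia.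
  rewrite (ltnW kn).
  have [j jE] : exists j, (n - k = j.+1)%N by exists (n - k).-1; move: kn; clear; lia.
  have cpE : cpow (n%:R : R) (1 - z) = (cpow n%:R (z - 1))^-1.
    by rewrite -[1 - z]opprB; exact: cpowN.
  have njR : 0 < (j.+1)%:R :> R by rewrite ltr0n.
  have niR : 0 < n%:R^-1 :> R by rewrite invr_gt0.
  have cE : c (n - k)%N * cpow n%:R (1 - z) = z * (gauss z j * cpow ((n - k)%:R / n%:R) (z - 1)).
    rewrite jE (rising_coef_gauss hc) cpE (cpowM _ njR niR) (cpowV _ n0R).
    by move: (cpow _ _) (cpow _ _) (gauss z j) => a b g; rewrite !mulrA.
  rewrite cE -mulrBr nmM.
  have N1 := nm_cpow_ratio_sub1_le zr n0 kn2; rewrite -DE in N1.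
  set p := cpow _ _ in N1 *.
  have -> : gauss z j * p - rGamma (z + 1)
      = (gauss z j - rGamma (z + 1)) + gauss z j * (p - 1) by ring.
  have hj := gauss_rate j zr; rewrite -K2E in hj.
  have j2 : K2 / j.+1%:R <= 2 * K2 / n%:R.
    rewrite [2 * K2]mulrC -mulrA ler_wpM2l// ler_pdivlMr// mulrC ler_pdivrMr//.
    by rewrite -natrM ler_nat; move: jE kn2; clear; lia.
  have gj : nm (gauss z j) <= 2 * K2 + K1.
    rewrite -(subrK (rGamma (z + 1)) (gauss z j)) (le_trans (nmD _ _))// lerD//.
    apply: (le_trans hj); rewrite ler_pdivrMr//; apply: (@le_trans _ _ (2 * K2)).
      by rewrite ler_peMl// ler1n.
    by rewrite ler_peMr ?mulr_ge0// ler1n.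
  apply: (@le_trans _ _ (r * ((2 * K2 / n%:R) + (2 * K2 + K1) * (D * (k%:R / n%:R))))).
    apply: ler_pM; rewrite ?nm_ge0//; apply: (le_trans (nmD _ _)); apply: lerD.
      exact: le_trans j2.
    by rewrite nmM ler_pM ?nm_ge0.
  apply: le_trans (Kmono Kn _ _); last by rewrite lerDl.
  rewrite [leRHS]mulrAC -[X in X <= _]mulr1.
  have k1 : 1 <= (k.+1%:R : R) by rewrite ler1n.
  have kk : k%:R <= (k.+1%:R : R) ^+ A.+1 by apply: le_trans k1A; rewrite ler_nat.
  have k1' : 1 <= (k.+1%:R : R) ^+ A.+1 by exact: le_trans k1A.
  move: (k.+1%:R ^+ A.+1) kk k1' => kA kk k1'.
  rewrite mulr1 KnE -!mulrA ler_wpM2l// [leRHS]mulrDl; apply: lerD.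
    rewrite !mulrA ler_peMr// !mulr_ge0 ?invr_ge0 ?ler0n//.
  have -> : (2 * K2 + K1) * D * (n%:R^-1 * kA)
      = ((2 * K2 + K1) * D) * (kA / n%:R) by ring.
  have -> : (2 * K2 + K1) * (D * (k%:R / n%:R))
      = ((2 * K2 + K1) * D) * (k%:R / n%:R) by ring.
  rewrite ler_wpM2l ?mulr_ge0 ?addr_ge0 ?mulr_ge0//.
  by rewrite ler_wpM2r ?invr_ge0 ?ler0n.
have nk : (n < 2 * k.+1)%N by move: kn2; clear; lia.
have farA := far nk.
apply: le_trans (Kmono Kf _ _); last by rewrite lerDr.
have nA : n%:R ^+ A <= 2 ^+ A.+1 / n%:R * k.+1%:R ^+ A.+1 :> R.
  rewrite mulrAC ler_pdivlMr// -exprSr -exprMn lerXn2r// ?nnegrE ?mulr_ge0//.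
  by rewrite -natrM ler_nat ltnW.
suff near : nm (if (k <= n)%N then c (n - k)%N * cpow n%:R (1 - z) else 0)
    <= (1 + r * Kg) * n%:R ^+ A.
  apply: (le_trans (nmB _ _)); apply: (le_trans (lerD near farA)).
  have -> : Kf * k.+1%:R ^+ A.+1 / n%:R = (1 + r * Kg) *
      (2 ^+ A.+1 / n%:R * k.+1%:R ^+ A.+1) + r * K1 * 2 * k.+1%:R ^+ A.+1 / n%:R.
    by rewrite KfE; move: (k.+1%:R ^+ A.+1) (2 ^+ A.+1) (n%:R^-1) => u v w; ring.
  by rewrite lerD2r ler_wpM2l// addr_ge0// mulr_ge0.
case: ifP => [kn|_]; last by rewrite nm0 mulr_ge0 ?exprn_ge0 ?addr_ge0 ?mulr_ge0.
have cpE : cpow (n%:R : R) (1 - z) = cpow (1%:R / n%:R) (z - 1).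
  by rewrite div1r (cpowV _ n0R) -[1 - z]opprB; exact: cpowN.
have [nk0|nk0] := posnP (n - k)%N.
  rewrite nk0 hc.1 mul1r cpE mulrDl mul1r ler_wpDr ?mulr_ge0 ?exprn_ge0//.
  by apply: (nm_cpow_ratio_le zr _ rA); rewrite n0.
have [j jE] : exists j, (n - k = j.+1)%N by exists (n - k).-1; rewrite prednK.
have njR : 0 < (j.+1)%:R :> R by rewrite ltr0n.
have niR : 0 < n%:R^-1 :> R by rewrite invr_gt0.
have cE : c (n - k)%N * cpow n%:R (1 - z) = z * (gauss z j * cpow ((n - k)%:R / n%:R) (z - 1)).
  rewrite jE (rising_coef_gauss hc) -[1 - z]opprB cpowN (cpowM _ njR niR) (cpowV _ n0R).
  by move: (cpow _ _) (cpow _ _) (gauss z j) => a b g; rewrite !mulrA.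
rewrite cE nmM [nm (gauss _ _ * _)]nmM [leRHS]mulrDl mul1r ler_wpDl ?exprn_ge0//.
rewrite -[leRHS]mulrA.
apply: ler_pM; rewrite ?mulr_ge0 ?nm_ge0//; apply: ler_pM; rewrite ?nm_ge0//.
  apply: (le_trans (gauss_bound j zr)); rewrite KgE ler_expR ler_piMr ?mulr_ge0//.
by apply: (nm_cpow_ratio_le zr _ rA); rewrite nk0 leq_subr.
Qed.

End CoefficientComparison.

(** * The Euler product and the mean value *)

Section EulerProduct.
Variables (R : realType) (F : finFieldType).
Local Notation C := R[i].
Implicit Types (z : C) (p : {poly F}).
Let q : nat := #|F|.

Local Notation qweight := (@prime_weight R F q%:R^-1).

Lemma card_ge2 : (2 <= q)%N.
Proof. exact: card_finNzRing_gt1. Qed.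

Let q_gt0 : 0 < q%:R :> R.
Proof. by rewrite ltr0n; exact: leq_trans card_ge2. Qed.

(** Degree at least 2 gives weight at most y^2; at y = 1/q this is the origin of the radius q^2. *)
Lemma prime_weight_le (y r : R) p : 0 <= y -> q%:R * y ^+ 2 < 1 -> 0 <= r ->
  prime_weight y p * r <= y ^+ 2 * r.
Proof.
move=> y0 qy r0; rewrite ler_wpM2r// /prime_weight.
case: ifP => [/andP[_ p2]|_]; last exact: sqr_ge0.
have y1 : y <= 1.
  rewrite -(@expr_le1 _ 2)//; apply: ltW; apply: le_lt_trans qy.
  by rewrite ler_peMl ?sqr_ge0// ler1n; exact: leq_trans card_ge2.
by rewrite -(subnK p2) addnC exprD ler_piMr ?sqr_ge0// exprn_ile1.
Qed.

Let qV_lt1 : q%:R * (q%:R^-1 : R) ^+ 2 < 1.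
Proof.
rewrite expr2 mulrA divff ?gt_eqF// mul1r invf_lt1// ltr1n; exact: card_ge2.
Qed.

Let qV_ge0 : 0 <= (q%:R^-1 : R). Proof. by rewrite invr_ge0. Qed.

Let qV_r (r : R) : r < (q ^ 2)%:R -> (q%:R^-1 : R) ^+ 2 * r < 1.
Proof. by move=> rq; rewrite exprVn mulrC ltr_pdivrMr ?exprn_gt0// mul1r -natrX. Qed.

Lemma euler_partialE z (A : {fset {poly F}}) : euler_partial F z A =
  \prod_(p <- A) ((1 - z * (prime_weight q%:R^-1 p)%:C)^-1
    * cpow (1 - prime_weight q%:R^-1 p) z).
Proof.
rewrite /euler_partial big_mkcond; apply: eq_bigr => p _; rewrite /prime_weight.
case: ifP => _; last by rewrite mulr0 !subr0 invr1 mul1r cpow1.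
by rewrite /euler_factor exprVn -natrX fmorphV rmorph_nat.
Qed.

Lemma euler_product_cvg (r : R) z L : 1 <= r -> r < (q ^ 2)%:R -> nm z <= r ->
  has_sum (log_term qweight z) L ->
  euler_partial F z @ totally --> (cexp L : R[i]^o).
Proof.
move=> r1 rq zr hL; have r0 : 0 <= r by exact: le_trans r1.
have hA := log_term_product (fun p => prime_weight_ge0 p qV_ge0) r1 (qV_r rq)
  (fun p => prime_weight_le p qV_ge0 qV_lt1 r0) zr hL.
have totallyF := @totally_filter {poly F}.
apply/cvgrPdist_le => e e0.
have [e1 eE] : exists e1 : R, e = e1%:C.
  by apply/complex_realP; rewrite realE ltW.
move: e0; rewrite eE ltcR => /hA[A0 hA0].
by exists A0 => // A /= /hA0; rewrite distrC nmE lecR euler_partialE.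
Qed.

Lemma euler_productE (r : R) z L : 1 <= r -> r < (q ^ 2)%:R -> nm z <= r ->
  has_sum (log_term qweight z) L -> euler_product F z = cexp L.
Proof.
move=> r1 rq zr hL; have totallyF := @totally_filter {poly F}.
exact: (@cvg_lim R[i]^o (@norm_hausdorff _ R[i]^o) _ _ _ _ _ (euler_product_cvg r1 rq zr hL)).
Qed.

Lemma prime_log_power_series (r : R) : 1 <= r -> r < (q ^ 2)%:R ->
  exists a L, a 0%N = 0 /\ power_series r a L /\
    forall z, nm z <= r -> has_sum (log_term qweight z) (L z).
Proof.
move=> r1 rq; have r0 : 0 <= r by exact: le_trans r1.
exact: (log_term_power_series (fun p => prime_weight_ge0 p qV_ge0) r1 (qV_r rq)
  (fun p => prime_weight_le p qV_ge0 qV_lt1 r0) (sum_prime_weight_sqr_le qV_ge0 qV_lt1)).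
Qed.

Lemma h_power_series (r : R) : 1 <= r -> r < (q ^ 2)%:R ->
  exists a, power_series r a (h F).
Proof.
move=> r1 rq; have r0 : 0 <= r by exact: le_trans r1.
have [a ha] := rGamma_power_series r1.
have [b hb] := cexp_linear_power_series (q%:R * (ln (1 - q%:R^-1))%:C) r0.
have [c [L [c0 [hc hL]]]] := prime_log_power_series r1 rq.
have [d hd] := power_series_cexp r0 c0 hc.
eexists; apply: eq_power_series (power_seriesM r0 (power_seriesM r0 ha hb) hd) => z zr.
rewrite /h (euler_productE r1 rq zr (hL z zr)) /cpow.
by congr (_ * cexp _ * _); rewrite -/q; ring.
Qed.

Lemma radius_between z : nm z < (q ^ 2)%:R ->
  exists r : R, [/\ 1 <= r, nm z < r & r < (q ^ 2)%:R].
Proof.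
move=> zq; exists ((Num.max 1 (nm z) + (q ^ 2)%:R) / 2).
have q4 : 4%:R <= (q ^ 2)%:R :> R by rewrite ler_nat (leq_sqr 2) card_ge2.
have m1 : Num.max 1 (nm z) < (q ^ 2)%:R by rewrite gt_max zq andbT; lra.
have m2 : 1 <= Num.max 1 (nm z) by rewrite le_max lexx.
have m3 : nm z <= Num.max 1 (nm z) by rewrite le_max lexx orbT.
by move: m1 m2 m3; set m := Num.max _ _ => m1 m2 m3; split; lra.
Qed.

(** * The mean value, uniformly on a closed disc of radius [rho] *)

Section MeanValue.
Variable rho : R.
Hypotheses (rho_ge : q%:R <= rho) (rho_lt : rho < (q ^ 2)%:R).

Let rho_gt0 : 0 < rho. Proof. exact: lt_le_trans rho_ge. Qed.

Let rho_ge1 : 1 <= rho.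
Proof. by apply: le_trans rho_ge; rewrite ler1n; exact: leq_trans card_ge2. Qed.

Definition prime_lam z (m : nat) : C := if m == 0%N then 0 else
  (m%:R * prime_fiber F m z - z * q%:R) * q%:R^-1 ^+ m.

Lemma prime_lam_divE z (m : nat) :
  prime_lam z m / m%:R = (q%:R^-1 ^+ m)%:C * prime_fiber F m z
    - z * q%:R * ((q%:R^-1 : R) ^+ m / m%:R)%:C.
Proof.
rewrite /prime_lam rmorphM [X in _ - _ * (_ * X)]fmorphV rmorph_nat.
rewrite !rmorphXn fmorphV rmorph_nat.
case: m => [|m] /=.
  rewrite invr0 !mulr0 subr0 /prime_fiber big1 ?mulr0// => p _.
  by rewrite big_ord0.
have m0 : m.+1%:R != 0 :> C by rewrite pnatr_eq0.
by move: (m.+1%:R : C) m0 (_ ^+ _) => u u0 v; field.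
Qed.

Lemma prime_fiber_sum_le (y : R) z n : 0 <= y -> y ^+ 2 * rho < 1 -> q%:R * y ^+ 2 < 1 ->
  nm z <= rho ->
  \sum_(m < n) nm ((y ^+ m)%:C * prime_fiber F m z)
  <= 2 * ((1 - q%:R * y ^+ 2)^-1 * (rho ^+ 2 / (1 - y ^+ 2 * rho))).
Proof.
move=> y0 yrho qy zr.
rewrite -(big_fset_iota (fun m => nm ((y ^+ m)%:C * prime_fiber F m z)) _ (@inj_id nat)).
have h := log_term_sum_le (fun p => prime_weight_ge0 p y0) rho_ge1 yrho
  (fun p => prime_weight_le p y0 qy (ltW rho_gt0)) (sum_prime_weight_sqr_le y0 qy) zr.
have hs := sum_le_fiber (pi := fun x => (x.2 * deg x.1)%N) h (has_sum_prime_fiber F y z).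
exact: (hs _).
Qed.

Lemma prime_lam_bound : exists s : R, 1 < s /\ exists B : R, forall z, nm z <= rho ->
  forall n, \sum_(i < n) nm (prime_lam z i * s%:C ^+ i) / i%:R <= B.
Proof.
(* The radius [s / q] must exceed [1 / q] while [(s / q)^2 * rho < 1]. *)
pose t := 1 - rho / (q ^ 2)%:R.
have qq0 : 0 < (q ^ 2)%:R :> R by rewrite natrX exprn_gt0.
have t0 : 0 < t by rewrite subr_gt0 ltr_pdivrMr// mul1r.
have t1 : t < 1 by rewrite gtrBl divr_gt0.
(* The gap [t] between [rho] and q^2 leaves room for [s > 1]: (1 + t/4)^2 (1 - t) < 1. *)
pose s := 1 + t / 4%:R; have s1 : 1 < s by rewrite ltrDl divr_gt0.
exists s; split=> //; have s0 : 0 < s by exact: lt_trans s1.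
pose y := s / q%:R; have y0 : 0 <= y by rewrite divr_ge0// ltW.
have yrho : y ^+ 2 * rho < 1.
  have -> : y ^+ 2 * rho = s ^+ 2 * (1 - t).
    by rewrite /y /t natrX; field; rewrite gt_eqF.
  rewrite /s; have : 0 < t ^+ 2 by rewrite exprn_gt0.
  have : 0 < t ^+ 3 by rewrite exprn_gt0.
  have -> : (1 + t / 4%:R) ^+ 2 * (1 - t)
      = 1 - (t / 2 + 7%:R / 16%:R * t ^+ 2 + t ^+ 3 / 16%:R) by field.
  by move=> ? ?; rewrite gtrBl; lra.
have qy : q%:R * y ^+ 2 < 1.
  by apply: le_lt_trans yrho; rewrite mulrC ler_wpM2l// sqr_ge0.
have y1 : y < 1.
  rewrite -(@expr_lt1 _ 2)//; apply: le_lt_trans qy.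
  by rewrite ler_peMl ?sqr_ge0// ler1n; exact: leq_trans card_ge2.
exists (2 * ((1 - q%:R * y ^+ 2)^-1 * (rho ^+ 2 / (1 - y ^+ 2 * rho)))
  + rho * q%:R * (1 - y)^-1) => z zr n.
have hgeo : \sum_(i < n) y ^+ i <= (1 - y)^-1 by apply: geometric_sum_le; rewrite y0.
apply: le_trans (lerD (prime_fiber_sum_le n y0 yrho qy zr)
  (ler_wpM2l _ hgeo)); last by rewrite mulr_ge0// ltW.
rewrite mulr_sumr -big_split/=; apply: ler_sum => i _.
have yE : y ^+ i = q%:R^-1 ^+ i * s ^+ i by rewrite -exprMn mulrC.
have -> : nm (prime_lam z i * s%:C ^+ i) / i%:R
    = nm (prime_lam z i / i%:R * (s ^+ i)%:C).
  by rewrite !nmM nmV nm_nat nmX !nmC normrX mulrAC.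
rewrite prime_lam_divE mulrBl; apply: (le_trans (nmB _ _)); apply: lerD.
  by rewrite yE rmorphM mulrAC.
have -> : z * q%:R * (q%:R^-1 ^+ i / i%:R)%:C * (s ^+ i)%:C = z * q%:R * (y ^+ i / i%:R)%:C.
  by rewrite yE !rmorphM; ring.
rewrite nmM nmC ger0_norm ?divr_ge0 ?exprn_ge0//.
rewrite nmM nm_nat; apply: ler_pM; rewrite ?mulr_ge0 ?nm_ge0 ?divr_ge0 ?exprn_ge0//.
  by rewrite ler_wpM2r.
case: i {yE} => -[|i] /= _; first by rewrite invr0 mulr0 expr0.
by rewrite ler_pdivrMr ?ltr0n// ler_peMr ?exprn_ge0// ler1n.
Qed.

(** The value of log G at 1/q: the terms [prime_fiber] regroup into the logarithm of the Euler
    product, and those of the q linear primes sum to q z log (1 - 1/q). *)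
Lemma prime_lam_has_sum z : nm z <= rho ->
  exists2 S, has_sum (fun m => prime_lam z m / m%:R) S &
    cexp S = cpow (1 - q%:R^-1) (q%:R * z) * euler_product F z.
Proof.
move=> zr; have [_ [L [_ [_ hL]]]] := prime_log_power_series rho_ge1 rho_lt.
have hLz := hL z zr.
have hf : has_sum (fun m => (q%:R^-1 ^+ m)%:C * prime_fiber F m z) (L z).
  exact: (has_sum_fiber (pi := fun x => (x.2 * deg x.1)%N) hLz (has_sum_prime_fiber F _ z)).
have hl : has_sum (fun m => ((q%:R^-1 : R) ^+ m / m%:R)%:C) (- ln (1 - q%:R^-1))%:C.
  apply: neg_ln_has_sum; rewrite qV_ge0/= invf_lt1// ltr1n; exact: card_ge2.
exists (L z - z * q%:R * (- ln (1 - q%:R^-1))%:C).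
  have := has_sumB hf (has_sumZ (z * q%:R) hl); congr has_sum.
  by apply/funext => m; rewrite prime_lam_divE.
rewrite cexpD (euler_productE rho_ge1 rho_lt zr hLz) mulrC; congr (_ * _).
by rewrite /cpow; congr cexp; rewrite rmorphN; ring.
Qed.

Lemma Mtilde_sum_estimate : exists K : R, forall (n : nat) z, (0 < n)%N -> nm z <= rho ->
  nm (Mtilde_sum F n z / ((#|F| ^ n)%:R * cpow n%:R (z - 1)) - z * h F z) <= K / n%:R.
Proof.
have [s [s1 [B hB]]] := prime_lam_bound.
have [K [A [K0 hK]]] := rising_coef_asymptotic rho_ge1.
have [K' K'0 hK'] := power_le_geometric A s1.
exists (K * K' * expR B) => n z n0 zr.
have n0R : 0 < n%:R :> R by rewrite ltr0n.
have [|c hc] := @logrec_exists C (fun m => if m == 0%N then 0 else z); first by [].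
have [|b hb] := @logrec_exists C (prime_lam z); first by [].
have s0 : 0 < s by exact: lt_trans s1.
have hbs := logrec_sum_nm_le (logrec_scale s%:C hb) (hB z zr).
have [S hS eS] := prime_lam_has_sum zr.
have hB1 m : \sum_(i < m) nm (prime_lam z i) / i%:R <= B.
  apply: le_trans (hB z zr m); apply: ler_sum => i _.
  rewrite ler_wpM2r ?invr_ge0// nmM nmX nmC (ger0_norm (ltW s0)).
  by rewrite ler_peMr ?nm_ge0// exprn_ege1// ltW.
have hG := logrec_has_sum_cexp hb hB1 hS; rewrite eS in hG.
pose w := z * rGamma (z + 1).
(* As G(1/q) is the sum of all [b k], the whole error is the one series of terms [b k * d k]; for k
   > n, [d k] is [- w], so the tail needs no separate treatment. *)
pose d k := (if (k <= n)%N then c (n - k)%N * cpow n%:R (1 - z) else 0) - w.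
have -> : Mtilde_sum F n z / ((#|F| ^ n)%:R * cpow n%:R (z - 1)) - z * h F z
    = conv b c n * cpow n%:R (1 - z)
      - w * (cpow (1 - q%:R^-1) (q%:R * z) * euler_product F z).
  rewrite (Mtilde_sum_conv n hc hb) -[1 - z]opprB cpowN natrX.
  have q0 : (q%:R : C) ^+ n != 0 by rewrite expf_neq0// pnatr_eq0; have := card_ge2; case: (q).
  have p0 := cpow_neq0 (n%:R : R) (z - 1).
  rewrite /h -/q /w; move: (cpow _ (z - 1)) p0 (cpow _ (q%:R * z)) (_ ^+ n) q0 => u u0 v t t0.
  by field; rewrite u0 t0.
have hd : has_sum (fun k => b k * d k) (conv b c n * cpow n%:R (1 - z)
      - w * (cpow (1 - q%:R^-1) (q%:R * z) * euler_product F z)).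
  have hfin : has_sum (fun k => if (k <= n)%N then b k * (c (n - k)%N * cpow n%:R (1 - z)) else 0)
      (conv b c n * cpow n%:R (1 - z)).
    pose g k := if (k <= n)%N then b k * (c (n - k)%N * cpow n%:R (1 - z)) else 0.
    have -> : conv b c n * cpow n%:R (1 - z) = \sum_(k < n.+1) g k.
      rewrite /conv mulr_suml; apply: eq_bigr => k _.
      by rewrite /g -ltnS ltn_ord mulrA.
    rewrite -(big_fset_iota g _ (@inj_id nat)); apply: has_sum_finite => k kn.
    rewrite /g ifF//; apply: contraNF kn => kn; apply/imfsetP; exists k => //.
    by change (k \in iota 0 n.+1); rewrite mem_iota leq0n ltnS.
  have := has_sumB hfin (has_sumZ w hG); congr has_sum; apply/funext => k.
  by rewrite /d; case: ifP => _; rewrite mulrBr ?mulr0 [b k * w]mulrC.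
apply: (has_sum_nm_le hd) => D.
apply: (@le_trans _ _ (\sum_(k <- D) K * K' / n%:R * nm (b k * s%:C ^+ k))).
  apply: ler_sum => k _; rewrite nmM [nm (b k * _)]nmM nmX nmC (ger0_norm (ltW s0)).
  have -> : K * K' / n%:R * (nm (b k) * s ^+ k) = nm (b k) * (K * (K' * s ^+ k) / n%:R).
    by move: (s ^+ k) => t; ring.
  rewrite ler_wpM2l ?nm_ge0//; apply: (le_trans (hK z c zr hc n k n0)).
  by rewrite ler_wpM2r ?invr_ge0 ?ler0n// ler_wpM2l.
rewrite -mulr_sumr [leRHS]mulrAC ler_wpM2l//.
by rewrite divr_ge0// mulr_ge0.
Qed.

End MeanValue.
End EulerProduct.

Theorem proposition1p4 (R : realType) (F : finFieldType) :
  (forall z : R[i], `|z| < (#|F| ^ 2)%:R ->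
     cvg (euler_partial F z @ totally) /\ analytic_at (h F) z) /\
  (forall delta : R, 0 < delta < 1 ->
     exists (K : R) (E : nat -> R[i] -> R[i]),
       forall (n : nat) (z : R[i]),
         (1 <= n)%N -> `|z| <= ((#|F| ^ 2)%:R - delta)%:C ->
         Mtilde_sum F n z
           = (#|F| ^ n)%:R * cpow n%:R (z - 1) * (z * h F z + E n z)
         /\ `|E n z| <= (K / n%:R)%:C).
Proof.
split=> [z zq|delta /andP[d0 d1]].
  have zq' : nm z < (#|F| ^ 2)%:R.
    by rewrite -ltcR -nmE rmorph_nat.
  have [r [r1 zr rq]] := radius_between zq'.
  split; last by have [a ha] := h_power_series r1 rq; exact: power_series_analytic ha zr.
  have [_ [L [_ [_ hL]]]] := prime_log_power_series r1 rq.
  apply/cvg_ex; exists (cexp (L z)).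
  exact: (euler_product_cvg r1 rq (ltW zr) (hL z (ltW zr))).
pose rho : R := (#|F| ^ 2)%:R - delta.
have rho_lt : rho < (#|F| ^ 2)%:R by rewrite gtrBl.
(* This uses delta < 1 together with q + 1 <= q^2. *)
have rho_ge : #|F|%:R <= rho.
  have : (#|F|.+1%:R : R) <= (#|F| ^ 2)%:R.
    by rewrite ler_nat; have := card_ge2 F; nia.
  by rewrite /rho -natr1; move: ((_ ^ 2)%:R : R) (#|F|%:R : R) => a b; lra.
have [K hK] := Mtilde_sum_estimate rho_ge rho_lt.
exists K, (fun n z => Mtilde_sum F n z / ((#|F| ^ n)%:R * cpow n%:R (z - 1)) - z * h F z).
move=> n z n0 zr; split.
  rewrite [z * h F z + _]addrC subrK mulrC divfK// mulf_neq0 ?cpow_neq0//.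
  by rewrite pnatr_eq0 expn_eq0 negb_and; have := card_ge2 F; case: #|F|.
by rewrite nmE lecR; apply: hK => //; rewrite -lecR -nmE.
Qed.
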